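(* There is an absolute constant $C_0>0$ such that the following holds. Assume: (a) $d\le n$ and $\eta_1 := C_0\sigma_x^2\sqrt{d/n}<\tfrac12$; (b) $r_d(\Sigma)/n\le C_1$ for a constant $C_1>0$; (c) for some constant $0<\delta_1<1$, $\dfrac{\Vert\theta^*_{(d+1):p}\Vert^2_{\Sigma_{(d+1):p}}}{\Vert\theta^*_{1:d}\Vert^2_{\Sigma_{1:d}^{-1}}}\le \dfrac{\delta_1}{4(1+\sigma_x^2)}\lambda_{d+1}^2$. Let $A_0$ be a constant with $A_0\ge1$ and $(1+A_0)^2<4\delta_1^{-1}$. Assume further that $\sigma^2\asymp1$ and $\Vert\theta^*_{1:d}\Vert^2_{\Sigma_{1:d}^{-1}}\lambda_d^2\asymp1$. (i) A sufficient condition for $\mathrm{MSE}_{\mathrm{in}}=O(\frac dn)$ with a probability approaching 1 as $n\to\infty$ is that $$\frac{\lambda_{d+1}}{\lambda_d}\lesssim\sqrt{\frac dn}\min\Big\{1,\sqrt{\frac{d}{r_d(\Sigma)}}\Big\}$$ and the ridge parameter $\tau$ is chosen in the range $A_0^{-1}\lambda_{d+1}\le\tau\le A_0\lambda_{d+1}$ if $r_d(\Sigma)\le d$, or in the range $$A_0^{-1}\lambda_{d+1}\max\Big\{\frac1c\sqrt{\frac{r_d(\Sigma)}{d}},1\Big\}\le\tau\le A_0\lambda_d\min\Big\{c\sqrt{\frac dn},1\Big\}$$ if $r_d(\Sigma)>d$, where $c\ge1$ is a constant satisfying $\frac{\lambda_{d+1}}{\lambda_d}\le c\sqrt{\frac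 dn}\min\{1,\sqrt{\frac{d}{r_d(\Sigma)}}\}$. (ii) Suppose that $n\gg d$, $\frac{r_d(\Sigma)}{n}\sqrt{\frac nd}\gg1$ and $64\frac{\sqrt{\delta_1}}{1-\sqrt{\delta_1}}<1$. Then a necessary condition for $\mathrm{MSE}_{\mathrm{in}}=O(\frac dn)$ with a probability bounded away from $0$ is that $\frac{\lambda_{d+1}}{\lambda_d}\lesssim\frac{d}{r_d(\Sigma)}$ and the ridge parameter $\tau$ is chosen in the range $\lambda_{d+1}\frac{r_d(\Sigma)}{n}\sqrt{\frac nd}\lesssim\tau\lesssim\lambda_d\sqrt{\frac dn}$. In the case where $n\gg d$ and $r_d(\Sigma)\asymp n$ in addition to the assumptions stated (including those of (ii)), the sufficient and necessary conditions on $\frac{\lambda_{d+1}}{\lambda_d}$ become matched: $\frac{\lambda_{d+1}}{\lambda_d}\lesssim\frac{d}{r_d(\Sigma)}$.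
   Context: Model. Let $1\le d<p$ be integers. The data $(y_1,x_1),\dots,(y_n,x_n)$ are i.i.d. from $y_i=x_i^\top\theta^*+\epsilon_i$, where $\theta^*\in\mathbb R^p$, $x_i\in\mathbb R^p$ is random with $E(x_i)=0$, $\mathrm{Var}(x_i)=\Sigma$ non-singular, and $\epsilon_i\in\mathbb R$ is independent of $x_i$ with $E(\epsilon_i)=0$, $\mathrm{Var}(\epsilon_i)=\sigma^2$. Throughout, $\Sigma=\mathrm{Diag}(\lambda_1,\dots,\lambda_p)$ with $\lambda_1\ge\dots\ge\lambda_p>0$. The vector $\Sigma^{-1/2}x_i$ is sub-gaussian with sub-gaussian norm $\sigma_x$, where a real random variable $z$ has norm $\Vert z\Vert_{\psi_2}=\inf\{t>0: E\exp(z^2/t^2)\le 2\}$ and a random vector $Z$ has norm $\sup_{s\ne 0}\Vert\langle s,Z\rangle/\Vert s\Vert\,\Vert_{\psi_2}$. $Y=(y_1,\dots,y_n)^\top$, $X=(x_1,\dots,x_n)^\top$, $\hat\Sigma=X^\top X/n$. For $\tau>0$ the ridge estimator is $\hat\theta(\tau)=X^\top(XX^\top+n\tau I_n)^{-1}Y$ (minimizer of $\frac1n\Vert Y-X\theta\Vert^2+\tau\Vert\theta\Vert^2$), and $\hat\theta(0)=\lim_{\tau\to0+}\hat\theta(\tau)$. $\Vert b\Vert_M=(b^\top Mb)^{1/2}$. $\mathrm{MSE}_{\mathrm{in}}=E[\Vert\hat\theta(\tau)-\theta^*\Vert_{\hat\Sigma}^2\mid X]=E[\frac1n\Vert X(\hat\theta(\tau)-\theta^*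 )\Vert^2\mid X]$. $\theta^*_{1:d}$, $\theta^*_{(d+1):p}$ are the first $d$ and last $p-d$ entries of $\theta^*$; $\Sigma_{1:d}=\mathrm{Diag}(\lambda_1,\dots,\lambda_d)$, $\Sigma_{(d+1):p}=\mathrm{Diag}(\lambda_{d+1},\dots,\lambda_p)$; $r_d(\Sigma)=\frac{\sum_{j>d}\lambda_j}{\lambda_{d+1}}$. Asymptotics. One considers a sequence of such models indexed by $n\to\infty$; $p,d,\Sigma,\theta^*,\sigma^2$ and the (deterministic) $\tau\ge0$ may depend on $n$, while $\sigma_x,C_1,\delta_1,A_0$ are fixed. For positive sequences, $a_n\lesssim b_n$ (or $a_n=O(b_n)$) means $a_n\le c\,b_n$ for all large $n$ for some constant $c>0$; $a_n\asymp b_n$ means $a_n\lesssim b_n$ and $b_n\lesssim a_n$; $a_n\ll b_n$ (or $b_n\gg a_n$) means $a_n/b_n\to0$. ''$\mathrm{MSE}=O(d/n)$ with a probability approaching 1'' means that for some constant $C$, $P(\mathrm{MSE}\le C\,d/n)\to1$; ''with a probability bounded away from 0'' means that for some constants $C,\epsilon>0$, $P(\mathrm{MSE}\le C\,d/n)\ge\epsilon$ for all large $n$. *)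

(* Defs.v *)
From HB Require Import structures.
From mathcomp Require Import all_boot all_order all_algebra.
From mathcomp Require Import all_classical all_reals all_analysis.
Set Implicit Arguments.
Unset Strict Implicit.
Unset Printing Implicit Defensive.
Import Order.TTheory GRing.Theory Num.Theory.
Import numFieldNormedType.Exports.
Local Open Scope classical_set_scope.
Local Open Scope ring_scope.

Definition mutually_independent (d d' : measure_display) (T : measurableType d)
    (T' : measurableType d') (R : realType) (P : probability T R) (I : finType)
    (Z : I -> T -> T') : Prop :=
  forall (J : {set I}) (B : I -> set T'), (forall i, measurable (B i)) ->
    P (\bigcap_(i in [set` J]) (Z i @^-1` B i)) =
    (\prod_(i in J) fine (P (Z i @^-1` B i)))%:E.

Definition identically_distributed (d d' : measure_display)
    (T : measurableType d) (T' : measurableType d') (R : realType)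
    (P : probability T R) (I : finType) (Z : I -> T -> T') : Prop :=
  forall (i j : I) (B : set T'), measurable B ->
    P (Z i @^-1` B) = P (Z j @^-1` B).

Definition independent_pair (d d1 d2 : measure_display) (T : measurableType d)
    (T1 : measurableType d1) (T2 : measurableType d2) (R : realType)
    (P : probability T R) (U : T -> T1) (V : T -> T2) : Prop :=
  forall (A : set T1) (B : set T2), measurable A -> measurable B ->
    P (U @^-1` A `&` V @^-1` B) = (P (U @^-1` A) * P (V @^-1` B))%E.

(* [M] is a version of the conditional expectation of [Z] given the
   sub-sigma-algebra [G]. *)
Definition cond_expectation_version (d : measure_display)
    (T : measurableType d) (R : realType) (P : probability T R)
    (G : set (set T)) (Z M : T -> R) : Prop :=
  [/\ forall B : set R, measurable B -> G (M @^-1` B),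
      P.-integrable setT (EFin \o M) &
      forall A, G A ->
        (\int[P]_(w in A) (M w)%:E)%E = (\int[P]_(w in A) (Z w)%:E)%E].

(* The infimum of the empty set is [+oo]. *)
Definition psi2_norm (d : measure_display) (T : measurableType d)
    (R : realType) (P : probability T R) (z : T -> R) : \bar R :=
  ereal_inf [set t%:E | t in
    [set t : R | 0 < t /\ ('E_P[fun w => expR (z w ^+ 2 / t ^+ 2)] <= 2%:E)%E]].

Definition wnorm (R : realType) (m : nat) (M : 'M[R]_m) (b : 'cV[R]_m) : R :=
  Num.sqrt ((b^T *m M *m b) 0 0).

(* Matrices are normed by the sup norm in the library, hence the weighted norm
   at the identity matrix for the Euclidean norm of [s]. *)
Definition psi2_norm_vec (d : measure_display) (T : measurableType d)
    (R : realType) (P : probability T R) (m : nat) (Z : T -> 'cV[R]_m) :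
    \bar R :=
  ereal_sup [set psi2_norm P (fun w => (s^T *m Z w) 0 0 / wnorm 1%:M s)
    | s in [set s : 'cV[R]_m | s != 0]].

Definition lesssim (R : realType) (a b : nat -> R) : Prop :=
  exists2 c : R, 0 < c & \forall n \near \oo, a n <= c * b n.

Definition same_order (R : realType) (a b : nat -> R) : Prop :=
  lesssim a b /\ lesssim b a.

Definition negligible_to (R : realType) (a b : nat -> R) : Prop :=
  a n / b n @[n --> \oo] --> (0 : R).

Section ridge.
Context (R : realType) (n p : nat).

Definition ridge_pos (X : 'M[R]_(n, p)) (Y : 'cV[R]_n) (tau : R) : 'cV[R]_p :=
  X^T *m invmx (X *m X^T + (n%:R * tau)%:M) *m Y.

Definition ridge (X : 'M[R]_(n, p)) (Y : 'cV[R]_n) (tau : R) : 'cV[R]_p :=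
  if 0 < tau then ridge_pos X Y tau
  else lim (ridge_pos X Y t @[t --> 0^'+]).

Definition sample_cov (X : 'M[R]_(n, p)) : 'M[R]_p := n%:R^-1 *: (X^T *m X).

End ridge.

(* With 0-based indices, [lam 0 j] and [theta j 0] are the (j+1)-th eigenvalue
   of [Sigma] and the (j+1)-th entry of the regression vector. *)
Record ridge_model (R : realType) (sigma_x : R) (n : nat) := RidgeModel {
  pdim : nat;
  ddim : nat;
  ddim_gt0 : (1 <= ddim)%N;
  ddim_lt : (ddim < pdim)%N;
  lam : 'rV[R]_pdim;
  theta : 'cV[R]_pdim;
  sigma2 : R;
  disp : measure_display;
  Omega : measurableType disp;
  Prob : probability Omega R;
  xvar : 'I_n -> {RV Prob >-> pdim.-tuple R};
  eps : 'I_n -> {RV Prob >-> R};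
  xcol := fun (i : 'I_n) (w : Omega) => \col_j tnth (xvar i w) j : 'cV[R]_pdim;
  yvar := fun (i : 'I_n) (w : Omega) => ((xcol i w)^T *m theta) 0 0 + eps i w;
  Sigma := diag_mx lam;
  lam_gt0 : forall j, 0 < lam 0 j;
  lam_nonincr : forall i j : 'I_pdim, (i <= j)%N -> lam 0 j <= lam 0 i;
  data_indep : mutually_independent Prob
    (fun i w => (yvar i w, xvar i w) : (R * pdim.-tuple R)%type);
  data_ident : identically_distributed Prob
    (fun i w => (yvar i w, xvar i w) : (R * pdim.-tuple R)%type);
  x_eps_indep : forall i, independent_pair Prob (xvar i) (eps i);
  x_mean : forall i j, ('E_Prob[fun w => tnth (xvar i w) j] = 0)%E;
  x_cov : forall i j k,
    covariance Prob (fun w => tnth (xvar i w) j) (fun w => tnth (xvar i w) k)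
    = (Sigma j k)%:E;
  eps_mean : forall i, ('E_Prob[eps i] = 0)%E;
  eps_var : forall i, 'V_Prob[eps i]%E = sigma2%:E;
  x_subgauss : forall i,
    psi2_norm_vec Prob (fun w =>
      diag_mx (\row_j (Num.sqrt (lam 0 j))^-1) *m xcol i w) = sigma_x%:E
}.

Section quantities.
Context (R : realType) (sigma_x : R) (n : nat) (m : ridge_model sigma_x n).

Definition design (w : Omega m) : 'M[R]_(n, pdim m) :=
  \matrix_(i, j) tnth (xvar m i w) j.

Definition response (w : Omega m) : 'cV[R]_n := \col_i yvar i w.

Definition dn : R := (ddim m)%:R / n%:R.

Definition idx_d : 'I_(pdim m) :=
  Ordinal (leq_ltn_trans (leq_pred (ddim m)) (ddim_lt m)).

Definition idx_dS : 'I_(pdim m) := Ordinal (ddim_lt m).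

(* lambda_d and lambda_{d+1} *)
Definition lam_d : R := lam m 0 idx_d.
Definition lam_dS : R := lam m 0 idx_dS.

Definition r_d : R := (\sum_(j < pdim m | (ddim m <= j)%N) lam m 0 j) / lam_dS.

Definition head_idx (i : 'I_(ddim m)) : 'I_(pdim m) := widen_ord (ltnW (ddim_lt m)) i.

Definition tail_idx (i : 'I_(pdim m - ddim m)) : 'I_(pdim m) :=
  cast_ord (subnKC (ltnW (ddim_lt m))) (rshift (ddim m) i).

Definition theta_head : 'cV[R]_(ddim m) := \col_i theta m (head_idx i) 0.
Definition theta_tail : 'cV[R]_(pdim m - ddim m) := \col_i theta m (tail_idx i) 0.
Definition Sigma_head : 'M[R]_(ddim m) := diag_mx (\row_i lam m 0 (head_idx i)).
Definition Sigma_tail : 'M[R]_(pdim m - ddim m) :=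
  diag_mx (\row_i lam m 0 (tail_idx i)).

Definition head_signal : R := wnorm (invmx Sigma_head) theta_head ^+ 2.
Definition tail_signal : R := wnorm Sigma_tail theta_tail ^+ 2.

Definition in_sample_loss (tau : R) (w : Omega m) : R :=
  wnorm (sample_cov (design w))
    (ridge (design w) (response w) tau - theta m) ^+ 2.

(* [mse] is a version of E[in_sample_loss | X], where conditioning is on the
   sigma-algebra generated by x_1, ..., x_n. *)
Definition is_MSE_in (tau : R) (mse : Omega m -> R) : Prop :=
  cond_expectation_version (Prob m) (g_sigma_preimage (fun i => xvar m i : _ -> _))
    (in_sample_loss tau) mse.

End quantities.

Section rates.
Context (R : realType) (sigma_x : R) (m : forall n, ridge_model sigma_x n).
Context (mse : forall n, Omega (m n) -> R).

Definition mse_rate_whp : Prop :=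
  exists2 C : R, 0 < C &
    Prob (m n) [set w | @mse n w <= C * dn (m n)] @[n --> \oo] --> 1%E.

Definition mse_rate_bounded_away : Prop :=
  exists C e : R, [/\ 0 < C, 0 < e &
    \forall n \near \oo, (e%:E <= Prob (m n) [set w | (@mse n w <= C * dn (m n))%R])%E].

End rates.

(* Main.v *)
(* Split the design as [X = A + B] along the first [d] and the remaining
   coordinates, and let [H = X X^T (X X^T + n tau)^-1]. Given [X], the risk is
   [(|(1 - H) X theta|^2 + sigma^2 |H|_F^2) / n]. With high probability the
   whitened first [d] columns are well conditioned, [|B|_F^2] is of order
   [n lambda_{d+1} r_d] and [|B B^T| <= C (n lambda_{d+1} + lambda_{d+1} r_d)],
   which is [O (n lambda_{d+1})] because [r_d = O (n)]. On that event
   [|H|_F^2] lies between [(tr H)^2 / n] and [d + |B B^T|_F^2 / (n tau)^2],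
   and the bias is controlled through the normal equation
   [A (theta - A^T w / (n tau)) = w - B theta + B B^T w / (n tau)] for
   [w = (1 - H) X theta]. Sufficiency is then arithmetic. For necessity, a risk
   bound of positive probability holds at some point of the good event; the
   lower bounds on variance and bias at that point bound [tau] from below and
   from above, and comparing the two bounds gives the condition on
   [lambda_{d+1} / lambda_d]. *)
From HB Require Import structures.
From mathcomp Require Import all_boot all_order all_algebra.
From mathcomp Require Import all_classical all_reals all_analysis.
From mathcomp Require Import measurable_realfun.
From mathcomp Require Import ring lra zify.
Require Import Defs.
Set Implicit Arguments.
Unset Strict Implicit.
Unset Printing Implicit Defensive.
Import Order.TTheory GRing.Theory Num.Theory.
Import numFieldNormedType.Exports.

Local Open Scope ring_scope.

(** * Ridge regression for a fixed design *)

(** The tail part [B] enters only through an upper bound on the norm of [B B^T] and two-sided bounds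
    on its trace, so [B] may have any rank and any number of columns. The net over the first [d]
    coordinates costs a factor [96 ^ d] in the failure probability; the absolute constant of the
    statement is chosen so that the condition on [d / n] keeps this factor below the concentration
    gain. Hypothesis (c) is used as [4 ts <= delta1 lambda_{d+1}^2 hs], where [ts] and [hs] are the
    tail and head signals: the tail then contributes to the bias at most a fraction [sqrt delta1] of
    what the head does, which keeps the lower bound on the bias positive. Two points shape the
    probabilistic half. A conditional expectation is fixed only almost everywhere, so the risk
    formula holds off a null set and all events are handled through measurable exceptional sets. At
    zero penalty the estimator is a limit, so its hat matrix is reached only through small positive
    penalties. *)

Definition dotv (R : rcfType) n (u v : 'cV[R]_n) : R := (u^T *m v) 0 0.
Definition nsq (R : rcfType) n (u : 'cV[R]_n) : R := dotv u u.
Definition nrm (R : rcfType) n (u : 'cV[R]_n) : R := Num.sqrt (nsq u).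
Definition fro (R : rcfType) m n (A : 'M[R]_(m, n)) : R := \tr (A^T *m A).

(** * Euclidean and Frobenius norms of real matrices *)

Section euclid.
Context {R : rcfType}.
Implicit Types (m n p : nat).

Lemma dotvE n (u v : 'cV[R]_n) : dotv u v = \sum_i u i 0 * v i 0.
Proof. by rewrite /dotv mxE; apply: eq_bigr => i _; rewrite mxE. Qed.

Lemma dotvC n (u v : 'cV[R]_n) : dotv u v = dotv v u.
Proof. by rewrite !dotvE; apply: eq_bigr => i _; rewrite mulrC. Qed.

Lemma dotvDl n (u v w : 'cV[R]_n) : dotv (u + v) w = dotv u w + dotv v w.
Proof. by rewrite /dotv linearD mulmxDl mxE. Qed.

Lemma dotvDr n (u v w : 'cV[R]_n) : dotv w (u + v) = dotv w u + dotv w v.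
Proof. by rewrite dotvC dotvDl ![dotv w _]dotvC. Qed.

Lemma dotvZl n a (u v : 'cV[R]_n) : dotv (a *: u) v = a * dotv u v.
Proof. by rewrite /dotv linearZ -scalemxAl mxE. Qed.

Lemma dotvZr n a (u v : 'cV[R]_n) : dotv u (a *: v) = a * dotv u v.
Proof. by rewrite dotvC dotvZl dotvC. Qed.

Lemma dotvNl n (u v : 'cV[R]_n) : dotv (- u) v = - dotv u v.
Proof. by rewrite -scaleN1r dotvZl mulN1r. Qed.

Lemma dotvNr n (u v : 'cV[R]_n) : dotv u (- v) = - dotv u v.
Proof. by rewrite dotvC dotvNl dotvC. Qed.

Lemma dotv_mull m n (A : 'M[R]_(m, n)) u v :
  dotv (A *m u) v = dotv u (A^T *m v).
Proof. by rewrite /dotv trmx_mul mulmxA. Qed.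

Lemma dotv_mulr m n (A : 'M[R]_(m, n)) u v :
  dotv v (A *m u) = dotv (A^T *m v) u.
Proof. by rewrite dotvC dotv_mull dotvC. Qed.

Definition dotv_lin := (dotvDl, dotvDr, dotvNl, dotvNr, dotvZl, dotvZr).

Lemma nsqE n (u : 'cV[R]_n) : nsq u = \sum_i u i 0 ^+ 2.
Proof. by rewrite /nsq dotvE; apply: eq_bigr => i _; rewrite expr2. Qed.

Lemma nsq_ge0 n (u : 'cV[R]_n) : 0 <= nsq u.
Proof. by rewrite nsqE sumr_ge0// => i _; exact: sqr_ge0. Qed.
Hint Resolve nsq_ge0 : core.

Lemma nsq_eq0 n (u : 'cV[R]_n) : nsq u = 0 -> u = 0.
Proof.
rewrite nsqE => /eqP; rewrite psumr_eq0; last by move=> i _; exact: sqr_ge0.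
move=> /allP h; apply/matrixP => i j; rewrite ord1 mxE.
by apply/eqP; rewrite -sqrf_eq0; apply: h; rewrite mem_index_enum.
Qed.

Lemma nsq0 n : nsq (0 : 'cV[R]_n) = 0.
Proof. by rewrite nsqE big1// => i _; rewrite mxE expr0n. Qed.

Lemma nsqZ n a (u : 'cV[R]_n) : nsq (a *: u) = a ^+ 2 * nsq u.
Proof. by rewrite /nsq dotvZl dotvZr mulrA expr2. Qed.

Lemma nsqN n (u : 'cV[R]_n) : nsq (- u) = nsq u.
Proof. by rewrite /nsq dotvNl dotvNr opprK. Qed.

Lemma nsqD n (u v : 'cV[R]_n) : nsq (u + v) = nsq u + 2 * dotv u v + nsq v.
Proof. by rewrite /nsq !dotv_lin (dotvC v u); ring. Qed.

Lemma nsqB n (u v : 'cV[R]_n) : nsq (u - v) = nsq u - 2 * dotv u v + nsq v.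
Proof. by rewrite nsqD nsqN dotvNr mulrN. Qed.

Lemma dotv_CS_sq n (u v : 'cV[R]_n) : dotv u v ^+ 2 <= nsq u * nsq v.
Proof.
have [v0|v0] := eqVneq (nsq v) 0.
  by rewrite v0 mulr0 (nsq_eq0 v0) /dotv mulmx0 mxE expr0n.
have vp : 0 < nsq v by rewrite lt_def v0 nsq_ge0.
have := nsq_ge0 (nsq v *: u - dotv u v *: v).
rewrite nsqB !nsqZ dotvZl dotvZr => h.
rewrite -subr_ge0 -(pmulr_rge0 _ vp); apply: le_trans h _.
by rewrite le_eqVlt; apply/orP; left; apply/eqP; ring.
Qed.

Lemma nrm_ge0 n (u : 'cV[R]_n) : 0 <= nrm u.
Proof. exact: sqrtr_ge0. Qed.
Hint Resolve nrm_ge0 : core.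

Lemma sqr_nrm n (u : 'cV[R]_n) : nrm u ^+ 2 = nsq u.
Proof. by rewrite sqr_sqrtr. Qed.

Lemma nrm_le n (u : 'cV[R]_n) c : 0 <= c -> (nrm u <= c) = (nsq u <= c ^+ 2).
Proof. by move=> c0; rewrite -(@ler_pXn2r _ 2)// ?nnegrE// sqr_nrm. Qed.

Lemma dotv_CS n (u v : 'cV[R]_n) : `|dotv u v| <= nrm u * nrm v.
Proof.
rewrite -(@ler_pXn2r _ 2)// ?nnegrE ?mulr_ge0//.
by rewrite real_normK ?num_real// exprMn !sqr_nrm dotv_CS_sq.
Qed.

Lemma dotv_le n (u v : 'cV[R]_n) : dotv u v <= nrm u * nrm v.
Proof. exact: le_trans (ler_norm _) (dotv_CS _ _). Qed.

Lemma nrmD n (u v : 'cV[R]_n) : nrm (u + v) <= nrm u + nrm v.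
Proof.
rewrite nrm_le ?addr_ge0// nsqD -!sqr_nrm.
by have := dotv_le u v; nra.
Qed.

Lemma nrmZ n a (u : 'cV[R]_n) : nrm (a *: u) = `|a| * nrm u.
Proof. by rewrite /nrm nsqZ sqrtrM ?sqr_ge0// sqrtr_sqr. Qed.

Lemma nrmN n (u : 'cV[R]_n) : nrm (- u) = nrm u.
Proof. by rewrite /nrm nsqN. Qed.

Lemma nrm_op m n (A : 'M[R]_(m, n)) c : 0 <= c ->
  (forall v, nsq (A *m v) <= c * nsq v) ->
  forall v, nrm (A *m v) <= Num.sqrt c * nrm v.
Proof.
by move=> c0 h v; rewrite nrm_le ?mulr_ge0 ?sqrtr_ge0// exprMn sqr_sqrtr// sqr_nrm.
Qed.

(** With [y = A^T v], Cauchy-Schwarz on [nsq y = dotv v (A y)] gives [nsq y ^ 2 <= nsq v (c nsq y)],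
    and one factor [nsq y] cancels. *)
Lemma op_tr m n (A : 'M[R]_(m, n)) c : 0 <= c ->
  (forall v, nsq (A *m v) <= c * nsq v) ->
  forall v, nsq (A^T *m v) <= c * nsq v.
Proof.
move=> c0 h v; set y := A^T *m v.
have h1 : nsq y = dotv v (A *m y) by rewrite /nsq {1}/y dotv_mull trmxK.
have h2 : nsq y ^+ 2 <= nsq v * (c * nsq y).
  by rewrite {1}h1 (le_trans (dotv_CS_sq _ _))// ler_wpM2l.
have [->|y0] := eqVneq (nsq y) 0; first by rewrite mulr_ge0.
have yp : 0 < nsq y by rewrite lt_def y0 nsq_ge0.
by rewrite -(ler_pM2l yp); nra.
Qed.

Lemma nsq_Dorth m n p (A : 'M[R]_(m, n)) (B : 'M[R]_(m, p)) u v :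
  A^T *m B = 0 -> nsq (A *m u + B *m v) = nsq (A *m u) + nsq (B *m v).
Proof.
move=> AB; rewrite nsqD dotv_mull mulmxA AB mul0mx.
by rewrite /dotv mulmx0 mxE mulr0 addr0.
Qed.

Lemma fro_col m n (A : 'M[R]_(m, n)) : fro A = \sum_j nsq (col j A).
Proof.
rewrite /fro /mxtrace; apply: eq_bigr => j _.
rewrite /nsq /dotv !mxE; apply: eq_bigr => i _; by rewrite !mxE.
Qed.

Lemma fro_ge0 m n (A : 'M[R]_(m, n)) : 0 <= fro A.
Proof. by rewrite fro_col sumr_ge0. Qed.

Lemma fro_tr m n (A : 'M[R]_(m, n)) : fro A^T = fro A.
Proof. by rewrite /fro trmxK mxtrace_mulC. Qed.

Lemma fro_sum m n (A : 'M[R]_(m, n)) : fro A = \sum_i \sum_j A i j ^+ 2.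
Proof.
rewrite -fro_tr fro_col; apply: eq_bigr => i _; rewrite nsqE.
by apply: eq_bigr => j _; rewrite !mxE.
Qed.

Lemma col_mulmx m n p (A : 'M[R]_(m, n)) (B : 'M[R]_(n, p)) j :
  col j (A *m B) = A *m col j B.
Proof. by rewrite colE -mulmxA -colE. Qed.

Lemma nsq_mul_fro m n (A : 'M[R]_(m, n)) v : nsq (A *m v) <= fro A * nsq v.
Proof.
rewrite nsqE fro_sum mulr_suml ler_sum// => i _.
have -> : (A *m v) i 0 = dotv (row i A)^T v.
  by rewrite dotvE mxE; apply: eq_bigr => j _; rewrite !mxE.
rewrite (le_trans (dotv_CS_sq _ _))// ler_wpM2r// nsqE.
by rewrite ler_sum// => j _; rewrite !mxE.
Qed.

Lemma fro_mul_le m n p (A : 'M[R]_(m, n)) (M : 'M[R]_(n, p)) c :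
  (forall v, nsq (A *m v) <= c * nsq v) -> fro (A *m M) <= c * fro M.
Proof.
move=> h; rewrite !fro_col mulr_sumr ler_sum// => j _.
by rewrite col_mulmx h.
Qed.

(** Cauchy-Schwarz between the diagonal and the all-ones vector; the off-diagonal squares only
    increase [fro A]. *)
Lemma fro_mxtrace n (A : 'M[R]_n) : \tr A ^+ 2 <= n%:R * fro A.
Proof.
have h1 : \tr A = dotv (\col_i A i i) (const_mx 1).
  by rewrite dotvE; apply: eq_bigr => i _; rewrite !mxE mulr1.
rewrite h1 (le_trans (dotv_CS_sq _ _))// mulrC ler_pM//.
  rewrite nsqE (eq_bigr (fun=> 1)); last by move=> i _; rewrite mxE expr1n.
  by rewrite sumr_const card_ord.
rewrite nsqE fro_sum ler_sum// => i _; rewrite mxE (bigD1 i)//= lerDl.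
by apply: sumr_ge0 => j _; exact: sqr_ge0.
Qed.

Lemma unitmx_col n (A : 'M[R]_n) :
  (forall v : 'cV_n, A *m v = 0 -> v = 0) -> A \in unitmx.
Proof.
move=> h; rewrite -unitmx_tr -row_free_unit; apply/inj_row_free => v vA.
apply: trmx_inj; rewrite trmx0; apply: h; apply: trmx_inj.
by rewrite trmx_mul trmxK vA trmx0.
Qed.

Lemma nsq_proj n (P : 'M[R]_n) v :
  P^T = P -> P *m P = P -> nsq (P *m v) <= nsq v.
Proof.
move=> Pt PP.
have {2}-> : v = P *m v + (1%:M - P) *m v by rewrite -mulmxDl subrKC mul1mx.
rewrite nsq_Dorth ?lerDl//; by rewrite Pt mulmxBr mulmx1 PP subrr.
Qed.

Lemma fro_proj n m (P : 'M[R]_n) (M : 'M[R]_(n, m)) :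
  P^T = P -> P *m P = P -> fro M = fro (P *m M) + fro ((1%:M - P) *m M).
Proof.
move=> Pt PP; rewrite !fro_col -big_split/=; apply: eq_bigr => j _.
rewrite !col_mulmx -nsq_Dorth; last by rewrite Pt mulmxBr mulmx1 PP subrr.
by rewrite -mulmxDl subrKC mul1mx.
Qed.

End euclid.
#[export] Hint Resolve nsq_ge0 nrm_ge0 : core.

Definition hat (R : rcfType) n p (X : 'M[R]_(n, p)) (s : R) : 'M[R]_n :=
  X *m X^T *m invmx (X *m X^T + s%:M).

(** * The hat matrix as a symmetric contraction *)

Section ridge_hat.
Context {R : rcfType} {n p : nat} (X : 'M[R]_(n, p)) (s : R) (s0 : 0 < s).
Let K := X *m X^T + s%:M.

Lemma gram_shift_unit : K \in unitmx.
Proof.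
apply: unitmx_col => v Kv.
have : dotv v (K *m v) = nsq (X^T *m v) + s * nsq v.
  by rewrite mulmxDl mul_scalar_mx dotvDr dotvZr -mulmxA dotv_mulr.
rewrite Kv {1}/dotv mulmx0 mxE => h.
apply: nsq_eq0; apply/eqP; rewrite eq_le nsq_ge0 andbT -(pmulr_rle0 _ s0).
by have := nsq_ge0 (X^T *m v); lra.
Qed.

Lemma hatE : hat X s = 1%:M - s *: invmx K.
Proof.
rewrite -(mulmxV gram_shift_unit) {1}/K /hat mulmxDl mul_scalar_mx.
by rewrite addrK.
Qed.

Lemma gram_shift_tr : K^T = K.
Proof. by rewrite /K linearD/= trmx_mul trmxK tr_scalar_mx. Qed.

Lemma hat_tr : (hat X s)^T = hat X s.
Proof.
by rewrite hatE linearB/= linearZ/= trmx1 trmx_inv gram_shift_tr.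
Qed.

Lemma nsq_shift_inv v : nsq (s *: (invmx K *m v)) <= nsq v.
Proof.
set u := invmx K *m v.
have vE : v = K *m u by rewrite /u mulmxA mulmxV ?gram_shift_unit// mul1mx.
have h : dotv u v = nsq (X^T *m u) + s * nsq u.
  rewrite {1}vE mulmxDl mul_scalar_mx dotvDr dotvZr -mulmxA dotv_mulr//.
have := nsq_ge0 (v - s *: u).
rewrite nsqB dotvZr nsqZ (dotvC v u) h.
have := mulr_ge0 (ltW s0) (nsq_ge0 (X^T *m u)); nra.
Qed.

Lemma nsq_hat v : nsq (hat X s *m v) <= nsq v.
Proof.
set u := invmx K *m v.
have vE : v = K *m u by rewrite /u mulmxA mulmxV ?gram_shift_unit// mul1mx.
have h : dotv v u = nsq (X^T *m u) + s * nsq u.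
  by rewrite dotvC {1}vE mulmxDl mul_scalar_mx dotvDr dotvZr -mulmxA dotv_mulr.
rewrite hatE mulmxBl mul1mx -scalemxAl -/u nsqB nsqZ dotvZr h.
have := mulr_ge0 (sqr_ge0 s) (nsq_ge0 u).
have := mulr_ge0 (ltW s0) (nsq_ge0 (X^T *m u)); nra.
Qed.

End ridge_hat.

(** * Variance and bias when the Gram matrix splits as [A A^T + B B^T] *)

Section split_design.
Context {R : rcfType} {n p : nat} (A B : 'M[R]_(n, p)) (s ell : R).
Hypotheses (s0 : 0 < s) (ell0 : 0 < ell) (AB : A *m B^T = 0).
Hypothesis Bop : forall v, nsq (B^T *m v) <= ell * nsq v.
Let X := A + B.
Let K := X *m X^T + s%:M.

Lemma gram_split : X *m X^T = A *m A^T + B *m B^T.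
Proof.
have BA : B *m A^T = 0.
  by apply: trmx_inj; rewrite trmx_mul trmxK AB trmx0.
rewrite /X linearD/= mulmxDl !mulmxDr AB BA.
by rewrite addr0 add0r.
Qed.

(* Cauchy-Schwarz on [B^T e = B^T (e - s u) + s B^T u] with [u = K^-1 e]. *)
Lemma dotv_hat_ge e : nsq (B^T *m e) / (ell + s) <= dotv e (hat X s *m e).
Proof.
set u := invmx K *m e.
have eE : e = K *m u.
  by rewrite /u mulmxA mulmxV ?mul1mx //; exact: gram_shift_unit.
have h : dotv e u = nsq (A^T *m u) + nsq (B^T *m u) + s * nsq u.
  rewrite dotvC {1}eE /K gram_split !mulmxDl mul_scalar_mx !dotvDr dotvZr.
  by rewrite -!mulmxA (dotv_mulr A) (dotv_mulr B).
have hatX : dotv e (hat X s *m e) = nsq e - s * dotv e u.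
  by rewrite (hatE X s0) mulmxBl mul1mx -scalemxAl -/u dotvDr dotvNr dotvZr.
set f := e - s *: u.
have hf : nsq f = nsq e - 2 * s * dotv e u + s ^+ 2 * nsq u.
  by rewrite /f nsqB dotvZr nsqZ; ring.
rewrite hatX ler_pdivrMr ?addr_gt0//.
have -> : B^T *m e = B^T *m f + s *: (B^T *m u).
  by rewrite /f mulmxBr -scalemxAr subrK.
have Bf := Bop f.
rewrite nsqD dotvZr nsqZ.
have cs := dotv_CS_sq (B^T *m f) (B^T *m u).
have fA := nsq_ge0 (A^T *m u).
set a := nsq (B^T *m f) in Bf cs *; set b := nsq (B^T *m u) in cs h *.
set c := dotv (B^T *m f) _ in cs *.
have a0 : 0 <= a by exact: nsq_ge0.
have b0 : 0 <= b by exact: nsq_ge0.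
have f0 : 0 <= nsq f by exact: nsq_ge0.
have key : nsq f + s * b <= nsq e - s * dotv e u.
  by rewrite hf; have := mulr_ge0 (ltW s0) fA; nra.
rewrite (le_trans _ (ler_wpM2r _ key))//; last by rewrite ltW// addr_gt0.
have amgm : 2 * c <= nsq f + ell * b.
  have : c ^+ 2 <= nsq f * (ell * b).
    by rewrite (le_trans cs)// mulrCA mulrA ler_wpM2r.
  have : 0 <= ell * b by rewrite mulr_ge0// ltW.
  move=> g0 hc; rewrite (le_trans (ler_norm _))//.
  rewrite -(@ler_pXn2r _ 2)// ?nnegrE ?addr_ge0// real_normK ?num_real//.
  rewrite exprMn.
  by have := sqr_ge0 (nsq f - ell * b); nra.
have := ler_wpM2l (ltW s0) amgm; nra.
Qed.

(** The quadratic lower bound is applied to each basis vector: the diagonal entries of the hat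
    matrix add up to its trace, and the squared rows of [B] to [fro B]. *)
Lemma tr_hat_ge : fro B / (ell + s) <= \tr (hat X s).
Proof.
rewrite -fro_tr fro_col mulr_suml ler_sum// => i _.
have -> : hat X s i i = dotv (delta_mx i 0) (hat X s *m delta_mx i 0).
  by rewrite /dotv -colE trmx_delta -rowE !mxE.
by rewrite colE dotv_hat_ge.
Qed.

Lemma fro_hat_ge : (fro B / (ell + s)) ^+ 2 <= n%:R * fro (hat X s).
Proof.
have B0 : 0 <= fro B / (ell + s) by rewrite divr_ge0 ?fro_ge0// ltW// addr_gt0.
apply: le_trans (fro_mxtrace _).
by rewrite lerXn2r ?nnegrE// ?tr_hat_ge// (le_trans B0)// tr_hat_ge.
Qed.

Section variance_upper.
Variable P : 'M[R]_n.
Hypotheses (Pt : P^T = P) (PP : P *m P = P) (PA : P *m A = A).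

(* The hat matrix is a contraction, so the range of [P] contributes at most
   [\tr P]; on the complement [X X^T] acts as [B B^T]. *)
Lemma fro_hat_le : fro (hat X s) <= \tr P + ell * fro B / s ^+ 2.
Proof.
rewrite (fro_proj _ Pt PP) lerD//.
  rewrite -fro_tr trmx_mul hat_tr// Pt (le_trans (fro_mul_le _ (c := 1) _))//.
    by move=> v; rewrite mul1r nsq_hat.
  by rewrite mul1r /fro Pt PP.
have -> : (1%:M - P) *m hat X s = (1%:M - P) *m (B *m B^T *m invmx K).
  rewrite /hat -/K gram_split [(A *m A^T + _) *m _]mulmxDl mulmxDr [X in X + _](_ : _ = 0) ?add0r//.
  by rewrite !mulmxA mulmxBl mul1mx PA subrr !mul0mx.
have QQ : (1%:M - P)^T = 1%:M - P by rewrite linearB/= trmx1 Pt.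
have QI : (1%:M - P) *m (1%:M - P) = 1%:M - P.
  by rewrite mulmxBr mulmx1 mulmxBl mul1mx PP subrr subr0.
rewrite (le_trans (fro_mul_le _ (c := 1) _))//.
  by move=> v; rewrite mul1r nsq_proj.
rewrite mul1r -fro_tr trmx_mul trmx_inv gram_shift_tr.
rewrite (le_trans (fro_mul_le _ (c := (s ^+ 2)^-1) _))//.
  move=> v; rewrite mulrC ler_pdivlMr ?exprn_gt0// mulrC -nsqZ.
  exact: nsq_shift_inv.
rewrite mulrC ler_wpM2r ?invr_ge0 ?sqr_ge0// fro_tr.
have -> : fro (B *m B^T) = fro (B^T *m B).
  by rewrite /fro !trmx_mul !trmxK -mulmxA mxtrace_mulC !mulmxA.
exact: fro_mul_le.
Qed.

End variance_upper.

Section bias.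
(** In the application [Z] is the whitened design, [D] the projection on the first [d] coordinates,
    [L] the square root of [Sigma] and [Li] its inverse. Then [H] is the square root of the head
    signal and [w] is the bias vector. *)
Variables (Z : 'M[R]_(n, p)) (D L Li : 'M[R]_p) (c1 c2 : R).
Hypotheses (DD : D *m D = D) (Dt : D^T = D) (Lt : L^T = L) (Lit : Li^T = Li).
Hypotheses (LLi : L *m Li = 1%:M) (DL : D *m L = L *m D).
Hypotheses (AE : A = Z *m D *m L) (c1p : 0 < c1).
Hypothesis lowD : forall v, c1 * nsq (D *m v) <= nsq (Z *m (D *m v)).
Variable f : 'cV[R]_p.
Let w := X *m f - hat X s *m (X *m f).
Let H := nrm (D *m (Li *m f)).
Let kap := 1 + ell / s.
Let u := f - s^-1 *: (A^T *m w).

Let Aut : A *m u = w - B *m f + s^-1 *: (B *m (B^T *m w)).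
Proof.
have wE : s *: w = s *: (X *m f) - X *m X^T *m w.
  have ww : w = s *: (invmx K *m (X *m f)).
    by rewrite /w (hatE X s0) mulmxBl mul1mx opprB addrC subrK scalemxAl.
  have Kw : K *m w = s *: (X *m f).
    by rewrite ww -scalemxAr mulmxA mulmxV ?mul1mx//; exact: gram_shift_unit.
  by rewrite -Kw /K mulmxDl mul_scalar_mx [X in _ = X - _]addrC addrK.
have {}wE : w = X *m f - s^-1 *: (X *m X^T *m w).
  by rewrite -[LHS](scalerK (lt0r_neq0 s0)) wE scalerBr scalerK ?lt0r_neq0.
rewrite {1}wE gram_split [(A *m A^T + _) *m _]mulmxDl scalerDr [X *m f]mulmxDl.
rewrite /u mulmxBr -scalemxAr !mulmxA.
move: (A *m f) (B *m f) (_ *: _) (_ *: _) => a b c d.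
by apply/matrixP => i j; rewrite !mxE; ring.
Qed.

Let opB v : nrm (B *m v) <= Num.sqrt ell * nrm v.
Proof.
have := @op_tr _ _ _ B^T _ (ltW ell0) Bop; rewrite trmxK => h.
exact: nrm_op (ltW ell0) h _.
Qed.

Let Bw : nrm (s^-1 *: (B *m (B^T *m w))) <= ell / s * nrm w.
Proof.
have si0 : 0 <= s^-1 by rewrite invr_ge0 ltW.
rewrite nrmZ ger0_norm// mulrC mulrAC ler_wpM2r//.
rewrite (le_trans (opB _))//.
rewrite (le_trans (ler_wpM2l (sqrtr_ge0 _) (nrm_op (ltW ell0) Bop w)))//.
by rewrite mulrA -expr2 sqr_sqrtr// ltW.
Qed.

Let Au_le : nrm (A *m u) <= kap * nrm w + nrm (B *m f).
Proof.
rewrite Aut (le_trans (nrmD _ _))//.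
have := nrmD w (- (B *m f)); rewrite nrmN => h.
by have := Bw; rewrite /kap; lra.
Qed.

Let DLu_le : Num.sqrt c1 * nrm (D *m (L *m u)) <= nrm (A *m u).
Proof.
rewrite -(@ler_pXn2r _ 2)// ?nnegrE ?mulr_ge0 ?sqrtr_ge0//.
rewrite exprMn (sqr_sqrtr (ltW c1p)) !sqr_nrm AE.
by have := lowD (L *m u); rewrite !mulmxA.
Qed.

(** Pairing the normal equation with [w] gives [nsq w <= dotv w (A u) + dotv w (B f)], the term in
    [B^T w] having a favourable sign. Since [A^T w = s D (f - u)], the first product equals [s]
    times [dotv (D f) u - nsq (D u)], hence is at most [s H h] with [h = nrm (D (L u))]. The normal
    equation itself bounds [h] through the conditioning constant [c1], and a quadratic inequality in
    [nrm w] remains. *)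
Lemma bias_le : nrm w <= 2 * (kap * s * H / Num.sqrt c1 + nrm (B *m f)).
Proof.
have c10 : 0 < Num.sqrt c1 by rewrite sqrtr_gt0.
move: DLu_le Au_le; set h := nrm (D *m (L *m u)); set t := nrm (B *m f).
move=> DLu_le' Au_le'.
have H0 : 0 <= H by exact: nrm_ge0.
have h0 : 0 <= h by exact: nrm_ge0.
have t0 : 0 <= t by exact: nrm_ge0.
have kap1 : 1 <= kap by rewrite lerDl divr_ge0 ?ltW.
have hle : h <= (kap * nrm w + t) / Num.sqrt c1.
  by rewrite ler_pdivlMr// mulrC (le_trans DLu_le').
have DA : D *m A^T = A^T.
  by rewrite AE !trmx_mul Dt Lt !mulmxA DL -[L *m D *m D]mulmxA DD.
have wA : dotv w (A *m u) <= s * (H * h).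
  have -> : dotv w (A *m u) = s * dotv (D *m f - D *m u) u.
    rewrite dotv_mulr -mulmxBr {2}/u opprB addrC subrK -scalemxAr mulmxA DA.
    by rewrite dotvZl mulrA mulfV ?mul1r// lt0r_neq0.
  rewrite ler_pM2l// dotvDl dotvNl.
  have -> : dotv (D *m u) u = nsq (D *m u).
    by rewrite /nsq [RHS]dotv_mull Dt mulmxA DD dotv_mull Dt.
  have -> : dotv (D *m f) u = dotv (D *m (Li *m f)) (D *m (L *m u)).
    rewrite [RHS]dotv_mull Dt !mulmxA DD DL -mulmxA dotv_mulr Lt.
    by rewrite mulmxA LLi mul1mx dotv_mulr Dt.
  by have := nsq_ge0 (D *m u); have := dotv_le (D *m (Li *m f)) (D *m (L *m u)); rewrite -/h -/H; lra.
have main : nsq w <= s * (H * h) + nrm w * t.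
  have -> : nsq w = dotv w (A *m u) + dotv w (B *m f) - s^-1 * nsq (B^T *m w).
    by rewrite Aut 2!dotvDr dotvNr dotvZr (dotv_mulr B (B^T *m w) w) /nsq; ring.
  have si0 : 0 <= s^-1 by rewrite invr_ge0 ltW.
  have := mulr_ge0 si0 (nsq_ge0 (B^T *m w)).
  by have := dotv_le w (B *m f); rewrite -/t; lra.
set q := Num.sqrt c1 in c10 hle *.
set a := kap * s * H / q.
have a0 : 0 <= a by rewrite !mulr_ge0 ?invr_ge0 ?(le_trans ler01 kap1)// ltW.
have sHh : s * (H * h) <= a * (nrm w + t).
  have sH0 : 0 <= s * H by rewrite mulr_ge0// ltW.
  rewrite mulrA (le_trans (ler_wpM2l sH0 hle))//.
  rewrite /a [X in _ <= X](_ : _ = s * H * ((kap * nrm w + kap * t) / q)); last by ring.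
  apply: ler_wpM2l => //; apply: ler_wpM2r; first by rewrite invr_ge0 ltW.
  by rewrite lerD2l ler_peMl.
have {}main : nrm w ^+ 2 <= (a + t) * nrm w + (a + t) ^+ 2.
  by rewrite sqr_nrm; have := mulr_ge0 a0 t0; have := sqr_ge0 a; have := sqr_ge0 t; nra.
have w0 : 0 <= nrm w by exact: nrm_ge0.
(* With [c = a + t], the inequality [x ^ 2 <= c x + c ^ 2] fails for every [x > 2 c]; this is the
   factor 2 of the bound. *)
rewrite leNgt; apply/negP => hw.
have at0 : 0 <= a + t by rewrite addr_ge0.
by nra.
Qed.

(** The spectral gap is applied to [u]: [nrm (D (L u))] is at least [lam_d nrm (D (Li u))]. As [Li]
    cancels the factor [L] of [A^T], the vector [D (Li u)] differs from [D (Li f)] by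
    [D (Z^T w) / s], whose norm is controlled by [c2]. *)
Lemma bias_ge lam_d : 0 <= lam_d -> 0 <= c2 ->
  (forall v, nsq (D *m (Z^T *m v)) <= c2 * nsq v) ->
  (forall v, lam_d * nrm (D *m (Li *m v)) <= nrm (D *m (L *m v))) ->
  Num.sqrt c1 * lam_d * (H - Num.sqrt c2 * nrm w / s) <=
  kap * nrm w + nrm (B *m f).
Proof.
move=> ld0 c20 upD gap.
apply: le_trans Au_le; apply: le_trans DLu_le.
rewrite -mulrA; apply: ler_wpM2l; first exact: sqrtr_ge0.
apply: le_trans (gap u); apply: ler_wpM2l => //.
have DLA : D *m (Li *m (A^T *m w)) = D *m (Z^T *m w).
  rewrite AE !trmx_mul Dt Lt !mulmxA -[D *m Li *m L]mulmxA (mulmx1C LLi) mulmx1.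
  by rewrite DD.
have -> : D *m (Li *m u) = D *m (Li *m f) - s^-1 *: (D *m (Z^T *m w)).
  by rewrite /u (mulmxBr Li) (mulmxBr D) -!scalemxAr DLA.
rewrite /H.
have := nrmD (D *m (Li *m f) - s^-1 *: (D *m (Z^T *m w))) (s^-1 *: (D *m (Z^T *m w))).
rewrite subrK nrmZ ger0_norm ?invr_ge0 ?(ltW s0)// => h.
have up : nrm (D *m (Z^T *m w)) <= Num.sqrt c2 * nrm w.
  rewrite !mulmxA; apply: (nrm_op (A := D *m Z^T) c20) => v.
  by rewrite -mulmxA.
rewrite lerBlDr (le_trans h)// lerD2l mulrC ler_wpM2r// invr_ge0 ltW//.
Qed.

End bias.

End split_design.

(** [Q = V^T V + (1 - D)] with [V = Z D] is invertible, because [V] is injective on the range of [D]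
    and [1 - D] on the complement. Its inverse therefore inverts [V^T V] on the range of [D], and
    [V Q^-1 V^T] is the orthogonal projection on the range of [Z D]. No basis has to be chosen, and
    cyclicity of the trace gives its rank. *)
Lemma range_proj (R : rcfType) n p (Z : 'M[R]_(n, p)) (D : 'M[R]_p) c :
    D^T = D -> D *m D = D -> 0 < c ->
    (forall v, c * nsq (D *m v) <= nsq (Z *m (D *m v))) ->
  exists P : 'M[R]_n, [/\ P^T = P, P *m P = P, P *m (Z *m D) = Z *m D &
    \tr P = \tr D].
Proof.
move=> Dt DD c0 low.
have [V VE] : exists V, V = Z *m D by exists (Z *m D).
pose Q := V^T *m V + (1%:M - D).
have VD : V *m D = V by rewrite VE -mulmxA DD.
have DV : D *m V^T = V^T by rewrite -{1}Dt -trmx_mul VD.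
have QD : Q *m D = V^T *m V.
  by rewrite mulmxDl -mulmxA VD mulmxBl mul1mx DD subrr addr0.
have DQ : D *m Q = V^T *m V.
  by rewrite mulmxDr mulmxA DV mulmxBr mulmx1 DD subrr addr0.
have Qu : Q \in unitmx.
  apply: unitmx_col => v Qv.
  have : dotv v (Q *m v) = nsq (V *m v) + nsq ((1%:M - D) *m v).
    rewrite {1}/Q [(V^T *m V + _) *m v]mulmxDl dotvDr -mulmxA dotv_mulr trmxK; congr (_ + _).
    have QI : (1%:M - D) *m (1%:M - D) = 1%:M - D.
      by rewrite mulmxBr mulmx1 mulmxBl mul1mx DD subrr subr0.
    by rewrite /nsq [RHS]dotv_mull linearB/= trmx1 Dt mulmxA QI.
  rewrite Qv {1}/dotv mulmx0 mxE => h.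
  have Vv : nsq (V *m v) = 0.
    by apply/eqP; rewrite eq_le nsq_ge0 andbT; have := nsq_ge0 ((1%:M - D) *m v); lra.
  have Dv : (1%:M - D) *m v = 0 by apply: nsq_eq0; rewrite Vv in h; lra.
  have D0 : D *m v = 0.
    apply: nsq_eq0; apply/eqP; rewrite eq_le nsq_ge0 andbT -(pmulr_rle0 _ c0).
    by rewrite (le_trans (low v))// mulmxA -VE Vv.
  by rewrite -[v]mul1mx -(subrK D 1%:M) mulmxDl Dv D0 addr0.
have iD : invmx Q *m (V^T *m V) = D by rewrite -QD mulmxA mulVmx// mul1mx.
have Di : (V^T *m V) *m invmx Q = D by rewrite -DQ -mulmxA mulmxV// mulmx1.
exists (V *m invmx Q *m V^T); split.
- have Qt : Q^T = Q by rewrite /Q linearD/= trmx_mul trmxK linearB/= trmx1 Dt.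
  by rewrite !trmx_mul trmxK trmx_inv Qt mulmxA.
- rewrite -[LHS]mulmxA [V^T *m _]mulmxA [V^T *m (V *m _)]mulmxA Di DV.
  by [].
- by rewrite -VE -!mulmxA iD VD.
- by rewrite -mulmxA mxtrace_mulC -mulmxA iD.
Qed.

(** * Nets of coordinate subspaces *)

(** With truncated subtraction the exponent is the distance from [x] to [M]. The sum is the total
    weight of one coordinate in the counting argument for the net, and it stays below 3. *)
Lemma sum_centered_geo (R : realType) (M : nat) :
  \sum_(x < M.*2.+1) (2^-1 : R) ^+ ((x - M) + (M - x)) = 3 - 2 * 2^-1 ^+ M.
Proof.
elim: M => [|M IH].
  by rewrite big_ord_recl big_ord0 !subnn addn0 !expr0; lra.
rewrite doubleS big_ord_recl big_ord_recr/=.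
set a := (X in X + _); set b := (X in _ + (X + _)); set c := (X in _ + (_ + X)).
have -> : a = 2^-1 ^+ M.+1 by congr (_ ^+ _); lia.
have -> : c = 2^-1 ^+ M.+1 by congr (_ ^+ _); rewrite /bump/=; lia.
have -> : b = 3 - 2 * 2^-1 ^+ M.
  by rewrite -IH; apply: eq_bigr => i _; congr (_ ^+ _); rewrite /bump/=; lia.
by rewrite exprS; lra.
Qed.

Lemma absz_shift (z : int) (K : nat) : (`|z| <= K)%N ->
  [/\ (`|(z + K%:Z)%R| < K.*2.+1)%N, 0 <= z + K%:Z &
      ((`|(z + K%:Z)%R| - K) + (K - `|(z + K%:Z)%R|) = `|z|)%N].
Proof. by move=> zK; split; lia. Qed.

Definition supported (R : realType) p (S : {set 'I_p}) (v : 'cV[R]_p) : Prop :=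
  forall j, j \notin S -> v j 0 = 0.

Section net.
Context {R : realType} {p : nat} (S : {set 'I_p}) (k : nat).
Hypotheses (k0 : (0 < k)%N) (Sk : (#|S| <= k)%N).
(** A net point is an integer vector times the mesh. Its entries are stored with offset [M], so that
    the value [M] encodes 0, and [dist] is the absolute value of the decoded entry. The budget [5 k]
    is the largest l1 norm produced by rounding a vector of the unit ball supported on [k]
    coordinates. *)
Let M := (5 * k)%N.
Let dist (x : 'I_M.*2.+1) := ((x - M) + (M - x))%N.
Let I := {ffun 'I_p -> 'I_M.*2.+1}.
Let small (f : I) := [forall j, (j \notin S) ==> (f j == M :> nat)]
  && (\sum_j dist (f j) <= 5 * k)%N.

(* Give the integer vector with entries [f j - M] the weight
   [2 ^ - \sum_j dist (f j)]: the total weight is at most [3 ^ k], and each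
   member of [small] has weight at least [2 ^ - 5 k]. *)
Let card_small : (#|[pred f : I | small f]| <= 96 ^ k)%N.
Proof.
pose Q (j : 'I_p) := [pred x : 'I_M.*2.+1 | (j \in S) || (x == M :> nat)].
have h1 : (#|[pred f : I | small f]|)%:R <=
    (2 : R) ^+ (5 * k) * \sum_(f in family Q) \prod_j (2^-1) ^+ dist (f j).
  rewrite -sum1_card natr_sum mulr_sumr.
  apply: (@le_trans _ _ (\sum_(f : I | small f) (2 ^+ (5 * k) *
     \prod_j (2^-1) ^+ dist (f j)))).
    apply: ler_sum => f /andP[_ fd].
    rewrite prodrXr exprVn ler_pdivlMr ?exprn_gt0// mul1r.
    by rewrite ler_eXn2l// ltr1n.
  rewrite -mulr_sumr -mulr_sumr ler_wpM2l ?exprn_ge0//.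
  rewrite [leLHS]big_mkcond [leRHS]big_mkcond/=.
  apply: ler_sum => f _; case: ifPn => fs; last first.
    by case: ifP => // _; rewrite prodr_ge0// => j _; rewrite exprn_ge0 ?invr_ge0.
  case: ifPn => // /negP; case; apply/familyP => j; rewrite inE.
  move: fs => /andP[/forallP/(_ j)]; case: (j \in S) => //=.
rewrite -(ler_nat R) (le_trans h1)//.
rewrite -(bigA_distr_big_dep Q (fun _ x => 2^-1 ^+ dist x)).
apply: (@le_trans _ _ (2 ^+ (5 * k) * \prod_(j < p) (if j \in S then 3 else 1))).
  rewrite ler_wpM2l ?exprn_ge0//; apply: ler_prod => j _; rewrite sumr_ge0/=; last first.
    by move=> x _; rewrite exprn_ge0 ?invr_ge0.
  case: (boolP (j \in S)) => jS.
    rewrite /= sum_centered_geo.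
    by rewrite gerBl mulr_ge0// exprn_ge0// invr_ge0.
  have MM : (M < M.*2.+1)%N by lia.
  rewrite /= (big_pred1 (Ordinal MM)); last by move=> x /=; rewrite -val_eqE.
  by rewrite /dist/= subnn expr0.
rewrite -big_mkcond/= prodr_const.
(* The base 96 is [2 ^ 5] from the least weight of a member times 3 from the total weight per
   coordinate. *)
rewrite natrX (_ : 96%:R = 2 ^+ 5 * 3); last by rewrite -natrX -natrM.
rewrite exprMn -exprM ler_wpM2l ?exprn_ge0// ler_weXn2l// ler1n//.
Qed.

(* Round towards minus infinity on the grid of mesh [1 / (4 sqrt k)]. *)
Lemma grid_net : exists N : seq 'cV[R]_p,
  [/\ (size N <= 96 ^ k)%N,
      forall a, a \in N -> supported S a /\ nsq a <= (5 / 4) ^+ 2 &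
      forall v, supported S v -> nsq v <= 1 ->
        exists2 a, a \in N & nsq (v - a) <= (1 / 4) ^+ 2].
Proof.
pose q : R := Num.sqrt k%:R.
have kp : 0 < k%:R :> R by rewrite ltr0n.
have q0 : 0 < q by rewrite sqrtr_gt0.
have qq : q ^+ 2 = k%:R by rewrite sqr_sqrtr ?ler0n.
pose h : R := (4 * q)^-1.
have h0 : 0 < h by rewrite invr_gt0 mulr_gt0.
pose vec (f : I) : 'cV[R]_p := \col_j (h * ((f j)%:R - M%:R)).
pose N := [seq vec f | f <- enum [pred f : I | small f] & nsq (vec f) <= (5 / 4) ^+ 2].
exists N; split.
- by rewrite size_map size_filter (leq_trans (count_size _ _))// -cardE.
- move=> a /mapP[f]; rewrite mem_filter mem_enum inE => /andP[fn /andP[/forallP fs _]] ->.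
  split => // j jS; have /implyP/(_ jS)/eqP fj := fs j.
  by rewrite mxE fj subrr mulr0.
- move=> v vS v1.
  have vj1 j : v j 0 ^+ 2 <= 1.
    rewrite (le_trans _ v1)// nsqE (bigD1 j)//= lerDl sumr_ge0// => i _.
    exact: sqr_ge0.
  pose m (j : 'I_p) : int := Num.floor (v j 0 / h).
  have m1 j : h * (m j)%:~R <= v j 0 < h * ((m j)%:~R + 1).
    have := floor_itv (v j 0 / h); rewrite -/(m j) intrD.
    by rewrite ler_pdivlMr// ltr_pdivrMr// ![_ * h]mulrC.
  have mS j : j \notin S -> m j = 0.
    by move=> jS; rewrite /m vS// mul0r floor0.
  have hq : h * q = 1 / 4.
    by rewrite /h; field; rewrite lt0r_neq0.
  (* Rounding costs at most one unit, and [|v_j| / h = 4 sqrt k |v_j| <= 2 + 2 k v_j ^ 2] by the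
     inequality between means. Summed over at most [k] coordinates of a vector of the unit ball this
     gives [3 k + 2 k]. *)
  have mb j : (`|m j|%N)%:R <= 3 + 2 * k%:R * v j 0 ^+ 2 :> R.
    have -> : (`|m j|%N)%:R = `|(m j)%:~R| :> R by rewrite -intr_norm -abszE.
    have h1 : h * `|(m j)%:~R| <= `|v j 0| + h.
      rewrite -{1}(gtr0_norm h0) -normrM; have /andP[a b] := m1 j.
      have c : h * (m j)%:~R = v j 0 + (h * (m j)%:~R - v j 0) by lra.
      rewrite c (le_trans (ler_normD _ _))// lerD2l ler_norml; lra.
    rewrite -(ler_pM2l h0) (le_trans h1)//.
    have hi : h * 4 * q = 1 by rewrite mulrAC hq; lra.
    have h2 : `|v j 0| <= h * (2 + 2 * k%:R * v j 0 ^+ 2).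
      have -> : `|v j 0| = h * (4 * q * `|v j 0|) by rewrite !mulrA hi mul1r.
      rewrite ler_pM2l// -qq -[v j 0 ^+ 2]real_normK ?num_real//.
      by have := sqr_ge0 (1 - q * `|v j 0|); nra.
    by nra.
  have sumS : (\sum_(j in S) `|m j| <= M)%N.
    rewrite -(ler_nat R) natr_sum (le_trans (ler_sum _ (fun j _ => mb j)))//.
    rewrite big_split/= sumr_const -mulr_sumr -mulr_natl.
    have Sk' : #|S|%:R <= k%:R :> R by rewrite ler_nat.
    have : \sum_(i in S) v i 0 ^+ 2 <= 1.
      rewrite (le_trans _ v1)// nsqE [leRHS](bigID (mem S))/= lerDl sumr_ge0//.
      by move=> i _; exact: sqr_ge0.
    move=> vs; have := ler_wpM2l (ltW kp) vs; rewrite /M natrM; lra.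
  have mM j : (`|m j| <= M)%N.
    have [jS|jS] := boolP (j \in S); last by rewrite mS.
    by rewrite (leq_trans _ sumS)// (bigD1 j)//= leq_addr.
  pose f : I := [ffun j => inord `|(m j + M%:Z)%R|%N].
  have fE j : (f j : nat) = `|(m j + M%:Z)%R|%N.
    by have [mj _ _] := absz_shift (mM j); rewrite ffunE inordK.
  have fm j : (f j)%:R - M%:R = (m j)%:~R :> R.
    rewrite fE -[_%:R]/((`|(m j + M%:Z)%R|%N : int)%:~R) gez0_abs.
      by rewrite intrD addrK.
    by have := mM j; lia.
  have near : nsq (v - vec f) <= (1 / 4) ^+ 2.
    apply: (@le_trans _ _ (\sum_(j in S) h ^+ 2)).
      rewrite nsqE (bigID (mem S))/= [X in _ + X]big1 ?addr0.
        apply: ler_sum => j _; rewrite !mxE fm.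
        by have := m1 j; have := h0; nra.
      by move=> j jS; rewrite !mxE fm vS// mS// mulr0 subrr expr0n.
    rewrite sumr_const -[h ^+ 2 *+ _]mulr_natr -hq exprMn qq ler_wpM2l ?sqr_ge0// ler_nat//.
  exists (vec f) => //; apply/mapP; exists f => //.
  rewrite mem_filter mem_enum inE; apply/andP; split.
    rewrite -nrm_le; last by lra.
    have -> : vec f = v - (v - vec f) by rewrite opprB addrC subrK.
    rewrite (le_trans (nrmD _ _))// nrmN.
    have : nrm v <= 1 by rewrite nrm_le// expr1n.
    have : nrm (v - vec f) <= 1 / 4 by rewrite nrm_le//; lra.
    lra.
  apply/andP; split.
    by apply/forallP => j; apply/implyP => jS; rewrite fE mS.
  rewrite (bigID (mem S))/= [X in (_ + X)%N]big1 ?addn0.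
    rewrite (leq_trans _ sumS)// leq_sum// => j _.
    by have [_ _ mj] := absz_shift (mM j); rewrite /dist fE mj.
  by move=> j jS; have [_ _ mj] := absz_shift (mM j); rewrite /dist fE mj mS.
Qed.

End net.

(* If [q] is the supremum of [|v^T Q v|] over the unit ball of the coordinate
   subspace, then [v^T Q v - a^T Q a = (v + a)^T Q (v - a)] is at most
   [q (2 + 1/4) / 4], whence the factor [16 / 7]. *)
Lemma quad_net {R : realType} p (S : {set 'I_p}) (N : seq 'cV[R]_p)
    (Q : 'M[R]_p) (q : R) :
  Q^T = Q ->
  (forall a, a \in N -> supported S a /\ nsq a <= (5 / 4) ^+ 2) ->
  (forall v, supported S v -> nsq v <= 1 ->
     exists2 a, a \in N & nsq (v - a) <= (1 / 4) ^+ 2) ->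
  (forall a, a \in N -> `|dotv a (Q *m a)| <= q) ->
  forall v, supported S v -> `|dotv v (Q *m v)| <= 16 / 7 * q * nsq v.
Proof.
move=> Qt NS Nnet Nq.
pose E : set R := [set x | exists v, [/\ supported S v, nsq v <= 1 &
  x = `|dotv v (Q *m v)|]]%classic.
have E0 : E 0.
  exists 0; split; first by move=> j _; rewrite mxE.
  - by rewrite nsq0.
  - by rewrite mulmx0 /dotv mulmx0 mxE normr0.
have Eub : has_sup E.
  split; first by exists 0.
  exists (1 + fro Q) => _ [v [_ v1 ->]].
  have nv1 : nrm v <= 1 by rewrite nrm_le// expr1n.
  rewrite (le_trans (dotv_CS _ _))// (le_trans (ler_piMl (nrm_ge0 _) nv1))//.
  have fQ := fro_ge0 Q.
  rewrite nrm_le ?addr_ge0// (le_trans (nsq_mul_fro _ _))//.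
  by rewrite (le_trans (ler_wpM2l fQ v1))//; nra.
set s := sup E.
have s0 : 0 <= s by exact: (sup_upper_bound Eub E0).
have hom v : supported S v -> `|dotv v (Q *m v)| <= s * nsq v.
  move=> vS; have [v0|v0] := eqVneq (nsq v) 0.
    by rewrite (nsq_eq0 v0) nsq0 mulr0 mulmx0 /dotv mulmx0 mxE normr0.
  have vp : 0 < nsq v by rewrite lt_def v0 nsq_ge0.
  pose c := (nrm v)^-1.
  have c2 : c ^+ 2 * nsq v = 1 by rewrite exprVn sqr_nrm mulVf.
  have : E `|dotv (c *: v) (Q *m (c *: v))|.
    exists (c *: v); split => //; last by rewrite nsqZ c2.
    by move=> j jS; rewrite mxE vS// mulr0.
  move=> /(sup_upper_bound Eub); rewrite -/s -scalemxAr dotvZl dotvZr mulrA -expr2.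
  rewrite normrM ger0_norm ?sqr_ge0// => h.
  have := ler_wpM2r (ltW vp) h.
  by rewrite mulrAC c2 mul1r.
have bil x y : supported S x -> supported S y ->
    `|dotv x (Q *m y)| <= s / 2 * (nsq x + nsq y).
  move=> xS yS.
  have sQ : dotv y (Q *m x) = dotv x (Q *m y) by rewrite dotv_mulr Qt dotvC.
  have xyS : supported S (x + y) by move=> j jS; rewrite mxE xS// yS// addr0.
  have xzS : supported S (x - y) by move=> j jS; rewrite !mxE xS// yS// subr0.
  have := hom _ xyS; have := hom _ xzS.
  rewrite !mulmxDr !mulmxN !dotv_lin sQ !nsqD nsqN dotvNr.
  rewrite !ler_norml => /andP[a1 a2] /andP[a3 a4]; apply/andP; split; lra.
have sq : s <= q + 9 / 16 * s.
  apply: ge_sup; first by exists 0.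
  move=> _ [v [vS v1 ->]].
  have [a aN va] := Nnet v vS v1; have [aS a1] := NS a aN.
  have := Nq a aN.
  (* The factor 9 balances the polarization bound: both [v + a] and [9 (v - a)] have norm at most
     [9 / 4], so dividing by 9 again leaves [9 / 16 s]. *)
  have dS : supported S (9 *: (v - a)) by move=> j jS; rewrite !mxE vS// aS// subr0 mulr0.
  have eS : supported S (v + a) by move=> j jS; rewrite !mxE vS// aS// addr0.
  have nvS : nsq (v + a) <= (9 / 4) ^+ 2.
    rewrite -nrm_le// (le_trans (nrmD _ _))//.
    have : nrm v <= 1 by rewrite nrm_le// expr1n.
    have : nrm a <= 5 / 4 by rewrite nrm_le//.
    lra.
  have := bil _ _ eS dS.
  rewrite nsqZ -scalemxAr dotvZr.
  have -> : dotv (v + a) (Q *m (v - a)) = dotv v (Q *m v) - dotv a (Q *m a).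
    rewrite mulmxDr mulmxN !dotv_lin [dotv a (Q *m v)]dotv_mulr Qt (dotvC (Q *m a)).
    by ring.
  rewrite normrM ger0_norm// => h1 h2.
  have h4 : s / 2 * (nsq (v + a) + 9 ^+ 2 * nsq (v - a)) <= s / 2 * (81 / 8).
    by apply: ler_wpM2l; [rewrite divr_ge0|lra].
  move: h1 h2; set V := dotv v _; set A := dotv a _ => h1 h2.
  have h3 : `|V| <= `|V - A| + `|A| by rewrite -{1}(subrK A V) ler_normD.
  lra.
move=> v vS; rewrite (le_trans (hom v vS))// ler_wpM2r ?nsq_ge0//; lra.
Qed.

Local Open Scope classical_set_scope.

(** * Independence *)

Definition rect n T (C : 'I_n -> set T) : set (n.-tuple T) :=
  [set t | forall i, C i (tnth t i)].

Section rect.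
Context d (T : measurableType d) (n : nat).

Lemma measurable_rect (C : 'I_n -> set T) :
  (forall i, measurable (C i)) -> measurable (rect C).
Proof.
move=> mC; have -> : rect C = \bigcap_(i in [set: 'I_n]) ((@tnth n T)^~ i @^-1` C i).
  by apply/seteqP; split => [t h i _|t h i]; exact: h.
apply: fin_bigcap_measurable => // i _.
by rewrite -[X in measurable X]setTI; exact: measurable_tnth.
Qed.

Definition rects : set (set (n.-tuple T)) :=
  [set rect C | C in [set C : 'I_n -> set T | forall i, measurable (C i)]].

Lemma measurable_tuple_rects : @measurable _ (n.-tuple T) = <<s rects >>.
Proof.
apply/seteqP; split; last first.
  apply: smallest_sub; first exact: sigma_algebra_measurable.
  by move=> _ [C mC <-]; exact: measurable_rect.
apply: smallest_sub; first exact: smallest_sigma_algebra.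
rewrite -bigcup_seq => A [i _ [B mB <-]]; apply: sub_sigma_algebra.
exists (fun j => if j == i then B else setT).
  by move=> j /=; case: ifP => // _.
rewrite setTI; apply/seteqP; split => [t h|t h j] /=.
  by have := h i; rewrite eqxx.
by case: ifPn => // /eqP ->.
Qed.

Lemma setI_closed_rects : setI_closed rects.
Proof.
move=> _ _ [C mC <-] [D mD <-]; exists (fun i => C i `&` D i).
  by move=> i; exact: measurableI.
by apply/seteqP; split => [t h|t [h1 h2] i]; [split=> i; case: (h i)|split].
Qed.

Lemma rects_setT : rects setT.
Proof. by exists (fun=> setT); [move=> i|apply/seteqP; split]. Qed.

End rect.

Section tuple_indep.
Context d (T : measurableType d) (R : realType) (P : probability T R).
Context d1 (T1 : measurableType d1) (n : nat).

(** Both sides are finite measures in [C]. They agree on rectangles, which are stable under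
    intersection and generate the sigma-algebra of tuples, so uniqueness of measures extends the
    equality. *)
Lemma tuple_indep_event (U : T -> n.-tuple T1) (F : set T) :
    measurable_fun setT U -> measurable F ->
    (forall C : 'I_n -> set T1, (forall i, measurable (C i)) ->
      P (U @^-1` rect C `&` F) = (P (U @^-1` rect C) * P F)%E) ->
  forall C, measurable C -> P (U @^-1` C `&` F) = (P (U @^-1` C) * P F)%E.
Proof.
move=> mU mF h.
have PF0 : 0 <= fine (P F) by rewrite fine_ge0.
pose m1 : {measure set (n.-tuple T1) -> \bar R} :=
  measure_function_pushforward__canonical__measure_function_Measure (mrestr P mF) mU.
pose m2 : {measure set (n.-tuple T1) -> \bar R} :=
  mscale (NngNum PF0)
    (measure_function_pushforward__canonical__measure_function_Measure P mU).
have PFE : (fine (P F))%:E = P F by rewrite fineK// fin_num_measure.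
have m2E X : m2 X = (P (U @^-1` X) * P F)%E by rewrite -PFE muleC.
move=> C mC; rewrite -m2E.
have : m1 C = m2 C.
  apply: (measure_unique (@rects _ T1 n) (fun=> setT)) => //.
  - exact: measurable_tuple_rects.
  - exact: setI_closed_rects.
  - by move=> _; exact: rects_setT.
  - by rewrite bigcup_const.
  - by move=> _ [D mD <-]; rewrite m2E -h.
  - move=> _; rewrite /m1 /= /pushforward /mrestr.
    apply: (@le_lt_trans _ _ 1%E); last exact: ltry.
    by rewrite preimage_setT setTI; exact: probability_le1.
by move=> <-.
Qed.

End tuple_indep.

Section indep_pair.
Context d (T : measurableType d) (R : realType) (P : probability T R).
Context d1 (T1 : measurableType d1) d2 (T2 : measurableType d2).

(** Independence says that the joint law of [U] and [V] is the product of their laws; Tonelli then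
    integrates over [U] with [V] frozen. *)
Lemma ge0_integral_indep_pair (U : T -> T1) (V : T -> T2)
    (f : T1 * T2 -> \bar R) :
    measurable_fun setT U -> measurable_fun setT V ->
    independent_pair P U V -> measurable_fun [set: T1 * T2] f -> (forall z, (0 <= f z)%E) ->
  (\int[P]_w f (U w, V w) = \int[P]_w \int[P]_v f (U v, V w))%E.
Proof.
move=> mU mV UV mf f0.
pose U' : {mfun T >-> T1} := HB.pack U (isMeasurableFun.Build _ _ _ _ U mU).
pose V' : {mfun T >-> T2} := HB.pack V (isMeasurableFun.Build _ _ _ _ V mV).
have mUV : measurable_fun setT (fun w => (U w, V w)) by exact: measurable_fun_pair.
pose UV' : {mfun T >-> (T1 * T2)%type} :=
  HB.pack (fun w => (U w, V w)) (isMeasurableFun.Build _ _ _ _ _ mUV).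
have e : forall X, measurable X ->
    (distribution P U' \x distribution P V')%E X = distribution P UV' X.
  by apply: product_measure_unique => A B mA mB; exact: UV.
transitivity (\int[distribution P UV']_z f z)%E.
  by rewrite ge0_integral_distribution.
transitivity (\int[(distribution P U' \x distribution P V')%E]_z f z)%E.
  by apply: eq_measure_integral => A mA _; exact/esym/e.
rewrite fubini_tonelli2//= ge0_integral_distribution//; last 2 first.
- exact: measurable_fun_fubini_tonelli_G.
- by move=> y; exact: integral_ge0.
apply: eq_integral => w _ /=; rewrite /fubini_G ge0_integral_distribution//.
by apply: measurableT_comp.
Qed.

End indep_pair.

Section mutual_indep.
Context d (T : measurableType d) (R : realType) (P : probability T R).
Context d1 (T1 : measurableType d1).

Lemma mutually_independent_all n (Z : 'I_n -> T -> T1) (C : 'I_n -> set T1) :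
    mutually_independent P Z -> (forall i, measurable (C i)) ->
  P [set w | forall i, C i (Z i w)] = (\prod_i fine (P (Z i @^-1` C i)))%:E.
Proof.
move=> Zi mC; have := Zi [set: 'I_n]%SET C mC.
rewrite (eq_bigl xpredT); last by move=> i; rewrite inE.
move=> <-; congr (P _); apply/seteqP; split => [w h i _|w h i]; first exact: h.
by apply: h; rewrite /= inE.
Qed.

Lemma mutually_independent_lift n (Z : 'I_n.+1 -> T -> T1) :
  mutually_independent P Z ->
  mutually_independent P (fun i : 'I_n => Z (lift ord0 i)).
Proof.
move=> Zi J C mC.
pose D (i : 'I_n.+1) := if unlift ord0 i is Some j then C j else setT.
have mD i : measurable (D i) by rewrite /D; case: (unlift _ _).
have := Zi (lift ord0 @: J)%SET D mD.
rewrite big_imset/=; last by move=> i j _ _; exact: lift_inj.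
have DE i : D (lift ord0 i) = C i by rewrite /D liftK.
under eq_bigr do rewrite DE.
move=> <-; congr (P _); apply/seteqP; split => [w h i /= /imsetP[j jJ ->]|w h i iJ].
  by rewrite DE; exact: h.
by have := h (lift ord0 i); rewrite /= DE; apply; exact: imset_f.
Qed.

Lemma mutually_independent_tuple n (Z : 'I_n.+1 -> T -> T1) :
    (forall i, measurable_fun setT (Z i)) -> mutually_independent P Z ->
  independent_pair P (fun w => [tuple Z (lift ord0 i) w | i < n]) (Z ord0).
Proof.
move=> mZ Zi A B mA mB.
have mU : measurable_fun setT (fun w => [tuple Z (lift ord0 i) w | i < n]).
  apply/measurable_fun_tnthP => i.
  rewrite (_ : _ \o _ = Z (lift ord0 i))//; apply/funext => w /=.
  by rewrite tnth_mktuple.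
apply: tuple_indep_event => //.
  by rewrite -[X in measurable X]setTI; exact: mZ.
move=> C mC.
have E1 : (fun w => [tuple Z (lift ord0 i) w | i < n]) @^-1` rect C =
    [set w | forall i, C i (Z (lift ord0 i) w)].
  by apply/seteqP; split => w h i; have := h i; rewrite tnth_mktuple.
pose D (i : 'I_n.+1) := if unlift ord0 i is Some j then C j else B.
have mD i : measurable (D i) by rewrite /D; case: (unlift _ _).
have D0 : D ord0 = B by rewrite /D unlift_none.
have DE i : D (lift ord0 i) = C i by rewrite /D liftK.
rewrite E1 (mutually_independent_all (mutually_independent_lift Zi))//.
have PB : P (Z ord0 @^-1` B) = (fine (P (Z ord0 @^-1` B)))%:E.
  rewrite fineK// fin_num_measure// -[X in measurable X]setTI; exact: mZ.
rewrite [in RHS]PB -EFinM mulrC.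
have := mutually_independent_all Zi mD; rewrite big_ord_recl D0.
have -> : \prod_(i < n) fine (P (Z (lift ord0 i) @^-1` D (lift ord0 i))) =
    \prod_(i < n) fine (P (Z (lift ord0 i) @^-1` C i)).
  by apply: eq_bigr => i _; rewrite DE.
move=> <-; congr (P _); apply/seteqP; split => [w [h hB] i|w h].
  by case: (unliftP ord0 i) => [j ->|->]; rewrite ?DE ?D0.
by split=> [i|]; [have := h (lift ord0 i); rewrite DE|have := h ord0; rewrite D0].
Qed.

(** Induction on [n]: the first factor is independent of the tuple of the others, so it integrates
    separately. Nonnegativity lets the argument run on bounds alone, with no integrability to carry
    along. *)
Lemma integral_prod_le n (Z : 'I_n -> T -> T1) (f : T1 -> R) (c : R) :
    (forall i, measurable_fun setT (Z i)) -> mutually_independent P Z ->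
    measurable_fun setT f -> (forall x, 0 <= f x) -> 0 <= c ->
    (forall i, (\int[P]_w (f (Z i w))%:E <= c%:E)%E) ->
  (\int[P]_w (\prod_i f (Z i w))%:E <= (c ^+ n)%:E)%E.
Proof.
move=> + + mf f0 c0; elim: n Z => [|n IH] Z mZ Zi fc.
  under eq_integral do rewrite big_ord0.
  by rewrite integral_cst//= probability_setT mule1 expr0.
pose U w := [tuple Z (lift ord0 i) w | i < n].
have mU : measurable_fun setT U.
  apply/measurable_fun_tnthP => i.
  rewrite (_ : _ \o _ = Z (lift ord0 i))//; apply/funext => w /=.
  by rewrite tnth_mktuple.
pose F (z : n.-tuple T1 * T1) : \bar R := (\prod_i f (tnth z.1 i) * f z.2)%:E.
have mprod : measurable_fun [set: n.-tuple T1] (fun t => \prod_i f (tnth t i)).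
  apply: measurable_prod => i _; apply: measurableT_comp => //.
  exact: measurable_tnth.
have mF : measurable_fun [set: n.-tuple T1 * T1] F.
  apply/measurable_EFinP; apply: measurable_funM.
    exact: (measurableT_comp mprod measurable_fst).
  exact: (measurableT_comp mf measurable_snd).
have F0 z : (0 <= F z)%E by rewrite lee_fin mulr_ge0// prodr_ge0.
have UZ := mutually_independent_tuple mZ Zi.
have IHn := IH _ (fun i => mZ (lift ord0 i)) (mutually_independent_lift Zi)
  (fun i => fc (lift ord0 i)).
have e w : (\prod_i f (Z i w))%:E = F (U w, Z ord0 w).
  rewrite /F big_ord_recl mulrC; congr ((_ * _)%:E).
  by apply: eq_bigr => i _; rewrite tnth_mktuple.
under eq_integral do rewrite e.
rewrite (ge0_integral_indep_pair mU (mZ ord0) UZ mF F0).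
have inner w : (\int[P]_v F (U v, Z ord0 w) =
    (f (Z ord0 w))%:E * \int[P]_v (\prod_i f (Z (lift ord0 i) v))%:E)%E.
  rewrite -ge0_integralZl//.
  - apply: eq_integral => v _; rewrite /F/= mulrC EFinM; congr (_ * (_)%:E)%E.
    by apply: eq_bigr => i _; rewrite tnth_mktuple.
  - apply/measurable_EFinP; apply: measurable_prod => i _.
    exact: measurableT_comp.
  - by move=> v _; rewrite lee_fin prodr_ge0.
  - by rewrite lee_fin.
under eq_integral do rewrite inner.
have mfZ : measurable_fun setT (fun w => (f (Z ord0 w))%:E).
  by apply/measurable_EFinP; exact: measurableT_comp.
rewrite ge0_integralZr//; last 2 first.
- by move=> w _; rewrite lee_fin.
- by apply: integral_ge0 => w _; rewrite lee_fin prodr_ge0.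
rewrite exprS EFinM lee_pmul// ?fc//.
- by apply: integral_ge0 => w _; rewrite lee_fin.
- by apply: integral_ge0 => w _; rewrite lee_fin prodr_ge0.
Qed.

End mutual_indep.

(** * Means and the conditional risk *)

Section has_mean.
Context d (T : measurableType d) (R : realType) (P : probability T R).
Implicit Types (f g : T -> R).

(** Integrability and a real value are carried together, so that sums and scalings of expectations
    are computed in [R] rather than in the extended reals. *)
Definition has_mean f (r : R) : Prop :=
  P.-integrable setT (EFin \o f) /\ (\int[P]_w (f w)%:E = r%:E)%E.

(** The integral is the difference of the integrals of the positive and negative parts; a real
    difference forces both to be finite. *)
Lemma has_mean_fin f r :
  measurable_fun setT f -> (\int[P]_w (f w)%:E = r%:E)%E -> has_mean f r.
Proof.
move=> mf fr; split => //.
have mEf : measurable_fun setT (EFin \o f) by exact/measurable_EFinP.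
have : (\int[P]_w (f w)%:E)%E \is a fin_num by rewrite fr.
rewrite integralE fin_numB => /andP[/fineK fp /fineK fn].
apply/integrableP; split => //.
rewrite (_ : (fun w => _) = (EFin \o f)^\+ \+ (EFin \o f)^\-)%E; last by rewrite -fune_abse.
rewrite ge0_integralD//=.
- by rewrite -fp -fn ltry.
- exact: measurable_funepos.
- exact: measurable_funeneg.
Qed.

Lemma has_mean_cst r : has_mean (fun=> r) r.
Proof.
apply: has_mean_fin => //.
by rewrite integral_cst//= probability_setT mule1.
Qed.

Lemma has_meanD f g r s : has_mean f r -> has_mean g s -> has_mean (fun w => f w + g w) (r + s).
Proof.
move=> [fi fr] [gi gs]; split.
  rewrite (_ : _ \o _ = (EFin \o f) \+ (EFin \o g))%E//.
  exact: integrableD.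
by under eq_integral do rewrite EFinD; rewrite integralD// fr gs.
Qed.

Lemma has_meanZ f r a : has_mean f r -> has_mean (fun w => a * f w) (a * r).
Proof.
move=> [fi fr]; split.
  rewrite (_ : _ \o _ = (fun w => a%:E * (EFin \o f) w))%E//.
  exact: integrableZl.
by under eq_integral do rewrite EFinM; rewrite integralZl// fr.
Qed.

Lemma has_mean_sum (I : Type) (s : seq I) (F : I -> T -> R) (r : I -> R) :
  (forall i, has_mean (F i) (r i)) ->
  has_mean (fun w => \sum_(i <- s) F i w) (\sum_(i <- s) r i).
Proof.
move=> h; elim: s => [|i s IH].
  rewrite big_nil (_ : (fun w => _) = fun=> 0); first exact: has_mean_cst.
  by apply/funext => w; rewrite big_nil.
rewrite big_cons (_ : (fun w => _) = fun w => F i w + \sum_(j <- s) F j w).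
  exact: has_meanD.
by apply/funext => w; rewrite big_cons.
Qed.

Lemma has_mean_measurable f r : has_mean f r -> measurable_fun setT f.
Proof. by move=> [/measurable_int/measurable_EFinP]. Qed.

Lemma expectation_has_mean f r : measurable_fun setT f ->
  ('E_P[f] = r%:E)%E -> has_mean f r.
Proof. by move=> mf; rewrite unlock; exact: has_mean_fin. Qed.

Lemma covariance_has_mean f g r : has_mean f 0 -> has_mean g 0 ->
  covariance P f g = r%:E -> has_mean (fun w => f w * g w) r.
Proof.
move=> hf hg; rewrite unlock.
have Ef h : has_mean h 0 -> ('E_P[h] = 0)%E by move=> [_]; rewrite unlock.
rewrite (Ef _ hf) (Ef _ hg)/= => h; apply: expectation_has_mean.
  by apply: measurable_funM; [exact: has_mean_measurable hf|exact: has_mean_measurable hg].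
rewrite -h; congr ('E_P[_])%E; apply/funext => w /=.
by rewrite !fctE/= !subr0.
Qed.

(* The positive and negative parts of [f g] are
   [f^+ g^+ + f^- g^-] and [f^+ g^- + f^- g^+]. *)
Lemma has_mean_indepM f g :
  has_mean f 0 -> has_mean g 0 -> independent_pair P f g ->
  has_mean (fun w => f w * g w) 0.
Proof.
move=> hf hg ind.
have mf := has_mean_measurable hf; have mg := has_mean_measurable hg.
pose pos (x : R) := Num.max x 0; pose neg (x : R) := Num.max (- x) 0.
have mpos : measurable_fun setT pos by exact: measurable_maxr.
have mneg : measurable_fun setT neg.
  exact: measurable_maxr.
have pos0 x : 0 <= pos x by rewrite le_max lexx orbT.
have neg0 x : 0 <= neg x by rewrite le_max lexx orbT.
have pn x : x = pos x - neg x.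
  by rewrite /pos /neg; case: (leP x 0); case: (leP (- x) 0); lra.
have posi h : has_mean h 0 -> exists a, has_mean (pos \o h) a /\ has_mean (neg \o h) a.
  move=> hh; have mh := has_mean_measurable hh.
  have [hi h0] := hh.
  have e1 : (fun w => (pos (h w))%:E) = ((EFin \o h)^\+)%E.
    by apply/funext => w; rewrite funeposE/= -EFin_max.
  have e2 : (fun w => (neg (h w))%:E) = ((EFin \o h)^\-)%E.
    by apply/funext => w; rewrite funenegE/= -EFin_max.
  move: h0; rewrite integralE => h0.
  have : (\int[P]_w ((EFin \o h)^\+)%E w - \int[P]_w ((EFin \o h)^\-)%E w)%E \is a fin_num.
    by rewrite h0.
  rewrite fin_numB => /andP[fp fn].
  exists (fine (\int[P]_w ((EFin \o h)^\+)%E w)); split.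
    apply: has_mean_fin; first exact: measurableT_comp.
    by rewrite fineK// -e1.
  apply: has_mean_fin; first exact: measurableT_comp.
  rewrite fineK//; transitivity (\int[P]_w ((EFin \o h)^\-)%E w)%E; first by rewrite -e2.
  move: h0; rewrite -(fineK fp) -(fineK fn) -EFinB => -[/eqP].
  by rewrite subr_eq0 => /eqP ->.
have [a [fpa fna]] := posi _ hf; have [b [gpb gnb]] := posi _ hg.
have prod (u v : R -> R) r s : measurable_fun setT u -> measurable_fun setT v ->
    (forall x, 0 <= u x) -> (forall x, 0 <= v x) ->
    has_mean (u \o f) r -> has_mean (v \o g) s ->
    has_mean (fun w => u (f w) * v (g w)) (r * s).
  move=> mu mv u0 v0 hu hv; apply: has_mean_fin.
    by apply: measurable_funM; exact: measurableT_comp.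
  have mF : measurable_fun [set: R * R] (fun z : R * R => (u z.1 * v z.2)%:E).
    apply/measurable_EFinP; apply: measurable_funM.
      exact: (measurableT_comp mu measurable_fst).
    exact: (measurableT_comp mv measurable_snd).
  rewrite (ge0_integral_indep_pair (f := fun z => (u z.1 * v z.2)%:E) mf mg ind mF)/=.
    have inner w : (\int[P]_v0 (u (f v0) * v (g w))%:E = (v (g w) * r)%:E)%E.
      have [_ <-] := has_meanZ (v (g w)) hu.
      by apply: eq_integral => x _; rewrite mulrC.
    under eq_integral do rewrite inner.
    have [_ <-] := has_meanZ r hv.
    by apply: eq_integral => x _; rewrite mulrC.
  by move=> z; rewrite lee_fin mulr_ge0.
have -> : (fun w => f w * g w) = (fun w => (pos (f w) * pos (g w) + neg (f w) * neg (g w))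
    + (-1) * (pos (f w) * neg (g w) + neg (f w) * pos (g w))).
  by apply/funext => w; rewrite {1}(pn (f w)) {1}(pn (g w)); ring.
have -> : 0 = (a * b + a * b) + (-1) * (a * b + a * b) by ring.
by apply: has_meanD; [|apply: has_meanZ]; apply: has_meanD; apply: prod.
Qed.

End has_mean.

(** The square expands into a constant, a linear term of mean zero and a quadratic form in [H^T H].
    For uncorrelated noise only the diagonal of that form survives, and its trace is [fro H]. *)
Lemma has_mean_nsq d (T : measurableType d) (R : realType) (P : probability T R)
    n k (e : 'I_n -> T -> R) (s2 : R) (b : 'cV[R]_k) (H : 'M[R]_(k, n)) :
    (forall i, has_mean P (e i) 0) ->
    (forall i j, has_mean P (fun w => e i w * e j w) (if i == j then s2 else 0)) ->
  has_mean P (fun w => nsq (b + H *m \col_i e i w)) (nsq b + s2 * fro H).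
Proof.
move=> e1 e2.
pose c : 'cV[R]_n := H^T *m b; pose M := H^T *m H.
have -> : (fun w => nsq (b + H *m \col_i e i w)) = (fun w => nsq b +
    (\sum_i (2 * c i 0) * e i w + \sum_i \sum_j M i j * (e i w * e j w))).
  apply/funext => w; rewrite nsqD -addrA; congr (_ + (_ + _)).
    rewrite dotv_mulr -/c dotvE mulr_sumr; apply: eq_bigr => i _.
    by rewrite [(\col_i _) i 0]mxE mulrA.
  rewrite /nsq dotv_mull mulmxA -/M dotvE; apply: eq_bigr => i _.
  rewrite [(\col_i _) i 0]mxE [(M *m _) i 0]mxE mulr_sumr.
  by apply: eq_bigr => j _; rewrite [(\col_i _) j 0]mxE; ring.
apply: has_meanD; first exact: has_mean_cst.
have -> : s2 * fro H = \sum_i (2 * c i 0) * 0 +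
    \sum_i \sum_j M i j * (if i == j then s2 else 0).
  rewrite big1 ?add0r; last by move=> i _; rewrite mulr0.
  rewrite /fro -/M /mxtrace mulr_sumr; apply: eq_bigr => i _.
  rewrite (bigD1 i)//= eqxx big1 ?addr0 1?mulrC// => j ji.
  by rewrite eq_sym (negbTE ji) mulr0.
apply: has_meanD; apply: has_mean_sum => i; first exact: has_meanZ.
by apply: has_mean_sum => j; exact: has_meanZ.
Qed.

(** * Conditional risk given the design *)

Section cond_risk.
Context d (T : measurableType d) (R : realType) (P : probability T R).
Context d1 (T1 : measurableType d1) (n k : nat).
Variables (e : 'I_n -> T -> R) (V : T -> T1) (s2 : R).
Variables (b : T1 -> 'cV[R]_k) (H : T1 -> 'M[R]_(k, n)).
Hypotheses (me : forall i, measurable_fun setT (e i)) (mV : measurable_fun setT V).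
Hypothesis e1 : forall i, has_mean P (e i) 0.
Hypothesis e2 : forall i j,
  has_mean P (fun w => e i w * e j w) (if i == j then s2 else 0).
Hypothesis indep : independent_pair P (fun w => [tuple e i w | i < n]) V.
Hypothesis mb : forall i, measurable_fun setT (fun v => b v i 0).
Hypothesis mH : forall i j, measurable_fun setT (fun v => H v i j).

Let loss w := nsq (b (V w) + H (V w) *m \col_i e i w).
Let risk v := nsq (b v) + s2 * fro (H v).

Lemma measurable_risk : measurable_fun setT risk.
Proof.
apply: measurable_funD.
  apply: (eq_measurable_fun (fun v => \sum_i b v i 0 ^+ 2)).
    by move=> v _; rewrite nsqE.
  by apply: measurable_sum => i; exact: measurable_funX.
apply: measurable_funM => //.
apply: (eq_measurable_fun (fun v => \sum_i \sum_j H v i j ^+ 2)).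
  by move=> v _; rewrite fro_sum.
by do 2 apply: measurable_sum => ?; exact: measurable_funX.
Qed.

Let mE : measurable_fun setT (fun w => [tuple e i w | i < n]).
Proof.
apply/measurable_fun_tnthP => i.
rewrite (_ : _ \o _ = e i)//; apply/funext => w /=.
by rewrite tnth_mktuple.
Qed.

(** Noise and design being independent, the noise is integrated out with the design frozen. The
    indicator of [D] depends on the design alone and comes out of the inner integral as a
    constant. *)
Lemma integral_loss (D : set T1) : measurable D ->
  (\int[P]_(w in V @^-1` D) (loss w)%:E = \int[P]_(w in V @^-1` D) (risk (V w))%:E)%E.
Proof.
move=> mD.
have mVD : measurable (V @^-1` D) by rewrite -[X in measurable X]setTI; exact: mV.
pose F (z : n.-tuple R * T1) : \bar R :=
  (\1_D z.2 * nsq (b z.2 + H z.2 *m \col_i tnth z.1 i))%:E.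
have m2 (f : T1 -> R) : measurable_fun setT f ->
    measurable_fun [set: n.-tuple R * T1] (fun z : n.-tuple R * T1 => f z.2).
  by move=> mf; exact: (measurableT_comp mf measurable_snd).
have mF : measurable_fun [set: n.-tuple R * T1] F.
  apply/measurable_EFinP; apply: measurable_funM.
    by apply: m2; exact: measurable_indic.
  apply: (eq_measurable_fun (fun z : n.-tuple R * T1 =>
      \sum_i (b z.2 i 0 + \sum_j H z.2 i j * tnth z.1 j) ^+ 2)).
    move=> z _; rewrite nsqE; apply: eq_bigr => i _; rewrite !mxE.
    by congr ((_ + _) ^+ 2); apply: eq_bigr => j _; rewrite mxE.
  apply: measurable_sum => i; apply: measurable_funX; apply: measurable_funD.
    exact: (m2 (fun v => b v i 0)).
  apply: measurable_sum => j; apply: measurable_funM.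
    exact: (m2 (fun v => H v i j)).
  exact: (measurableT_comp (measurable_tnth j) measurable_fst).
have F0 z : (0 <= F z)%E.
  by rewrite lee_fin mulr_ge0 ?nsq_ge0// indicE; case: (_ \in _).
have ED (f : T -> R) : (\int[P]_(w in V @^-1` D) (f w)%:E =
    \int[P]_w (\1_D (V w) * f w)%:E)%E.
  rewrite [LHS]integral_mkcond; apply: eq_integral => w _.
  rewrite /patch/= indicE; have [wD|wD] := boolP (w \in V @^-1` D).
    by rewrite mem_set ?mul1r//; rewrite inE in wD.
  by rewrite memNset ?mul0r//; rewrite notin_setE in wD.
rewrite !ED.
transitivity (\int[P]_w F ([tuple e i w | i < n], V w))%E.
  apply: eq_integral => w _; rewrite /F/= /loss; congr (_ * nsq (_ + _ *m _))%:E.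
  by apply/matrixP => i j; rewrite !mxE tnth_mktuple.
rewrite (ge0_integral_indep_pair mE mV indep mF F0).
apply: eq_integral => w _; rewrite /F/=.
have [_ <-] := has_meanZ (\1_D (V w)) (has_mean_nsq (b (V w)) (H (V w)) e1 e2).
apply: eq_integral => v _; congr (_ * nsq (_ + _ *m _))%:E.
by apply/matrixP => i j; rewrite !mxE tnth_mktuple.
Qed.

Let S : measurableType _ := g_sigma_algebra_preimageType V.

Let pos_null (f : T -> R) (A : set T) : P.-integrable setT (EFin \o f) ->
  measurable A -> (forall w, A w -> 0 < f w) ->
  (\int[P]_(w in A) (f w)%:E = 0)%E -> P A = 0%E.
Proof.
move=> fi mA f0 If.
have mf : measurable_fun A (EFin \o f).
  by apply: measurable_funTS; exact: measurable_int fi.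
have /(ae_eq_integral_abs P mA mf)[B [mB PB AB]] :
    (\int[P]_(w in A) `|(EFin \o f) w| = 0)%E.
  rewrite -If; apply: eq_integral => w /[!inE] /f0 fw /=.
  by rewrite gtr0_norm.
apply/eqP; rewrite eq_le measure_ge0 andbT -PB le_measure ?inE//.
apply: (subset_trans _ AB) => w Aw /= /(_ Aw) [] fw.
by have := f0 _ Aw; rewrite fw ltxx.
Qed.

(** The difference between [M] and the risk has integral 0 over every event generated by [V]. The
    sets where it is positive and where it is negative are such events, so both are null, and off
    their union the two functions coincide. *)
Lemma cond_risk_ae (M : T -> R) :
  cond_expectation_version P (g_sigma_algebra_preimage V) loss M ->
  exists N, [/\ measurable N, P N = 0%E & forall w, ~ N w -> M w = risk (V w)].
Proof.
move=> [MG Mi ME].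
have mR : measurable_fun setT (risk \o V) by exact: measurableT_comp measurable_risk mV.
have Ri : P.-integrable setT (EFin \o (risk \o V)).
  have GT : g_sigma_algebra_preimage V setT.
    by exists setT => //; rewrite setTI preimage_setT.
  have := ME setT GT; rewrite -(preimage_setT V) integral_loss// preimage_setT => h.
  have Mfin : (\int[P]_w (M w)%:E)%E \is a fin_num by exact: integrable_fin_num.
  have [] // := @has_mean_fin _ _ _ P (risk \o V) (fine (\int[P]_w (M w)%:E)%E) mR.
  by rewrite fineK.
have GE A : g_sigma_algebra_preimage V A ->
    measurable A /\ (\int[P]_(w in A) (M w - risk (V w))%:E = 0)%E.
  move=> GA; have [D mD] := GA; rewrite setTI => DA.
  have mA : measurable A by rewrite -DA -[X in measurable X]setTI; exact: mV.
  split => //; under eq_integral do rewrite EFinB.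
  have MiA : P.-integrable A (EFin \o M) by exact: integrableS Mi.
  have RiA : P.-integrable A (EFin \o (risk \o V)) by exact: integrableS Ri.
  have -> := integralB mA MiA RiA.
  rewrite [X in (X - _)%E](ME A GA) -DA integral_loss// subee//.
  rewrite DA; exact: (integrable_fin_num mA RiA).
(* [S] is the sample space with the sigma-algebra generated by [V]. Measurability on [S] is what
   places the two sign sets of the difference among the events where [M] and the risk are
   comparable. *)
have mSM : measurable_fun setT (M : S -> R).
  by move=> _ B mB; rewrite setTI; exact: MG.
have mSV : measurable_fun setT (V : S -> T1) by move=> _ B mB; exists B.
have mSR : measurable_fun setT ((fun w => M w - risk (V w)) : S -> R).
  by apply: measurable_funB => //; exact: measurableT_comp measurable_risk mSV.
have G1 : g_sigma_algebra_preimage V [set w | 0 < M w - risk (V w)].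
  have := mSR measurableT `]0, +oo[%classic (measurable_itv _).
  rewrite setTI; congr (g_sigma_algebra_preimage V _); apply/seteqP.
  by split => w /=; rewrite in_itv/= andbT.
have G2 : g_sigma_algebra_preimage V [set w | M w - risk (V w) < 0].
  have := mSR measurableT `]-oo, 0[%classic (measurable_itv _).
  rewrite setTI (_ : _ @^-1` _ = [set w | M w - risk (V w) < 0])//.
have [m1 I1] := GE _ G1; have [m2 I2] := GE _ G2.
have fi : P.-integrable setT (EFin \o (fun w => M w - risk (V w))).
  rewrite (_ : _ \o _ = (EFin \o M) \- (EFin \o (risk \o V)))%E//.
  exact: integrableB.
have fiN : P.-integrable setT (EFin \o (fun w => - (M w - risk (V w)))).
  exact: integrableN fi.
have PA1 := pos_null fi m1 (fun w h => h) I1.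
have PA2 : P [set w | M w - risk (V w) < 0] = 0%E.
  apply: (pos_null fiN m2) => [w|]; first by rewrite /= oppr_gt0.
  under eq_integral do rewrite EFinN.
  rewrite integralN/= ?I2 ?oppe0//.
  by apply: integrable_add_def => //; exact: integrableS fi.
exists ([set w | 0 < M w - risk (V w)] `|` [set w | M w - risk (V w) < 0]); split.
- exact: measurableU.
- apply/eqP; rewrite eq_le measure_ge0 andbT.
  apply: (le_trans (measureU2 P m1 m2)); rewrite -[leRHS]adde0.
  by apply: leeD; [move: PA1 => /= -> | move: PA2 => /= ->].
- move=> w nN; case: (ltgtP 0 (M w - risk (V w))) => h.
  + by exfalso; apply: nN; left.
  + by exfalso; apply: nN; right.
  + by apply/eqP; rewrite -subr_eq0 -h.
Qed.

End cond_risk.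

(** * Independence of the noise from the design *)

Section noise_indep.
Context d (T : measurableType d) (R : realType) (P : probability T R).
Context d1 (T1 : measurableType d1) (n : nat).
Variables (e : 'I_n -> T -> R) (x : 'I_n -> T -> T1) (g : T1 -> R).
Hypotheses (me : forall i, measurable_fun setT (e i))
  (mx : forall i, measurable_fun setT (x i)) (mg : measurable_fun setT g).
Hypothesis zi : mutually_independent P
  (fun i w => (g (x i w) + e i w, x i w) : (R * T1)%type).
Hypothesis xe : forall i, independent_pair P (x i) (e i).

Let mtup d' (T' : measurableType d') (f : 'I_n -> T -> T') :
  (forall i, measurable_fun setT (f i)) ->
  measurable_fun setT (fun w => [tuple f i w | i < n]).
Proof.
move=> mf; apply/measurable_fun_tnthP => i.
rewrite (_ : _ \o _ = f i)//; apply/funext => w /=.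
by rewrite tnth_mktuple.
Qed.

(** The shear [(y, x)] to [(y - g x, x)] turns a rectangle in noise and design into a measurable set
    of observations, to which mutual independence of the pairs applies. Each factor then splits by
    the independence of [x i] and [e i]. *)
Let rect_prob (C : 'I_n -> set R) (D : 'I_n -> set T1) :
  (forall i, measurable (C i)) -> (forall i, measurable (D i)) ->
  P [set w | forall i, C i (e i w) /\ D i (x i w)] =
  (\prod_i (fine (P (e i @^-1` C i)) * fine (P (x i @^-1` D i))))%:E.
Proof.
move=> mC mD.
pose B i : set (R * T1) := (fun z : R * T1 => z.1 - g z.2) @^-1` C i `&` snd @^-1` D i.
have mB i : measurable (B i).
  apply: measurableI.
    rewrite -[X in measurable X]setTI.
    have mh : measurable_fun [set: R * T1] (fun z : R * T1 => z.1 - g z.2).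
      apply: measurable_funB; first exact: measurable_fst.
      exact: (measurableT_comp mg measurable_snd).
    exact: mh.
  by rewrite -[X in measurable X]setTI; exact: measurable_snd.
have := mutually_independent_all zi mB.
have BE i : (fun w => (g (x i w) + e i w, x i w)) @^-1` B i =
    x i @^-1` D i `&` e i @^-1` C i.
  by apply/seteqP; split => w /=; rewrite /B/= addrAC subrr add0r => -[].
have -> : [set w | forall i, B i (g (x i w) + e i w, x i w)] =
    [set w | forall i, C i (e i w) /\ D i (x i w)].
  by apply/seteqP; split => w /= h i; have := h i; rewrite /B/= addrAC subrr add0r.
move=> ->; congr (_%:E); apply: eq_bigr => i _.
rewrite BE xe// fineM 1?mulrC// fin_num_measure// -[X in measurable X]setTI.
  exact: mx.
exact: me.
Qed.

(* Only the pairs [(y_i, x_i)] are assumed mutually independent;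
   [e_i = y_i - g (x_i)] turns this into a product rule for the [e_i] and [x_i]. *)
Lemma noise_design_indep :
  independent_pair P (fun w => [tuple e i w | i < n]) (fun w => [tuple x i w | i < n]).
Proof.
have me' := mtup me; have mx' := mtup mx.
have E1 (C : 'I_n -> set R) : (fun w => [tuple e i w | i < n]) @^-1` rect C =
    [set w | forall i, C i (e i w)].
  by apply/seteqP; split => w h i; have := h i; rewrite tnth_mktuple.
have E2 (C : 'I_n -> set T1) : (fun w => [tuple x i w | i < n]) @^-1` rect C =
    [set w | forall i, C i (x i w)].
  by apply/seteqP; split => w h i; have := h i; rewrite tnth_mktuple.
move=> A B mA mB; apply: tuple_indep_event => //.
  by rewrite -[X in measurable X]setTI; exact: mx'.
move=> C mC; rewrite setIC muleC.
move: B mB; apply: tuple_indep_event => //.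
  by rewrite -[X in measurable X]setTI; apply: me' => //; exact: measurable_rect.
move=> D mD; rewrite setIC muleC E1 E2.
have -> : [set w | forall i, C i (e i w)] `&` [set w | forall i, D i (x i w)] =
    [set w | forall i, C i (e i w) /\ D i (x i w)].
  by apply/seteqP; split => [w [h1 h2] i|w h]; split=> // i; case: (h i).
have := rect_prob mC (fun=> measurableT).
have := rect_prob (fun=> measurableT) mD.
rewrite (rect_prob mC mD).
have -> : [set w | forall i, [set: R] (e i w) /\ D i (x i w)] = [set w | forall i, D i (x i w)].
  by apply/seteqP; split => w h i; [case: (h i)|split].
have -> : [set w | forall i, C i (e i w) /\ [set: T1] (x i w)] = [set w | forall i, C i (e i w)].
  by apply/seteqP; split => w h i; [case: (h i)|split].
by move=> -> ->; rewrite -EFinM -big_split/=; congr (_%:E); apply: eq_bigr => i _;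
  rewrite !preimage_setT !probability_setT mul1r mulr1.
Qed.

Lemma noise_pairwise_indep i j : i != j -> independent_pair P (e i) (e j).
Proof.
move=> ij A B mA mB.
pose C k := if k == i then A else if k == j then B else setT.
have mC k : measurable (C k) by rewrite /C; case: ifP => // _; case: ifP.
pose CA k := if k == i then A else setT.
pose CB k := if k == j then B else setT.
have mCA k : measurable (CA k) by rewrite /CA; case: ifP.
have mCB k : measurable (CB k) by rewrite /CB; case: ifP.
have rp D : (forall k, measurable (D k)) -> P [set w | forall k, D k (e k w)] =
    (\prod_k fine (P (e k @^-1` D k)))%:E.
  move=> mD; have := rect_prob mD (fun=> measurableT).
  have -> : [set w | forall i, D i (e i w) /\ [set: T1] (x i w)] = [set w | forall i, D i (e i w)].
    by apply/seteqP; split => w h k; [case: (h k)|split].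
  by move=> ->; congr (_%:E); apply: eq_bigr => k _; rewrite preimage_setT probability_setT mulr1.
have -> : e i @^-1` A = [set w | forall k, CA k (e k w)].
  apply/seteqP; split => [w h k|w h]; first by rewrite /CA; case: eqP => // ->.
  by have := h i; rewrite /CA eqxx.
have -> : e j @^-1` B = [set w | forall k, CB k (e k w)].
  apply/seteqP; split => [w h k|w h]; first by rewrite /CB; case: eqP => // ->.
  by have := h j; rewrite /CB eqxx.
have -> : [set w | forall k, CA k (e k w)] `&` [set w | forall k, CB k (e k w)] =
    [set w | forall k, C k (e k w)].
  apply/seteqP; split => [w [h1 h2] k|w h].
    by have := h1 k; have := h2 k; rewrite /CA /CB /C; case: (k == i); case: (k == j).
  split => k; have := h k; rewrite /CA /CB /C; first by case: ifP.
  by case: ifP => [/eqP ->|]; rewrite ?(negbTE ij).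
rewrite !rp// -EFinM -big_split/=; congr (_%:E); apply: eq_bigr => k _.
rewrite /C /CA /CB; have [->|ki] := eqVneq k i.
  by rewrite (negbTE ij) preimage_setT probability_setT mulr1.
by rewrite preimage_setT probability_setT mul1r.
Qed.

End noise_indep.

(** * Concentration of sub-exponential averages *)

(** From [expR (- x) >= 1 - x] one gets [expR x - 1 <= x expR x]. For [x >= 0] this is used once
    more after multiplication by [x]; for [x <= 0] the bound [expR x >= 1 + x] replaces the
    right-hand side by [x + x ^ 2]. *)
Lemma expR_le_quad (R : realType) (x : R) : expR x <= 1 + x + x ^+ 2 * expR `|x|.
Proof.
have h : expR x - 1 <= x * expR x.
  have := expR_ge1Dx (- x); rewrite expRN => h.
  have e0 := expR_gt0 x.
  have := ler_wpM2r (ltW e0) h; rewrite mulVf ?gt_eqF//; nra.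
have [x0|x0] := leP 0 x.
  rewrite ger0_norm//; have := ler_wpM2l x0 h; nra.
have e1 : 1 <= expR `|x| by rewrite -expR0 ler_expR.
have := ler_wpM2l (sqr_ge0 x) e1.
have := expR_ge1Dx x; nra.
Qed.

Section bounded_mean.
Context d (T : measurableType d) (R : realType) (P : probability T R).
Implicit Types (f g : T -> R).

(** One-sided counterpart of [has_mean] for nonnegative functions; exponential moments are only ever
    bounded from above. *)
Definition bmean f (c : R) : Prop :=
  [/\ measurable_fun setT f, forall w, 0 <= f w &
      (\int[P]_w (f w)%:E <= c%:E)%E].

Lemma bmean_le f c c' : bmean f c -> c <= c' -> bmean f c'.
Proof. by move=> [mf f0 fc] cc'; split=> //; rewrite (le_trans fc)// lee_fin. Qed.

Lemma bmean_lef f g c : bmean g c -> measurable_fun setT f ->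
  (forall w, 0 <= f w <= g w) -> bmean f c.
Proof.
move=> [mg g0 gc] mf fg; split => //.
  by move=> w; case/andP: (fg w).
rewrite (le_trans _ gc)//; apply: ge0_le_integral => //.
- by move=> w _; rewrite lee_fin; case/andP: (fg w).
- exact/measurable_EFinP.
- exact/measurable_EFinP.
- by move=> w _; rewrite lee_fin; case/andP: (fg w).
Qed.

Lemma bmeanZ f c a : 0 <= a -> bmean f c -> bmean (fun w => a * f w) (a * c).
Proof.
move=> a0 [mf f0 fc]; split; first exact: measurable_funM.
  by move=> w; rewrite mulr_ge0.
under eq_integral do rewrite EFinM.
rewrite ge0_integralZl ?lee_fin//.
- by rewrite EFinM lee_wpmul2l.
- exact/measurable_EFinP.
- by move=> w _; rewrite lee_fin.
Qed.

Lemma bmeanD f g a b : bmean f a -> bmean g b -> bmean (fun w => f w + g w) (a + b).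
Proof.
move=> [mf f0 fa] [mg g0 gb]; split; first exact: measurable_funD.
  by move=> w; rewrite addr_ge0.
under eq_integral do rewrite EFinD.
rewrite ge0_integralD//; first by rewrite EFinD leeD.
- by move=> w _; rewrite lee_fin.
- exact/measurable_EFinP.
- by move=> w _; rewrite lee_fin.
- exact/measurable_EFinP.
Qed.

Lemma bmean_sum (I : eqType) (s : seq I) (F : I -> T -> R) (c : I -> R) :
  (forall i, i \in s -> bmean (F i) (c i)) ->
  bmean (fun w => \sum_(i <- s) F i w) (\sum_(i <- s) c i).
Proof.
elim: s => [_|i s IH h].
  rewrite big_nil (_ : (fun w => _) = fun=> 0); last first.
    by apply/funext => w; rewrite big_nil.
  by split=> //; rewrite integral0.
rewrite big_cons (_ : (fun w => _) = fun w => F i w + \sum_(j <- s) F j w).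
  apply: bmeanD; first by apply: h; rewrite mem_head.
  by apply: IH => j js; apply: h; rewrite in_cons js orbT.
by apply/funext => w; rewrite big_cons.
Qed.

Lemma bmean_markov f c a : 0 < a -> bmean f c ->
  (P [set w | a <= f w]%R <= (c / a)%:E)%E /\ measurable [set w | a <= f w].
Proof.
move=> a0 [mf f0 fc].
have mA : measurable [set w | a <= f w].
  have := mf measurableT `[a, +oo[%classic (measurable_itv _).
  rewrite setTI (_ : _ @^-1` _ = [set w | a <= f w])//.
  by apply/funext => w; rewrite /preimage/= in_itv/= andbT.
split => //.
have [m1 f1 h1] : bmean (fun w => \1_[set w | a <= f w] w) (c / a).
  rewrite mulrC; apply: (@bmean_lef _ (fun w => a^-1 * f w)).
  - by apply: bmeanZ => //; rewrite invr_ge0 ltW.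
  - exact: measurable_indic.
  - move=> w; rewrite indicE; apply/andP; split; first by case: (_ \in _).
    have [|] := boolP (w \in _) => wA; last by rewrite mulr_ge0// invr_ge0 ltW.
    by rewrite inE/= in wA; rewrite mulrC ler_pdivlMr// mul1r.
by move: h1; rewrite integral_indic// setIT.
Qed.

Lemma bmean_has_mean f c : bmean f c -> exists2 r, has_mean P f r & r <= c.
Proof.
move=> [mf f0 fc].
have fin : (\int[P]_w (f w)%:E)%E \is a fin_num.
  rewrite ge0_fin_numE; first by rewrite (le_lt_trans fc) ?ltry.
  by apply: integral_ge0 => w _; rewrite lee_fin.
exists (fine (\int[P]_w (f w)%:E)%E); last by rewrite -lee_fin fineK.
by apply: has_mean_fin => //; rewrite fineK.
Qed.

Lemma has_mean_bmean f r : has_mean P f r -> (forall w, 0 <= f w) -> bmean f r.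
Proof.
by move=> h f0; split=> //; [exact: has_mean_measurable h|rewrite h.2].
Qed.

(** The linear term vanishes because [W] has mean 1. For the quadratic one put [y = W - 1] and
    [u = |y| / (2 K)]: then [|s y| <= u], [u ^ 2 <= 4 expR u], and [2 u = |y| / K <= 1 + W / K].
    Hence the remainder is at most [16 s ^ 2 K ^ 2 expR 1] times [expR (W / K)], and the exponential
    moment 2 brings the constant to 32. *)
Lemma mgf_le (W : T -> R) (K s : R) :
    1 <= K -> (forall w, 0 <= W w) -> has_mean P W 1 ->
    bmean (fun w => expR (W w / K)) 2 -> `|s| <= (2 * K)^-1 ->
  bmean (fun w => expR (s * (W w - 1))) (expR (32 * expR 1 * s ^+ 2 * K ^+ 2)).
Proof.
move=> K1 W0 W1 WK sK.
have K0 : 0 < K by rewrite (lt_le_trans _ K1).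
pose A := 16 * s ^+ 2 * K ^+ 2 * expR 1.
have A0 : 0 <= A.
  by rewrite mulr_ge0 ?expR_ge0// mulr_ge0 ?sqr_ge0// mulr_ge0 ?sqr_ge0.
have [r hr r2] := bmean_has_mean WK.
have mW := has_mean_measurable W1.
have hm : has_mean P (fun w => (1 + s * (W w + (-1))) + A * expR (W w / K))
    (1 + s * (1 + (-1)) + A * r).
  apply: has_meanD; last exact: has_meanZ.
  apply: has_meanD; first exact: has_mean_cst.
  by apply: has_meanZ; apply: has_meanD => //; exact: has_mean_cst.
have key w : expR (s * (W w - 1)) <= (1 + s * (W w + (-1))) + A * expR (W w / K).
  set y := W w - 1.
  rewrite (le_trans (expR_le_quad _))// lerD2l.
  pose u := `|y| / (2 * K).
  have u0 : 0 <= u by rewrite divr_ge0// mulr_ge0// ltW.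
  have yE : `|y| = 2 * K * u by rewrite /u mulrC divfK// mulf_neq0// gt_eqF.
  have hu : u ^+ 2 <= 4 * expR u.
    have h1 := expR_ge1Dx (u / 2).
    have h2 : expR u = expR (u / 2) ^+ 2 by rewrite expr2 -expRD; congr expR; lra.
    rewrite h2; have : 0 <= u / 2 by rewrite divr_ge0.
    nra.
  have su : `|s * y| <= u.
    by rewrite normrM mulrC /u ler_wpM2l.
  have yu : expR `|s * y| * expR u <= expR 1 * expR (W w / K).
    rewrite -!expRD ler_expR (le_trans (lerD su (lexx u)))//.
    have : `|y| <= W w + 1.
      by rewrite ler_norml /y; have := W0 w; lra.
    have -> : u + u = `|y| / K by rewrite yE; field; rewrite gt_eqF.
    move=> h; rewrite ler_pdivrMr//; rewrite mulrDl mul1r divfK ?gt_eqF//; lra.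
  have -> : (s * y) ^+ 2 = s ^+ 2 * (4 * K ^+ 2 * u ^+ 2).
    by rewrite exprMn -[y ^+ 2]real_normK ?num_real// yE; ring.
  have s2 := sqr_ge0 s.
  have e0 := expR_ge0 `|s * y|.
  rewrite (@le_trans _ _ (s ^+ 2 * (16 * K ^+ 2) * (expR u * expR `|s * y|)))//.
    have h3 : 4 * K ^+ 2 * u ^+ 2 <= 16 * K ^+ 2 * expR u.
      by have := ler_wpM2l (sqr_ge0 K) hu; lra.
    by have := ler_wpM2r e0 (ler_wpM2l s2 h3); rewrite !mulrA.
  rewrite (_ : A * _ = s ^+ 2 * (16 * K ^+ 2) * (expR 1 * expR (W w / K))); last by rewrite /A; ring.
  have c0 : 0 <= s ^+ 2 * (16 * K ^+ 2) by rewrite mulr_ge0// mulr_ge0// sqr_ge0.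
  by rewrite ler_wpM2l// mulrC.
have hb := has_mean_bmean hm (fun w => le_trans (expR_ge0 _) (key w)).
apply: (bmean_le (bmean_lef hb _ _)).
- by apply: measurableT_comp => //; apply: measurable_funM => //; exact: measurable_funB.
- by move=> w; rewrite expR_ge0 key.
- rewrite subrr mulr0 addr0 (le_trans _ (expR_ge1Dx _))// lerD2l.
  rewrite (_ : 32 * _ * _ * _ = A * 2); last by rewrite /A; ring.
  by rewrite ler_wpM2l.
Qed.

End bounded_mean.

Lemma mutually_independent_comp d (T : measurableType d) (R : realType)
    (P : probability T R) d1 (T1 : measurableType d1) d2 (T2 : measurableType d2)
    (I : finType) (Z : I -> T -> T1) (h : T1 -> T2) :
  measurable_fun setT h -> mutually_independent P Z ->
  mutually_independent P (fun i w => h (Z i w)).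
Proof.
move=> mh Zi J B mB; apply: (Zi J (fun i => h @^-1` B i)) => i.
by rewrite -[X in measurable X]setTI; exact: mh.
Qed.

Section concentration.
Context d (T : measurableType d) (R : realType) (P : probability T R).
Context d1 (T1 : measurableType d1) (n : nat) (x : 'I_n -> T -> T1).
Hypotheses (mx : forall i, measurable_fun setT (x i))
  (xi : mutually_independent P x).

Lemma bmean_prod (f : T1 -> R) (c : R) : measurable_fun setT f ->
  (forall z, 0 <= f z) -> 0 <= c -> (forall i, bmean P (fun w => f (x i w)) c) ->
  bmean P (fun w => \prod_i f (x i w)) (c ^+ n).
Proof.
move=> mf f0 c0 fc; split.
- by apply: measurable_prod => i _; exact: measurableT_comp.
- by move=> w; rewrite prodr_ge0.
- by apply: integral_prod_le => // i; case: (fc i).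
Qed.

(** Chernoff's method for both tails: the moment generating function of the sum is a product by
    independence, and Markov's inequality is applied at parameters [s] and [- s]. *)
Lemma concentration (W : T1 -> R) (K eta : R) :
    measurable_fun setT W -> (forall z, 0 <= W z) ->
    (forall i, has_mean P (fun w => W (x i w)) 1) ->
    1 <= K -> (forall i, bmean P (fun w => expR (W (x i w) / K)) 2) ->
    0 < eta <= 1 ->
  let B := [set w | n%:R * eta <= `|\sum_i W (x i w) - n%:R| ] in
  measurable B /\
  (P B <= (2 * expR (- (n%:R * (eta ^+ 2 / (128 * expR 1 * K ^+ 2)))))%:E)%E.
Proof.
move=> mW W0 W1 K1 WK /andP[eta0 eta1] B.
have K0 : 0 < K by rewrite (lt_le_trans _ K1).
have e1 : 1 <= expR 1 :> R by rewrite -{1}expR0 ler_expR.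
have e0 : 0 < expR 1 :> R := expR_gt0 _.
(* This [s] minimizes [32 expR 1 s ^ 2 K ^ 2 - s eta], with minimum
   [- eta ^ 2 / (128 expR 1 K ^ 2)]. The assumptions [eta <= 1] and [K >= 1] keep it in the range
   allowed by [mgf_le]. *)
pose s := eta / (64 * expR 1 * K ^+ 2).
have s0 : 0 < s by rewrite divr_gt0// !mulr_gt0// exprn_gt0.
have sK : s <= (2 * K)^-1.
  rewrite /s ler_pdivrMr ?mulr_gt0 ?exprn_gt0//.
  rewrite (_ : _ * (_ * _) = 32 * expR 1 * K); last by field; rewrite gt_eqF.
  by rewrite (le_trans eta1)//; nra.
have tail (t : R) : `|t| = s ->
    let A := [set w | s * (n%:R * eta) <= t * (\sum_i W (x i w) - n%:R)] in
    measurable A /\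
    (P A <= (expR (- (n%:R * (eta ^+ 2 / (128 * expR 1 * K ^+ 2)))))%:E)%E.
  move=> ts A.
  have b1 : bmean P (fun w => \prod_i expR (t * (W (x i w) - 1)))
      (expR (32 * expR 1 * t ^+ 2 * K ^+ 2) ^+ n).
    have mf : measurable_fun setT (fun z => expR (t * (W z - 1))).
      apply: measurableT_comp => //; apply: measurable_funM => //.
      exact: measurable_funB.
    have tK : `|t| <= (2 * K)^-1 by rewrite ts.
    exact: (bmean_prod mf (fun z => expR_ge0 _) (expR_ge0 _)
      (fun i => mgf_le K1 (fun w => W0 (x i w)) (W1 i) (WK i) tK)).
  have [PA mA] := bmean_markov (expR_gt0 (s * (n%:R * eta))) b1.
  have AE : A = [set w | expR (s * (n%:R * eta)) <= \prod_i expR (t * (W (x i w) - 1))].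
    apply/funext => w; rewrite /A/=; congr is_true.
    rewrite -expR_sum ler_expR -mulr_sumr sumrB; congr (_ <= _ * (_ - _)).
    by rewrite sumr_const card_ord.
  rewrite AE; split => //; rewrite (le_trans PA)// lee_fin -expRM_natl -expRN -expRD ler_expR.
  rewrite -[t ^+ 2]real_normK ?num_real// ts /s.
  rewrite le_eqVlt; apply/orP; left; apply/eqP; field.
  by rewrite !gt_eqF.
have [m1 P1] := tail s (gtr0_norm s0).
have [m2 P2] := tail (- s) (etrans (normrN _) (gtr0_norm s0)).
have BE : B = [set w | s * (n%:R * eta) <= s * (\sum_i W (x i w) - n%:R)] `|`
    [set w | s * (n%:R * eta) <= - s * (\sum_i W (x i w) - n%:R)].
  apply/seteqP; split => w; rewrite /B/= mulNr -mulrN !ler_pM2l//.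
    by rewrite ler_normr => /orP.
  by move=> h; rewrite ler_normr; apply/orP.
rewrite BE; split; first exact: measurableU.
apply: (le_trans (measureU2 P m1 m2)).
by rewrite mulrDl mul1r EFinD; exact: leeD.
Qed.

End concentration.

(** * The good event for a whitened design *)

(** Each [expR (a i)] lies above the tangent of [expR] at the weighted mean [m], and the slopes
    average out. *)
Lemma expR_jensen (R : realType) (I : finType) (w a : I -> R) :
  (forall i, 0 <= w i) -> \sum_i w i = 1 ->
  expR (\sum_i w i * a i) <= \sum_i w i * expR (a i).
Proof.
move=> w0 w1; set m := \sum_i w i * a i.
have h i : w i * (expR m * (1 + (a i - m))) <= w i * expR (a i).
  rewrite ler_wpM2l// -{2}(subrK m (a i)) expRD mulrC.
  by rewrite ler_wpM2r ?expR_ge0// expR_ge1Dx.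
apply: le_trans (ler_sum _ (fun i _ => h i)).
have -> : \sum_i w i * (expR m * (1 + (a i - m))) =
    expR m * (\sum_i w i * (1 - m) + \sum_i w i * a i).
  by rewrite -big_split/= mulr_sumr; apply: eq_bigr => i _; ring.
by rewrite -mulr_suml w1 -/m mul1r subrK mulr1.
Qed.

Section whp.
Context d (T : measurableType d) (R : realType) (P : probability T R).
Implicit Types (Q : T -> Prop).

(** A measurable exceptional set is exhibited instead of measuring [Q], since [Q] will quantify over
    all vectors and its own measurability is not established. *)
Definition whp Q (rho : R) : Prop :=
  exists B, [/\ measurable B, (P B <= rho%:E)%E & forall w, ~ B w -> Q w].

Lemma whp_and Q1 Q2 r1 r2 :
  whp Q1 r1 -> whp Q2 r2 -> whp (fun w => Q1 w /\ Q2 w) (r1 + r2).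
Proof.
move=> [B1 [m1 P1 h1]] [B2 [m2 P2 h2]]; exists (B1 `|` B2); split.
- exact: measurableU.
- by rewrite (le_trans (measureU2 P m1 m2))// EFinD leeD.
- by move=> w /not_orP[n1 n2]; split; [exact: h1|exact: h2].
Qed.

Lemma whp_imp Q1 Q2 r : (forall w, Q1 w -> Q2 w) -> whp Q1 r -> whp Q2 r.
Proof. by move=> h [B [mB PB hB]]; exists B; split=> // w /hB/h. Qed.

Lemma whp_le Q r s : r <= s -> whp Q r -> whp Q s.
Proof.
move=> rs [B [mB PB hB]]; exists B; split=> //.
by rewrite (le_trans PB)// lee_fin.
Qed.

Lemma whp_triv Q r : 0 <= r -> (forall w, Q w) -> whp Q r.
Proof. by move=> r0 h; exists set0; split=> //; rewrite measure0 lee_fin. Qed.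

Lemma whp_seq (I : eqType) (s : seq I) (Q : I -> T -> Prop) r :
  0 <= r -> (forall a, a \in s -> whp (Q a) r) ->
  whp (fun w => forall a, a \in s -> Q a w) ((size s)%:R * r).
Proof.
move=> r0; elim: s => [_|b s IH h].
  by apply: whp_triv; rewrite ?mul0r.
have hb : whp (Q b) r by apply: h; rewrite mem_head.
have hs : whp (fun w => forall a, a \in s -> Q a w) ((size s)%:R * r).
  by apply: IH => a as_; apply: h; rewrite in_cons as_ orbT.
apply: (whp_le _ (whp_imp _ (whp_and hb hs))).
  by rewrite /= -natr1 mulrDl mul1r addrC.
by move=> w [h1 h2] a; rewrite in_cons => /orP[/eqP ->|/h2].
Qed.

End whp.

Section good_event.
Context d0 (T : measurableType d0) (R : realType) (P : probability T R).
Context (n p d : nat) (lam : 'rV[R]_p) (x : 'I_n -> T -> p.-tuple R) (K : R).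
Hypotheses (n0 : (0 < n)%N) (d1 : (0 < d)%N) (dp : (d < p)%N).
Hypothesis lam0 : forall j, 0 < lam 0 j.
Hypothesis lamD : forall i j : 'I_p, (i <= j)%N -> lam 0 j <= lam 0 i.
Hypotheses (mx : forall i, measurable_fun setT (x i))
  (xi : mutually_independent P x).

Definition white_lin (v : 'cV[R]_p) (t : p.-tuple R) : R :=
  \sum_j v j 0 * (tnth t j / Num.sqrt (lam 0 j)).

Definition white_mx (w : T) : 'M[R]_(n, p) :=
  \matrix_(i, j) (tnth (x i w) j / Num.sqrt (lam 0 j)).

Hypothesis K1 : 1 <= K.
Hypothesis hmean : forall i v,
  has_mean P (fun w => white_lin v (x i w) ^+ 2) (nsq v).
Hypothesis hexp : forall i v, v != 0 ->
  bmean P (fun w => expR (white_lin v (x i w) ^+ 2 / nsq v / K)) 2.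

Let K0 : 0 < K. Proof. by rewrite (lt_le_trans _ K1). Qed.

Let mlin v : measurable_fun setT (white_lin v).
Proof.
apply: measurable_sum => j; apply: measurable_funM => //.
by apply: measurable_funM => //; exact: measurable_tnth.
Qed.

Lemma white_mxE w v i : (white_mx w *m v) i 0 = white_lin v (x i w).
Proof. by rewrite mxE; apply: eq_bigr => j _; rewrite mxE mulrC. Qed.

Lemma nsq_white w v : nsq (white_mx w *m v) = \sum_i white_lin v (x i w) ^+ 2.
Proof. by rewrite nsqE; apply: eq_bigr => i _; rewrite white_mxE. Qed.

Let rho : R := 2 * expR (- (n%:R * ((1 / 8) ^+ 2 / (128 * expR 1 * K ^+ 2)))).
Let rho0 : 0 <= rho. Proof. by rewrite mulr_ge0// expR_ge0. Qed.
Let nR : 0 < n%:R :> R. Proof. by rewrite ltr0n. Qed.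

Let whp_conc (W : p.-tuple R -> R) :
  measurable_fun setT W -> (forall z, 0 <= W z) ->
  (forall i, has_mean P (fun w => W (x i w)) 1) ->
  (forall i, bmean P (fun w => expR (W (x i w) / K)) 2) ->
  whp P (fun w => `|\sum_i W (x i w) - n%:R| <= n%:R * (1 / 8)) rho.
Proof.
move=> mW W0 W1 WK.
have eta : 0 < (1 / 8 : R) <= 1 by apply/andP; split; lra.
have [mB PB] := concentration mx xi mW W0 W1 K1 WK eta.
exists [set w | n%:R * (1 / 8) <= `|\sum_i W (x i w) - n%:R|]; split=> //.
by move=> w /negP; rewrite -ltNge => /ltW.
Qed.

Lemma whp_vec v : whp P (fun w =>
  `|nsq (white_mx w *m v) - n%:R * nsq v| <= n%:R * (1 / 8) * nsq v) rho.
Proof.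
have [->|v0] := eqVneq v 0.
  by apply: whp_triv => // w; rewrite mulmx0 !nsq0 !mulr0 subrr normr0.
have vp : 0 < nsq v.
  rewrite lt_def nsq_ge0 andbT; apply: contra_neq v0; exact: nsq_eq0.
apply: (whp_imp _ (@whp_conc (fun z => white_lin v z ^+ 2 / nsq v) _ _ _ _)).
- move=> w h; rewrite nsq_white.
  have -> : \sum_i white_lin v (x i w) ^+ 2 =
      (\sum_i white_lin v (x i w) ^+ 2 / nsq v) * nsq v.
    by rewrite -mulr_suml divfK// gt_eqF.
  by rewrite -mulrBl normrM (gtr0_norm vp) ler_wpM2r// ltW.
- by apply: measurable_funM => //; exact: measurable_funX.
- by move=> z; rewrite divr_ge0 ?sqr_ge0// ltW.
- move=> i; have := has_meanZ (nsq v)^-1 (hmean i v).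
  rewrite mulVf ?gt_eqF//; congr has_mean.
  by apply/funext => w; rewrite mulrC.
- by move=> i; exact: hexp.
Qed.

Definition head_set : {set 'I_p} := [set j : 'I_p | (j < d)%N]%SET.

Lemma card_head : (#|head_set| <= d)%N.
Proof.
have h : head_set \subset [set widen_ord (ltnW dp) i | i : 'I_d]%SET.
  apply/fintype.subsetP => j; rewrite inE => jd; apply/imsetP; exists (Ordinal jd) => //.
  exact: val_inj.
rewrite (leq_trans (subset_leq_card h))// (leq_trans (leq_imset_card _ _))//.
by rewrite card_ord.
Qed.

(** A union bound over the at most [96 ^ d] net points controls the quadratic form of the centred
    Gram matrix there, and [quad_net] extends the control to the whole coordinate subspace. *)
Lemma whp_head : whp P (fun w => forall v, supported head_set v ->
  `|nsq (white_mx w *m v) - n%:R * nsq v| <= n%:R / 2 * nsq v) ((96 ^ d)%:R * rho).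
Proof.
have [N [Ns NS Nnet]] := @grid_net R p _ _ d1 card_head.
have h := @whp_seq _ _ _ P _ N _ rho rho0 (fun a _ => whp_vec a).
apply: (whp_le _ (whp_imp _ h)).
  by rewrite ler_wpM2r// ler_nat.
move=> w {}h v vS.
pose Q := (white_mx w)^T *m white_mx w - n%:R%:M.
have Qt : Q^T = Q.
  by rewrite /Q linearB/= trmx_mul trmxK tr_scalar_mx.
have QE u : dotv u (Q *m u) = nsq (white_mx w *m u) - n%:R * nsq u.
  by rewrite mulmxBl mul_scalar_mx dotvDr dotvNr dotvZr -mulmxA dotv_mulr trmxK.
(* Net points have squared norm at most [25 / 16], so the deviation [n / 8] becomes [25 n / 128].
   The net factor [16 / 7] then gives [25 n / 56], below [n / 2]. *)
have := @quad_net R p head_set N Q (n%:R * (25 / 128)) Qt NS Nnet _ v vS.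
rewrite QE => /(_ _)/le_trans; apply.
  move=> a aN; rewrite QE (le_trans (h a aN))//.
  have [_ a1] := NS a aN.
  have nR' := ltW nR; have := ler_wpM2l nR' a1; lra.
have nR' := ltW nR.
have := mulr_ge0 nR' (nsq_ge0 v); lra.
Qed.

Definition tail_row : 'rV[R]_p := \row_j (if (d <= j)%N then Num.sqrt (lam 0 j) else 0).
Definition tail_diag : 'M[R]_p := diag_mx tail_row.
Definition tail_tr : R := \sum_(j < p | (d <= j)%N) lam 0 j.

Lemma tail_row_sqr j : tail_row 0 j ^+ 2 = if (d <= j)%N then lam 0 j else 0.
Proof. by rewrite mxE; case: ifP => _; rewrite ?expr0n// sqr_sqrtr// ltW. Qed.

Lemma tail_tr_gt0 : 0 < tail_tr.
Proof.
rewrite /tail_tr (bigD1 (Ordinal dp))//= ltr_pwDl// sumr_ge0// => j _.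
exact: ltW.
Qed.

(** Divided by [tail_tr], the squared norm of a tail row is a convex combination of squared whitened
    coordinates. Its mean is therefore 1, and Jensen's inequality bounds its exponential moment
    whatever the dependence between coordinates, so a single application of concentration
    suffices. *)
Lemma whp_tail_tr : whp P (fun w =>
  `|fro (white_mx w *m tail_diag) - n%:R * tail_tr| <= n%:R * (1 / 8) * tail_tr) rho.
Proof.
have t0 := tail_tr_gt0.
pose c (j : 'I_p) := (if (d <= j)%N then lam 0 j else 0) / tail_tr.
have c0 j : 0 <= c j.
  by apply: divr_ge0; [case: ifP => // _; exact: ltW|exact: ltW].
have c1 : \sum_j c j = 1.
  by rewrite -mulr_suml -big_mkcond/= divff// gt_eqF.
pose e (j : 'I_p) : 'cV[R]_p := delta_mx j 0.
have e1 j : nsq (e j) = 1.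
  rewrite nsqE (bigD1 j)//= mxE !eqxx expr1n big1 ?addr0// => i ij.
  by rewrite mxE (negbTE ij) expr0n.
have e0 j : e j != 0.
  by apply/eqP => ej; have := e1 j; rewrite ej nsq0 => /eqP; rewrite eq_sym oner_eq0.
pose W z := \sum_j c j * white_lin (e j) z ^+ 2.
have mW : measurable_fun setT W.
  by apply: measurable_sum => j; apply: measurable_funM => //; exact: measurable_funX.
apply: (whp_imp _ (whp_conc mW _ _ _)).
- move=> w h.
  have -> : fro (white_mx w *m tail_diag) = (\sum_i W (x i w)) * tail_tr.
    rewrite mulr_suml fro_sum; apply: eq_bigr => i _.
    rewrite mulr_suml; apply: eq_bigr => j _.
    rewrite mul_mx_diag [in LHS]mxE exprMn tail_row_sqr -white_mxE -colE.
    by rewrite [col _ _ _ _]mxE /c [RHS]mulrAC divfK ?gt_eqF// mulrC.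
  by rewrite -mulrBl normrM (gtr0_norm t0) ler_wpM2r// ltW.
- by move=> z; apply: sumr_ge0 => j _; rewrite mulr_ge0// sqr_ge0.
- move=> i; rewrite -c1; apply: has_mean_sum => j.
  by rewrite -[X in has_mean _ _ X]mulr1 -(e1 j); exact: has_meanZ.
- move=> i; apply: (@bmean_lef _ _ _ _ _ (fun w => \sum_j c j * expR (white_lin (e j) (x i w) ^+ 2 / nsq (e j) / K))).
  + suff : bmean P (fun w => \sum_j c j * expR (white_lin (e j) (x i w) ^+ 2 / nsq (e j) / K))
        (\sum_j c j * 2) by rewrite -mulr_suml c1 mul1r.
    apply: bmean_sum => j _.
    exact: (bmeanZ (c0 j) (hexp i (e0 j))).
  + apply: measurableT_comp => //; apply: measurable_funM => //.
    exact: measurableT_comp.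
  + move=> w; rewrite expR_ge0/=.
    rewrite (_ : W _ / K = \sum_j c j * (white_lin (e j) (x i w) ^+ 2 / nsq (e j) / K)).
      exact: expR_jensen.
    by rewrite mulr_suml; apply: eq_bigr => j _; rewrite e1 divr1 mulrA.
Qed.

(** The eigenvalues extended by 0 beyond the dimension; they stay nonincreasing, and blocks may
    start anywhere. *)
Let ell (k : nat) : R := oapp (lam 0) 0 (insub k : option 'I_p).

Let ellE (j : 'I_p) : ell j = lam 0 j.
Proof. by rewrite /ell valK. Qed.

Let ell0 k : 0 <= ell k.
Proof. by rewrite /ell; case: insubP => //= j _ _; exact: ltW. Qed.

Let ellD k l : (k <= l)%N -> ell l <= ell k.
Proof.
move=> kl; rewrite {1}/ell; case: insubP => [j _ jl|]/=; last by rewrite ell0.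
have kp : (k < p)%N by rewrite (leq_ltn_trans kl)// -jl ltn_ord.
by rewrite -[k]/(Ordinal kp : nat) ellE lamD//= jl.
Qed.

Let group (g : 'I_p) : {set 'I_p} :=
  [set j : 'I_p | (d <= j)%N && ((j - d) %/ n == g)%N]%SET.

Let card_group g : (#|group g| <= n)%N.
Proof.
pose f (j : 'I_p) : 'I_n := Ordinal (ltn_pmod (j - d) n0).
rewrite -[leqRHS]card_ord -(card_in_imset (f := f)); first exact: max_card.
move=> i j; rewrite !inE => /andP[di /eqP gi] /andP[dj /eqP gj] [] ij.
apply: val_inj => /=.
by rewrite -(subnK di) -(subnK dj) (divn_eq (i - d) n) (divn_eq (j - d) n) gi gj ij.
Qed.

Let glam (g : 'I_p) : R := ell (d + g * n).

Let glam_ge g j : j \in group g -> lam 0 j <= glam g.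
Proof.
rewrite inE => /andP[dj /eqP gj]; rewrite -ellE; apply: ellD.
by rewrite -gj -leq_subRL// leq_trunc_div.
Qed.

Let glam0 g : 0 <= glam g. Proof. exact: ell0. Qed.

Let Wl : R := \sum_g glam g.

(** The eigenvalue that opens a block is at most each of the [n] eigenvalues of the preceding block.
    The first block has no predecessor, and its opening eigenvalue remains as the separate term
    [ell d]. *)
Let sum_ell M : n%:R * \sum_(0 <= g < M.+1) ell (d + g * n) <=
  n%:R * ell d + \sum_(0 <= k < M * n) ell (d + k).
Proof.
elim: M => [|M IH]; first by rewrite big_nat1 mul0n big_geq// !addn0 addr0.
rewrite big_nat_recr//= mulrDr.
have -> : \sum_(0 <= k < M.+1 * n) ell (d + k) =
    \sum_(0 <= k < M * n) ell (d + k) + \sum_(M * n <= k < M.+1 * n) ell (d + k).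
  by rewrite -big_cat_nat// leq_mul2r leqnSn orbT.
rewrite addrA lerD//.
have -> : n%:R * ell (d + M.+1 * n) = \sum_(M * n <= k < M.+1 * n) ell (d + M.+1 * n).
  by rewrite sumr_const_nat mulSn addnK mulr_natl.
rewrite big_nat_cond [leRHS]big_nat_cond; apply: ler_sum => k /andP[/andP[_ kM] _].
by apply: ellD; rewrite leq_add2l ltnW.
Qed.

Lemma Wl_le : Wl <= lam 0 (Ordinal dp) + tail_tr / n%:R.
Proof.
rewrite -(ler_pM2l nR) mulrDr mulrCA divff ?gt_eqF// mulr1.
apply: (@le_trans _ _ (n%:R * \sum_(0 <= g < p.+1) ell (d + g * n))).
  rewrite ler_pM2l// big_nat_recr//= big_mkord lerDl ell0//.
apply: (le_trans (sum_ell p)); rewrite -(ellE (Ordinal dp))/= lerD2l.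
have ellp k : (p <= k)%N -> ell k = 0.
  by move=> pk; rewrite /ell insubF//; apply/negbTE; rewrite -leqNgt.
have -> : tail_tr = \sum_(d <= k < p) ell k.
  rewrite big_geq_mkord; apply: eq_bigr => j _.
  by rewrite ellE.
rewrite (_ : \sum_(0 <= k < _) _ = \sum_(d <= k < d + p * n) ell k); last first.
  by rewrite -{2}[d]add0n big_addn addKn; apply: eq_bigr => k _; rewrite addnC.
have pn : (p <= d + p * n)%N by rewrite (leq_trans _ (leq_addl _ _))// leq_pmulr.
have -> : \sum_(d <= k < d + p * n) ell k =
    \sum_(d <= k < p) ell k + \sum_(p <= k < d + p * n) ell k.
  by rewrite -big_cat_nat// ltnW.
rewrite [X in _ + X]big_nat_cond [X in _ + X]big1 ?addr0// => k /andP[/andP[pk _] _].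
exact: ellp.
Qed.

(* A single net of the tail coordinates would be too large, as [p] is
   unrestricted. These coordinates are cut into consecutive blocks of length
   [n], and the largest eigenvalue [glam g] of block [g] bounds the others. On
   each block the norm is controlled by the logarithm of an exponential sum
   over a net of [R^n]; Jensen's inequality with weights [glam g / Wl] combines
   the blocks without a union bound. *)
Lemma whp_tail_op : whp P (fun w => forall u : 'cV[R]_n,
  nsq ((white_mx w *m tail_diag)^T *m u) <=
  n%:R * (4 * ln 384 * K) * (lam 0 (Ordinal dp) + tail_tr / n%:R) * nsq u)
  ((1 / 2) ^+ n).
Proof.
have ldp := lam0 (Ordinal dp).
have Wl0 : 0 < Wl.
  have p0 : (0 < p)%N by rewrite (leq_trans _ dp).
  rewrite /Wl (bigD1 (Ordinal p0))//= ltr_pwDl ?sumr_ge0//.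
  by rewrite /glam/= mul0n addn0 -[d in ell d]/(Ordinal dp : nat) ellE.
(* Net points have squared norm at most [25 / 16], so [s nsq a <= 1 / K] and the exponential moment
   with parameter [K] is available. *)
pose s : R := 16 / (25 * K).
have s0 : 0 < s by rewrite divr_gt0// mulr_gt0.
have netP : forall g : 'I_p, exists N : seq 'cV[R]_p,
  [/\ (size N <= 96 ^ n)%N,
      forall a, a \in N -> supported (group g) a /\ nsq a <= (5 / 4) ^+ 2 &
      forall v, supported (group g) v -> nsq v <= 1 ->
        exists2 a, a \in N & nsq (v - a) <= (1 / 4) ^+ 2].
  by move=> g; exact: grid_net.
have [N NP] := choice netP.
pose F (a : 'cV[R]_p) w := \prod_i expR (s * white_lin a (x i w) ^+ 2).
have FE a w : F a w = expR (s * nsq (white_mx w *m a)).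
  by rewrite /F -expR_sum nsq_white mulr_sumr.
have bF g a : a \in N g -> bmean P (F a) (2 ^+ n).
  move=> aN; have [_ NS _] := NP g; have [_ a1] := NS a aN.
  apply: (bmean_prod mx xi (f := fun z => expR (s * white_lin a z ^+ 2))) => //.
    apply: measurableT_comp => //; apply: measurable_funM => //.
    exact: measurable_funX.
  move=> i; have [a0|a0] := eqVneq a 0.
    rewrite a0 (_ : (fun w => _) = fun=> 1); last first.
      apply/funext => w; rewrite /white_lin big1 ?expr0n ?mulr0 ?expR0// => j _.
      by rewrite mxE mul0r.
    split => //; rewrite integral_cst//= probability_setT mule1 lee_fin.
    by rewrite ler1n.
  have ap : 0 < nsq a.
    rewrite lt_def nsq_ge0 andbT; apply: contra_neq a0; exact: nsq_eq0.
  apply: (bmean_lef (hexp i a0)).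
    apply: measurableT_comp => //; apply: measurable_funM => //.
    by apply: measurable_funX; exact: measurableT_comp.
  move=> w; rewrite expR_ge0 ler_expR mulrC -mulrA ler_wpM2l ?sqr_ge0//.
  rewrite -invfM -[leRHS]mul1r ler_pdivlMr ?mulr_gt0//.
  have -> : s * (nsq a * K) = 16 / 25 * nsq a by rewrite /s; field; rewrite gt_eqF.
  lra.
pose Phi g w := \sum_(a <- N g) F a w.
have bPhi g : bmean P (Phi g) (192 ^+ n).
  apply: (@bmean_le _ _ _ _ _ ((size (N g))%:R * 2 ^+ n)).
    rewrite mulr_natl -sum1_size -mulr_natl natr_sum mulr_suml.
    by under eq_bigr do rewrite mul1r; apply: bmean_sum => a; exact: bF.
  have [Ns _ _] := NP g.
  rewrite (_ : 192 = 96 * 2); last by rewrite -natrM.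
  by rewrite exprMn ler_wpM2r ?exprn_ge0// -natrX ler_nat.
have bPsi : bmean P (fun w => \sum_g glam g / Wl * Phi g w) (192 ^+ n).
  have -> : 192 ^+ n = \sum_g glam g / Wl * 192 ^+ n :> R.
    by rewrite -!mulr_suml divff ?mul1r// gt_eqF.
  apply: bmean_sum => g _; apply: bmeanZ => //.
  by rewrite divr_ge0// ltW.
(* The mean is at most [192 ^ n]: [96 ^ n] net points, each contributing at most [2 ^ n]. Doubling
   the base makes Markov's inequality yield [(1 / 2) ^ n]. *)
have e384 : 0 < 384 ^+ n :> R by rewrite exprn_gt0.
have [PB mB] := bmean_markov e384 bPsi.
exists [set w | 384 ^+ n <= \sum_g glam g / Wl * Phi g w]; split => //.
  rewrite (le_trans PB)// lee_fin -expr_div_n.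
  by rewrite (_ : 192 / 384 = 1 / 2)//; lra.
move=> w /negP; rewrite -ltNge => PsiW u.
have Phi0 g : 0 < Phi g w.
  have [_ _ Nnet] := NP g.
  have [||a aN _] := Nnet 0; first by move=> j _; rewrite mxE.
    by rewrite nsq0.
  rewrite /Phi (big_rem a)//= ltr_pwDl//.
    by rewrite FE expR_gt0.
  by apply: sumr_ge0 => b _; rewrite FE expR_ge0.
pose c g := 16 / 7 * (ln (Phi g w) / s).
have NF g a : a \in N g -> s * nsq (white_mx w *m a) <= ln (Phi g w).
  move=> aN; rewrite -ler_expR lnK ?posrE// -FE /Phi (big_rem a)//= lerDl.
  by apply: sumr_ge0 => b _; rewrite FE expR_ge0.
have opg g v : supported (group g) v -> nsq (white_mx w *m v) <= c g * nsq v.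
  move=> vS; have [_ NS Nnet] := NP g.
  pose Q := (white_mx w)^T *m white_mx w.
  have Qt : Q^T = Q by rewrite /Q trmx_mul trmxK.
  have QE z : dotv z (Q *m z) = nsq (white_mx w *m z).
    by rewrite -mulmxA dotv_mulr trmxK.
  have := @quad_net R p (group g) (N g) Q (ln (Phi g w) / s) Qt NS Nnet _ v vS.
  rewrite QE ger0_norm ?nsq_ge0//; apply => a aN.
  by rewrite QE ger0_norm ?nsq_ge0// ler_pdivlMr// mulrC NF.
have c0 g : 0 <= c g.
  have [_ _ Nnet] := NP g.
  have [||a aN _] := Nnet 0; first by move=> j _; rewrite mxE.
    by rewrite nsq0.
  have := NF g a aN; have := nsq_ge0 (white_mx w *m a) => h1 h2.
  by rewrite /c mulr_ge0// divr_ge0 ?(ltW s0)// (le_trans _ h2)// mulr_ge0// ltW.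
have opT g (y : 'cV[R]_p) : y = (white_mx w)^T *m u ->
    \sum_(j in group g) y j 0 ^+ 2 <= c g * nsq u.
  move=> yE.
  pose D : 'M[R]_p := diag_mx (\row_j (j \in group g)%:R).
  have Dt : D^T = D by rewrite tr_diag_mx.
  have h := @op_tr _ _ _ (white_mx w *m D) (c g) (c0 g) _ u.
  have {h} := h _; rewrite trmx_mul Dt -mulmxA -yE => h.
  apply: le_trans (h _); last first.
    move=> v; rewrite -mulmxA (le_trans (opg g _ _))//.
      by move=> j jS; rewrite mul_diag_mx !mxE (negbTE jS) mul0r.
    rewrite ler_wpM2l// !nsqE ler_sum// => j _; rewrite mul_diag_mx !mxE.
    by case: (j \in _); rewrite ?mul1r// mul0r expr0n sqr_ge0.
  rewrite nsqE big_mkcond ler_sum// => j _; rewrite mul_diag_mx !mxE.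
  by case: (j \in _); rewrite ?mul1r// mul0r expr0n.
pose y := (white_mx w)^T *m u.
have -> : nsq ((white_mx w *m tail_diag)^T *m u) =
    \sum_(j : 'I_p | (d <= j)%N) lam 0 j * y j 0 ^+ 2.
  rewrite trmx_mul tr_diag_mx -mulmxA -/y nsqE [RHS]big_mkcond.
  apply: eq_bigr => j _; rewrite mul_diag_mx mxE exprMn tail_row_sqr.
  by case: ifP; rewrite ?mul0r.
have pg (j : 'I_p) : ((j - d) %/ n < p)%N.
  by rewrite (leq_ltn_trans (leq_div _ _))// (leq_ltn_trans (leq_subr _ _)).
rewrite (partition_big (fun j : 'I_p => Ordinal (pg j)) xpredT)//=.
apply: (@le_trans _ _ (\sum_g glam g * (c g * nsq u))).
  apply: ler_sum => g _; apply: le_trans (ler_wpM2l (glam0 g) (opT g y erefl)).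
  rewrite mulr_sumr (eq_bigl (mem (group g))); last by move=> j; rewrite !inE -val_eqE.
  by apply: ler_sum => j jg; rewrite ler_wpM2r ?sqr_ge0// glam_ge.
rewrite (eq_bigr (fun g => (glam g * c g) * nsq u)); last by move=> g _; rewrite mulrA.
rewrite -mulr_suml ler_wpM2r ?nsq_ge0//.
have jen : \sum_g glam g / Wl * ln (Phi g w) <= n%:R * ln 384.
  rewrite -ler_expR expRM_natl lnK ?posrE//.
  apply: le_trans (ltW PsiW).
  have lnE g : Phi g w = expR (ln (Phi g w)) by rewrite lnK// posrE.
  have <- : \sum_g glam g / Wl * expR (ln (Phi g w)) = \sum_g glam g / Wl * Phi g w.
    by apply: eq_bigr => g _; rewrite -lnE.
  apply: expR_jensen; first by move=> g; rewrite divr_ge0// ltW.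
  by rewrite -mulr_suml divff// gt_eqF.
(* The constant is [16 / 7] from the net times [25 / 16] from [1 / s]; the statement rounds [25 / 7]
   up to 4. *)
have -> : \sum_g glam g * c g = 25 / 7 * K * Wl * (\sum_g glam g / Wl * ln (Phi g w)).
  rewrite mulr_sumr; apply: eq_bigr => g _; rewrite /c /s; field.
  by rewrite !gt_eqF.
have ln0 : 0 <= ln 384 :> R by rewrite ln_ge0// ler1n.
have KW : 0 <= 25 / 7 * K * Wl by rewrite !mulr_ge0// ltW.
rewrite (le_trans (ler_wpM2l KW jen))//.
have h1 : 0 <= K * (n%:R * ln 384) by rewrite !mulr_ge0// ltW.
have h2 := ler_wpM2l h1 Wl_le.
have h3 := mulr_ge0 h1 (ltW Wl0).
lra.
Qed.

Definition good (Lk : R) (w : T) : Prop :=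
  [/\ forall v, supported head_set v ->
        `|nsq (white_mx w *m v) - n%:R * nsq v| <= n%:R / 2 * nsq v,
      `|fro (white_mx w *m tail_diag) - n%:R * tail_tr| <= n%:R / 2 * tail_tr &
      forall u : 'cV[R]_n, nsq ((white_mx w *m tail_diag)^T *m u) <=
        n%:R * Lk * (lam 0 (Ordinal dp) + tail_tr / n%:R) * nsq u].

Lemma whp_good (v : 'cV[R]_p) : whp P (fun w => good (4 * ln 384 * K) w /\
    nsq (white_mx w *m v) <= 2 * n%:R * nsq v)
  ((96 ^ d)%:R * rho + (rho + ((1 / 2) ^+ n + rho))).
Proof.
apply: (whp_imp _ (whp_and whp_head (whp_and whp_tail_tr (whp_and whp_tail_op (whp_vec v))))).
have nR' := ltW nR.
move=> w [h1 [h2 [h3]]]; rewrite ler_norml => /andP[_ h4]; split; first split=> //.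
  by rewrite (le_trans h2)// ler_wpM2r ?(ltW tail_tr_gt0)// ler_wpM2l//; lra.
by have := mulr_ge0 nR' (nsq_ge0 v); lra.
Qed.

End good_event.

(** * Moments of the model *)

Section model_moments.
Context (R : realType) (sigma_x : R) (n : nat) (m : ridge_model sigma_x n).
Let P := Prob m.
Let p := pdim m.

Lemma measurable_xvar i : measurable_fun setT (xvar m i).
Proof. exact: measurable_funPT. Qed.

Lemma measurable_coord i (j : 'I_p) : measurable_fun setT (fun w => tnth (xvar m i w) j).
Proof. exact: (measurableT_comp (measurable_tnth j) (measurable_xvar i)). Qed.

Lemma x_has_mean i j : has_mean P (fun w => tnth (xvar m i w) j) 0.
Proof. by apply: expectation_has_mean; [exact: measurable_coord|exact: x_mean]. Qed.

Lemma xx_has_mean i j k :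
  has_mean P (fun w => tnth (xvar m i w) j * tnth (xvar m i w) k)
    (if j == k then lam m 0 j else 0).
Proof.
apply: covariance_has_mean; [exact: x_has_mean|exact: x_has_mean|].
by rewrite x_cov /Sigma mxE; case: eqP.
Qed.

Lemma white_has_mean i v :
  has_mean P (fun w => white_lin (lam m) v (xvar m i w) ^+ 2) (nsq v).
Proof.
pose c j := v j 0 / Num.sqrt (lam m 0 j).
have -> : (fun w => white_lin (lam m) v (xvar m i w) ^+ 2) = (fun w =>
    \sum_j \sum_k (c j * c k) * (tnth (xvar m i w) j * tnth (xvar m i w) k)).
  apply/funext => w; rewrite expr2 /white_lin mulr_suml; apply: eq_bigr => j _.
  by rewrite mulr_sumr; apply: eq_bigr => k _; rewrite /c; ring.
have -> : nsq v = \sum_j \sum_k (c j * c k) * (if j == k then lam m 0 j else 0).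
  rewrite nsqE; apply: eq_bigr => j _; rewrite (bigD1 j)//= eqxx big1 ?addr0.
    have l0 := lam_gt0 j.
    rewrite /c -[X in _ = _ * X](sqr_sqrtr (ltW l0)); field.
    by rewrite gt_eqF// sqrtr_gt0.
  by move=> k kj; rewrite eq_sym (negbTE kj) mulr0.
by do 2 apply: has_mean_sum => ?; apply: has_meanZ; exact: xx_has_mean.
Qed.

Let zE i (v : 'cV[R]_p) w :
  (v^T *m (diag_mx (\row_j (Num.sqrt (lam m 0 j))^-1) *m xcol i w)) 0 0 =
  white_lin (lam m) v (xvar m i w).
Proof.
rewrite mxE; apply: eq_bigr => j _; rewrite mul_diag_mx !mxE.
by congr (_ * _); rewrite mulrC.
Qed.

(** The infimum in the norm is not shown to be attained, so the exponential bound is stated for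
    every [t] above [sigma_x], where some smaller admissible value exists. *)
Let psi_exp i (v : 'cV[R]_p) t : v != 0 -> sigma_x < t ->
  bmean P (fun w => expR (white_lin (lam m) v (xvar m i w) ^+ 2 / nsq v / t ^+ 2)) 2
  /\ 0 < t.
Proof.
move=> v0 st.
have := x_subgauss m i; rewrite /psi2_norm_vec => h.
pose z w := (v^T *m (diag_mx (\row_j (Num.sqrt (lam m 0 j))^-1) *m xcol i w)) 0 0 / wnorm 1%:M v.
have hz : (psi2_norm P z <= sigma_x%:E)%E.
  by rewrite -h; apply: ereal_sup_ubound; exists v.
have : (psi2_norm P z < t%:E)%E by rewrite (le_lt_trans hz)// lte_fin.
move=> /ereal_inf_lt[_ [t' [t'0 Et'] <-]]; rewrite lte_fin => t't.
have t0 : 0 < t by rewrite (lt_trans t'0).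
split => //.
have zz w : z w ^+ 2 = white_lin (lam m) v (xvar m i w) ^+ 2 / nsq v.
  rewrite /z zE expr_div_n; congr (_ / _).
  by rewrite /wnorm mulmx1 -/(dotv v v) sqr_sqrtr// nsq_ge0.
have mw : measurable_fun setT (fun w => white_lin (lam m) v (xvar m i w) ^+ 2).
  exact: has_mean_measurable (white_has_mean i v).
have me s : measurable_fun setT (fun w => expR (white_lin (lam m) v (xvar m i w) ^+ 2 / nsq v / s)).
  by apply: measurableT_comp => //; do 2 apply: measurable_funM => //.
apply: (@bmean_lef _ _ _ _ _ (fun w => expR (z w ^+ 2 / t' ^+ 2))) => //.
  split.
  - by under eq_fun do rewrite zz; exact: me.
  - by move=> w; exact: expR_ge0.
  - by move: Et'; rewrite unlock.
move=> w; rewrite expR_ge0 ler_expR zz.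
rewrite ler_wpM2l//; first by rewrite divr_ge0 ?sqr_ge0 ?nsq_ge0.
by rewrite lef_pV2 ?posrE ?exprn_gt0// lerXn2r ?nnegrE ?(ltW t0) ?(ltW t'0) ?(ltW t't).
Qed.

(* A normalized coordinate [z] has [E z^2 = 1], while
   [1 + E z^2 / t^2 <= E exp (z^2 / t^2) <= 2] for [t > sigma_x]. *)
Lemma sigma_x_ge1 : (0 < n)%N -> 1 <= sigma_x.
Proof.
move=> n0; pose i : 'I_n := Ordinal n0.
pose j : 'I_p := Ordinal (ddim_lt m).
pose v : 'cV[R]_p := delta_mx j 0.
have v1 : nsq v = 1.
  rewrite nsqE (bigD1 j)//= mxE !eqxx expr1n big1 ?addr0// => k kj.
  by rewrite mxE (negbTE kj) expr0n.
have v0 : v != 0.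
  by apply/eqP => ej; have := v1; rewrite ej nsq0 => /eqP; rewrite eq_sym oner_eq0.
rewrite leNgt; apply/negP => s1; pose t := (sigma_x + 1) / 2.
have st : sigma_x < t by rewrite /t; lra.
have tl : t < 1 by rewrite /t; lra.
have [bt t0] := psi_exp i v0 st.
have [r hr r2] := bmean_has_mean bt.
have hm := has_meanD (has_mean_cst P 1) (has_meanZ (t ^+ 2)^-1 (white_has_mean i v)).
have : 1 + (t ^+ 2)^-1 * nsq v <= r.
  rewrite -lee_fin -hr.2 -hm.2; apply: ge0_le_integral => //.
  - move=> w _; rewrite lee_fin addr_ge0// mulr_ge0 ?sqr_ge0// invr_ge0 sqr_ge0//.
  - by apply/measurable_EFinP; exact: has_mean_measurable hm.
  - by apply/measurable_EFinP; exact: has_mean_measurable hr.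
  - by move=> w _; rewrite lee_fin v1 divr1 mulrC expR_ge1Dx.
rewrite v1 mulr1 => h.
have : (t ^+ 2)^-1 <= 1 by lra.
rewrite invf_le1 ?exprn_gt0// => t1.
by nra.
Qed.

(** Since [sigma_x] is positive, [2 sigma_x] exceeds it strictly; its square is the parameter
    [K = 4 sigma_x ^ 2] used from here on. *)
Lemma white_exp i v : v != 0 ->
  bmean P (fun w => expR (white_lin (lam m) v (xvar m i w) ^+ 2 / nsq v / (4 * sigma_x ^+ 2))) 2.
Proof.
move=> v0; have n0 : (0 < n)%N by rewrite (leq_ltn_trans _ (ltn_ord i)).
have s1 := sigma_x_ge1 n0.
have st : sigma_x < 2 * sigma_x by lra.
have [h _] := psi_exp i v0 st.
by rewrite (_ : 4 * _ = (2 * sigma_x) ^+ 2)//; ring.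
Qed.

Lemma K_ge1 : (0 < n)%N -> 1 <= 4 * sigma_x ^+ 2.
Proof. by move=> /sigma_x_ge1 h; nra. Qed.

Lemma xvar_indep : mutually_independent P (fun i => xvar m i).
Proof.
have := mutually_independent_comp (h := snd) measurable_snd (@data_indep _ _ _ m).
exact.
Qed.

Lemma eps_has_mean i : has_mean P (eps m i) 0.
Proof. by apply: expectation_has_mean; [exact: measurable_funPT|exact: eps_mean]. Qed.

Let g (t : p.-tuple R) : R := \sum_j tnth t j * theta m j 0.

Let mg : measurable_fun setT g.
Proof. by apply: measurable_sum => j; apply: measurable_funM => //; exact: measurable_tnth. Qed.

Let data_indep' : mutually_independent P
  (fun i w => (g (xvar m i w) + eps m i w, xvar m i w : p.-tuple R) : (R * p.-tuple R)%type).
Proof.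
have := @data_indep _ _ _ m.
rewrite (_ : (fun i w => (yvar i w, _)) = (fun i w =>
  (g (xvar m i w) + eps m i w, xvar m i w : p.-tuple R) : (R * p.-tuple R)%type))//.
apply/funext => i; apply/funext => w; congr ((_ + _), _).
by rewrite mxE; apply: eq_bigr => j _; rewrite !mxE.
Qed.

Lemma eps_xvar_indep : independent_pair P (fun w => [tuple eps m i w | i < n])
  (fun w => [tuple (xvar m i w : p.-tuple R) | i < n]).
Proof.
apply: (@noise_design_indep _ _ _ P _ _ n (fun i => eps m i) (fun i => xvar m i) g) => //.
exact: x_eps_indep.
Qed.

Lemma ee_has_mean i j :
  has_mean P (fun w => eps m i w * eps m j w) (if i == j then sigma2 m else 0).
Proof.
have [<-|ij] := eqVneq i j.
  apply: covariance_has_mean; [exact: eps_has_mean|exact: eps_has_mean|].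
  exact: eps_var.
apply: has_mean_indepM; [exact: eps_has_mean|exact: eps_has_mean|].
apply: (@noise_pairwise_indep _ _ _ P _ _ n (fun i => eps m i) (fun i => xvar m i) g) => //.
exact: x_eps_indep.
Qed.

End model_moments.

(** * The limit at zero penalty *)

Section ridge_limit.
Context (R : realType) (n p : nat) (X : 'M[R]_(n, p)).
Let G := X *m X^T.

(* For a Gram matrix [ker (G ^ 2) = ker G = ker X^T]. *)
Lemma tr_factor_gram2 : exists C : 'M[R]_(p, n), X^T = C *m (G *m G).
Proof.
apply/submxP; rewrite submxE; apply/eqP.
set N := cokermx (G *m G).
have GGN : G *m (G *m N) = 0 by rewrite mulmxA mulmx_coker.
have Gt : G^T = G by rewrite /G trmx_mul trmxK.
have sq0 k l (A : 'M[R]_(k, l)) : A^T *m A = 0 -> A = 0.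
  move=> AA; apply/matrixP => i j; rewrite mxE.
  have : nsq (col j A) = 0.
    by rewrite colE /nsq dotv_mull mulmxA AA mul0mx /dotv mulmx0 mxE.
  by move/nsq_eq0/matrixP/(_ i 0); rewrite !mxE.
have GN : G *m N = 0.
  by apply: sq0; rewrite trmx_mul Gt -mulmxA GGN mulmx0.
by apply: sq0; rewrite trmx_mul trmxK -mulmxA [X *m _]mulmxA -/G GN mulmx0.
Qed.

(** Writing [X^T = C G ^ 2] gives [X^T (G + s)^-1 = C G - s C (hat X s)]. The hat matrix is a
    contraction, so its entries are at most 1 and the convergence to [C G] is linear in [s]. *)
Lemma ridge_kernel_limit : exists (M : 'M[R]_(p, n)), exists2 c : R, 0 <= c &
  forall s, 0 < s -> forall i j,
    `|(X^T *m invmx (G + s%:M)) i j - M i j| <= s * c.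
Proof.
have [C CE] := tr_factor_gram2.
exists (C *m G); exists (\sum_i \sum_j (`|C i j| * 2) * n.+1%:R).
  by do 2 apply: sumr_ge0 => ? _; rewrite !mulr_ge0.
move=> s s0 i j; set K := G + s%:M.
have Ku : K \in unitmx by exact: gram_shift_unit.
have -> : X^T *m invmx K = C *m G - s *: (C *m hat X s).
  have e : C *m G = C *m (G *m G) *m invmx K + s *: (C *m G *m invmx K).
    rewrite -{1}[C *m G](mulmxK Ku) {1}/K mulmxDr mul_mx_scalar mulmxDl.
    by rewrite -scalemxAl mulmxA.
  by rewrite CE /hat -/G -/K e [C *m (G *m invmx K)]mulmxA addrK.
rewrite mxE [X in `|X - _|]addrC addrK mxE normrN [X in `|X|]mxE normrM gtr0_norm// ler_pM2l//.
rewrite mxE (le_trans (ler_norm_sum _ _ _))//.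
have hb k l : `|hat X s k l| <= 1.
  rewrite -(@ler_pXn2r _ 2)// ?nnegrE// expr1n real_normK ?num_real//.
  have h := nsq_hat X s0 (delta_mx l 0).
  have e1 : nsq (delta_mx l 0 : 'cV[R]_n) = 1.
    rewrite nsqE (bigD1 l)//= mxE !eqxx expr1n big1 ?addr0// => b bl.
    by rewrite mxE (negbTE bl) expr0n.
  rewrite -e1 (le_trans _ h)// -colE nsqE (bigD1 k)//= [(col l _) k 0]mxE lerDl sumr_ge0// => b _.
  exact: sqr_ge0.
rewrite (bigD1 i)//= -[leLHS]addr0 lerD//; last first.
  by do 2 apply: sumr_ge0 => ? _; rewrite !mulr_ge0.
apply: ler_sum => k _; rewrite normrM -mulrA ler_wpM2l// (le_trans (hb _ _))//.
by rewrite -natrM ler1n muln_gt0.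
Qed.

(** The first limit is the one that defines the estimator at zero penalty. The second runs along a
    sequence, because measurability passes to pointwise limits of sequences. *)
Lemma ridge_pos_cvg : (0 < n)%N -> exists M : 'M[R]_(p, n),
  (forall Y, ridge_pos X Y t @[t --> 0^'+] --> M *m Y) /\
  (forall i j, hat X k.+1%:R^-1 i j @[k --> \oo] --> (X *m M) i j).
Proof.
move=> n0; have [M [c c0 hM]] := ridge_kernel_limit; exists M.
have nR : 0 < n%:R :> R by rewrite ltr0n.
split.
  move=> Y; pose c' := n%:R * c * (\sum_j `|Y j 0|) + 1.
  have c'0 : 0 < c' by rewrite ltr_wpDl// !mulr_ge0// ?sumr_ge0// ltW.
  apply/cvgrPdist_le => e e0; near=> t.
  have t0 : 0 < t by near: t; exact: nbhs_right_gt.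
  have te : t < e / c' by near: t; apply: nbhs_right_lt; rewrite divr_gt0.
  rewrite distrC /ridge_pos.
  have -> : X^T *m invmx (X *m X^T + (n%:R * t)%:M) *m Y - M *m Y =
     (X^T *m invmx (X *m X^T + (n%:R * t)%:M) - M) *m Y by rewrite mulmxBl.
  have nt0 : 0 < n%:R * t by rewrite mulr_gt0.
  rewrite /Num.Def.normr/= mx_normrE; apply: bigmax_le; first exact: ltW.
  move=> [i j] _ /=; rewrite ord1.
  rewrite mxE (le_trans (ler_norm_sum _ _ _))//.
  apply: (@le_trans _ _ (\sum_j (n%:R * t * c) * `|Y j 0|)).
    apply: ler_sum => k _; rewrite normrM ler_wpM2r//.
    by have := hM _ nt0 i k; rewrite !mxE.
  rewrite -mulr_sumr.
  have : t * c' <= e by rewrite -ler_pdivlMr// ltW.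
  rewrite /c'; lra.
move=> i j; apply/cvgrPdist_le => e e0.
pose b := c * (\sum_k `|X i k|) + 1.
have b0 : 0 < b by rewrite ltr_wpDl// mulr_ge0// sumr_ge0.
near=> k.
have s0 : 0 < k.+1%:R^-1 :> R by rewrite invr_gt0.
have sb : k.+1%:R^-1 <= e / b.
  near: k; have := @cvg_harmonic R; move/cvgrPdist_le => /(_ (e / b)).
  move=> /(_ (divr_gt0 e0 b0)); apply: filterS => k.
  by rewrite sub0r normrN ger0_norm// invr_ge0.
rewrite distrC /hat -mulmxA.
have -> : (X *m (X^T *m invmx (X *m X^T + k.+1%:R^-1%:M))) i j - (X *m M) i j =
    (X *m (X^T *m invmx (X *m X^T + k.+1%:R^-1%:M) - M)) i j.
  by rewrite mulmxBr !mxE.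
rewrite mxE (le_trans (ler_norm_sum _ _ _))//.
apply: (@le_trans _ _ (\sum_l `|X i l| * (k.+1%:R^-1 * c))).
  apply: ler_sum => l _; rewrite normrM ler_wpM2l//.
  by have := hM _ s0 l j; rewrite !mxE.
rewrite -mulr_suml.
have : k.+1%:R^-1 * b <= e by rewrite -ler_pdivlMr.
have : 0 <= k.+1%:R^-1 :> R by rewrite ltW.
rewrite /b; move: (k.+1%:R^-1) (\sum_k `|X i k|) => h S h0 hS.
by rewrite mulrCA mulrC; lra.
Unshelve. all: by end_near. Qed.

End ridge_limit.

(** * Measurability of matrix operations *)

Section measurable_matrix.
Context d (T : measurableType d) (R : realType).

Lemma measurable_det n (M : T -> 'M[R]_n) :
  (forall i j, measurable_fun setT (fun t => M t i j)) ->
  measurable_fun setT (fun t => \det (M t)).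
Proof.
move=> mM; apply: measurable_sum => s; apply: measurable_funM => //.
by apply: measurable_prod => i _; exact: mM.
Qed.

Lemma measurable_mulmx m n k (A : T -> 'M[R]_(m, n)) (B : T -> 'M[R]_(n, k)) :
  (forall i j, measurable_fun setT (fun t => A t i j)) ->
  (forall i j, measurable_fun setT (fun t => B t i j)) ->
  forall i j, measurable_fun setT (fun t => (A t *m B t) i j).
Proof.
move=> mA mB i j.
apply: (eq_measurable_fun (fun t => \sum_k A t i k * B t k j)).
  by move=> t _; rewrite mxE.
by apply: measurable_sum => l; apply: measurable_funM.
Qed.

(* Inversion is not covered by the library's measurability lemmas; for nonzero
   [x] it equals [x * exp (- ln (x ^ 2))]. *)
Lemma measurable_invmx n (M : T -> 'M[R]_n) :
  (forall i j, measurable_fun setT (fun t => M t i j)) ->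
  (forall t, M t \in unitmx) ->
  forall i j, measurable_fun setT (fun t => invmx (M t) i j).
Proof.
move=> mM uM i j.
apply: (eq_measurable_fun (fun t =>
    \det (M t) * expR (- ln (\det (M t) ^+ 2)) * cofactor (M t) j i)).
  move=> t _; rewrite /invmx uM !mxE; congr (_ * _).
  have d0 : \det (M t) != 0 by have := uM t; rewrite unitmxE unitfE.
  rewrite expRN lnK ?posrE ?exprn_even_gt0//.
  by rewrite expr2 invfM mulrA divff// mul1r.
have mdet := measurable_det mM.
apply: measurable_funM.
  apply: measurable_funM => //; apply: measurableT_comp => //.
  apply: measurableT_comp => //; apply: measurableT_comp; first exact: measurable_ln.
  exact: measurable_funX.
apply: measurable_funM => //; apply: measurable_det => k l.
apply: (eq_measurable_fun (fun t => M t (lift j k) (lift i l))).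
  by move=> t _; rewrite !mxE.
exact: mM.
Qed.

Lemma measurable_hat n p (X : T -> 'M[R]_(n, p)) s : 0 < s ->
  (forall i j, measurable_fun setT (fun t => X t i j)) ->
  forall i j, measurable_fun setT (fun t => hat (X t) s i j).
Proof.
move=> s0 mX.
have mXt i j : measurable_fun setT (fun t => (X t)^T i j).
  by apply: (eq_measurable_fun (fun t => X t j i)) => // t _; rewrite mxE.
have mG := measurable_mulmx mX mXt.
apply: measurable_mulmx => //; apply: measurable_invmx; last first.
  by move=> t; exact: gram_shift_unit.
move=> i j.
apply: (eq_measurable_fun (fun t => (X t *m (X t)^T) i j + (s%:M : 'M[R]_n) i j)).
  by move=> t _; rewrite [in RHS]mxE.
exact: measurable_funD.
Qed.

End measurable_matrix.

(** * The in-sample risk as squared bias plus variance *)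

Section mse_risk.
Context (R : realType) (sigma_x : R) (n : nat) (m : ridge_model sigma_x n).
Let P := Prob m.
Let p := pdim m.

Let dmx (v : n.-tuple (p.-tuple R)) : 'M[R]_(n, p) :=
  \matrix_(i, j) tnth (tnth v i) j.

Let V (w : Omega m) : n.-tuple (p.-tuple R) := [tuple (xvar m i w : p.-tuple R) | i < n].

Let dmxV w : dmx (V w) = design w.
Proof. by apply/matrixP => i j; rewrite !mxE tnth_mktuple. Qed.

Let mdmx i j : measurable_fun setT (fun v => dmx v i j).
Proof.
apply: (eq_measurable_fun (fun v : n.-tuple (p.-tuple R) => tnth (tnth v i) j)).
  by move=> v _; rewrite mxE.
exact: (measurableT_comp (measurable_tnth j) (measurable_tnth i)).
Qed.

(** One matrix [H] serves both regimes. At zero penalty it is known only as a limit of hat matrices,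
    which is enough for its measurability and, later, for passing lower bounds on its Frobenius norm
    to the limit. *)
Lemma ridge_hat (tau : R) : 0 <= tau -> (0 < n)%N ->
  exists H : n.-tuple (p.-tuple R) -> 'M[R]_n,
  [/\ forall i j, measurable_fun setT (fun v => H v i j),
      forall v Y, dmx v *m ridge (dmx v) Y tau = H v *m Y,
      0 < tau -> forall v, H v = hat (dmx v) (n%:R * tau) &
      tau = 0 -> forall v i j, hat (dmx v) k.+1%:R^-1 i j @[k --> \oo] --> H v i j].
Proof.
rewrite le_eqVlt => /orP[/eqP <-|tau0] n0.
  have [M MP] := choice (fun v => ridge_pos_cvg (dmx v) n0).
  exists (fun v => dmx v *m M v); split => //.
  - move=> i j; apply: (measurable_fun_cvg (h := fun k v => hat (dmx v) k.+1%:R^-1 i j)).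
      move=> k; apply: measurable_hat => //; by rewrite invr_gt0.
    by move=> v _; exact: (MP v).2.
  - move=> v Y; rewrite /ridge ltxx -mulmxA; congr (_ *m _).
    apply: cvg_lim; first exact: norm_hausdorff.
    exact: (MP v).1.
  - by rewrite ltxx.
  - by move=> _ v i j; exact: (MP v).2.
have s0 : 0 < n%:R * tau by rewrite mulr_gt0// ltr0n.
exists (fun v => hat (dmx v) (n%:R * tau)); split => //.
- exact: measurable_hat.
- by move=> v Y; rewrite /ridge tau0 /ridge_pos /hat !mulmxA.
- by move=> t0; rewrite t0 ltxx in tau0.
Qed.

Lemma mse_ae (tau : R) (mse : Omega m -> R) : 0 <= tau -> (0 < n)%N ->
    is_MSE_in tau mse ->
  exists N, [/\ measurable N, P N = 0%E & forall w, ~ N w -> exists H : 'M[R]_n,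
    [/\ 0 < tau -> H = hat (design w) (n%:R * tau),
        tau = 0 -> forall i j, hat (design w) k.+1%:R^-1 i j @[k --> \oo] --> H i j &
        mse w = n%:R^-1 * (nsq (design w *m theta m - H *m (design w *m theta m)) +
                           sigma2 m * fro H)]].
Proof.
move=> tau0 n0 hM.
have [H [mH HY Hpos Hzero]] := ridge_hat tau0 n0.
have nR : 0 < n%:R :> R by rewrite ltr0n.
(* The factor [1 / n] is split as [c ^ 2] and absorbed into [b] and [H'], which puts the loss in the
   form [nsq (b + H' eps)]. *)
pose c : R := Num.sqrt n%:R^-1.
have c2 : c ^+ 2 = n%:R^-1 by rewrite sqr_sqrtr// invr_ge0 ltW.
pose b v := c *: (H v *m (dmx v *m theta m) - dmx v *m theta m).
pose H' v := c *: H v.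
have mV : measurable_fun setT V.
  apply/measurable_fun_tnthP => i.
  rewrite (_ : _ \o _ = xvar m i); first exact: measurable_xvar.
  by apply/funext => w /=; rewrite tnth_mktuple.
have mX := measurable_mulmx mdmx (fun i j => measurable_cst (theta m i j)).
have mb i : measurable_fun setT (fun v => b v i 0).
  apply: (eq_measurable_fun (fun v => c * ((H v *m (dmx v *m theta m)) i 0 - (dmx v *m theta m) i 0))).
    by move=> v _; rewrite !mxE.
  apply: measurable_funM => //; apply: measurable_funB; last exact: mX.
  exact: measurable_mulmx.
have mH' i j : measurable_fun setT (fun v => H' v i j).
  apply: (eq_measurable_fun (fun v => c * H v i j)).
    by move=> v _; rewrite mxE.
  exact: measurable_funM.
have me i : measurable_fun setT (eps m i) by exact: measurable_funPT.
have ce : cond_expectation_version P (g_sigma_algebra_preimage V)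
    (fun w => nsq (b (V w) + H' (V w) *m \col_i eps m i w)) mse.
  (* The tuple of all rows generates the same sigma-algebra as the family of rows. *)
  have -> : g_sigma_algebra_preimage V =
      g_sigma_preimage (fun i => xvar m i : _ -> p.-tuple R).
    rewrite -[LHS]/(preimage_set_system setT V (g_sigma_preimage (fun i (t : n.-tuple (p.-tuple R)) => tnth t i))).
    rewrite -g_sigma_preimage_comp; congr g_sigma_preimage.
    by apply/funext => i; apply/funext => w /=; rewrite tnth_mktuple.
  rewrite (_ : (fun w => nsq _) = in_sample_loss tau)//.
  apply/funext => w; rewrite /in_sample_loss /wnorm.
  set u := ridge _ _ _ - theta m.
  have e : (u^T *m sample_cov (design w) *m u) 0 0 = n%:R^-1 * nsq (design w *m u).
    rewrite /sample_cov -scalemxAr -scalemxAl mxE; congr (_ * _).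
    by rewrite /nsq dotv_mull /dotv !mulmxA.
  rewrite e sqr_sqrtr; last by rewrite mulr_ge0 ?nsq_ge0// invr_ge0 ltW.
  rewrite -c2 -nsqZ; congr nsq.
  rewrite /b /H' -scalemxAl -scalerDr; congr (_ *: _).
  rewrite /u mulmxBr -dmxV HY dmxV.
  have -> : response w = design w *m theta m + \col_i eps m i w.
    apply/matrixP => i j; rewrite ord1 !mxE /yvar; congr (_ + _).
    by rewrite mxE; apply: eq_bigr => k _; rewrite !mxE.
  by rewrite mulmxDr addrAC.
have [N [mN PN hN]] := cond_risk_ae me mV (@eps_has_mean _ _ _ m)
  (@ee_has_mean _ _ _ m) (@eps_xvar_indep _ _ _ m) mb mH' ce.
exists N; split => // w Nw; exists (H (V w)); split.
- by move=> t0; rewrite Hpos// dmxV.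
- by move=> t0 i j; have := Hzero t0 (V w) i j; rewrite dmxV.
- rewrite hN// /b /H' nsqZ c2 dmxV -nsqN opprB mulrDr; congr (_ + _).
  rewrite /fro [(c *: _)^T]linearZ/= -scalemxAl -scalemxAr scalerA -expr2 c2 mxtraceZ.
  by rewrite mulrCA.
Qed.

End mse_risk.

(** * Risk bounds with high probability *)

Section risk_bounds.
Context (R : realType) (sigma_x : R) (n : nat) (m : ridge_model sigma_x n).
Let P := Prob m.
Let p := pdim m.
Let d := ddim m.
Hypothesis n0 : (0 < n)%N.

(** The bound on the norm of [B B^T] given by the good event, divided by [n lambda_{d+1}]; it stays
    bounded as long as [r_d / n] does. *)
Definition op_cst : R := 4 * ln 384 * (4 * sigma_x ^+ 2) * (1 + r_d m / n%:R).

Let nR : 0 < n%:R :> R. Proof. by rewrite ltr0n. Qed.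
Let lamS0 : 0 < lam_dS m. Proof. exact: lam_gt0. Qed.
Let lam_d0 : 0 < lam_d m. Proof. exact: lam_gt0. Qed.

Lemma tail_trE : tail_tr d (lam m) = lam_dS m * r_d m.
Proof. by rewrite /r_d mulrC divfK// gt_eqF. Qed.

Lemma r_d_gt0 : 0 < r_d m.
Proof. by rewrite /r_d divr_gt0//; exact: (tail_tr_gt0 (ddim_lt m) (@lam_gt0 _ _ _ m)). Qed.

Let ln384 : 0 < ln 384 :> R. Proof. by rewrite ln_gt0// ltr1n. Qed.

Lemma op_cst_gt0 : 0 < op_cst.
Proof.
have s1 := sigma_x_ge1 m n0; have r0 := r_d_gt0.
have s2 : 0 < 4 * sigma_x ^+ 2 by rewrite mulr_gt0// exprn_gt0// (lt_le_trans _ s1).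
have r1 : 0 < 1 + r_d m / n%:R by rewrite addr_gt0// divr_gt0.
by apply: mulr_gt0 => //; apply: mulr_gt0 => //; apply: mulr_gt0.
Qed.

Let head_diag : 'M[R]_p := diag_mx (\row_j (j < d)%:R).
Let sq_diag : 'M[R]_p := diag_mx (\row_j Num.sqrt (lam m 0 j)).
Let isq_diag : 'M[R]_p := diag_mx (\row_j (Num.sqrt (lam m 0 j))^-1).
Let tdiag : 'M[R]_p := tail_diag d (lam m).

Let sqrt_gt0 j : 0 < Num.sqrt (lam m 0 j). Proof. by rewrite sqrtr_gt0; exact: lam_gt0. Qed.

Lemma head_signalE : head_signal m = nsq (head_diag *m (isq_diag *m theta m)).
Proof.
have inv : invmx (Sigma_head m) = diag_mx (\row_i (lam m 0 (head_idx i))^-1).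
  have u : Sigma_head m *m diag_mx (\row_i (lam m 0 (head_idx i))^-1) = 1%:M.
    rewrite /Sigma_head mulmx_diag -diag_const_mx; congr diag_mx.
    by apply/matrixP => i j; rewrite !mxE mulfV// gt_eqF// lam_gt0.
  have Su : Sigma_head m \in unitmx by case/mulmx1_unit: u.
  by rewrite -[RHS](mulKmx Su) u mulmx1.
rewrite /head_signal /wnorm inv.
have -> : ((theta_head m)^T *m diag_mx (\row_i (lam m 0 (head_idx i))^-1) *m theta_head m) 0 0 =
    \sum_i (theta m (head_idx i) 0) ^+ 2 / lam m 0 (head_idx i).
  rewrite mxE; apply: eq_bigr => i _; rewrite mul_mx_diag !mxE; ring.
rewrite sqr_sqrtr; last first.
  by apply: sumr_ge0 => i _; rewrite divr_ge0 ?sqr_ge0// ltW// lam_gt0.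
rewrite nsqE.
rewrite (eq_bigr (fun j : 'I_p => if (j < d)%N then theta m j 0 ^+ 2 / lam m 0 j else 0)); last first.
  move=> j _; rewrite !mul_diag_mx !mxE; case: ifP => _; last by rewrite mul0r expr0n.
  by rewrite mul1r exprMn exprVn sqr_sqrtr 1?mulrC// ltW// lam_gt0.
rewrite -big_mkcond/=.
by rewrite (big_ord_narrow (ltnW (ddim_lt m))).
Qed.

Lemma tail_signalE : tail_signal m = nsq (tdiag *m theta m).
Proof.
rewrite /tail_signal /wnorm.
have -> : ((theta_tail m)^T *m Sigma_tail m *m theta_tail m) 0 0 =
    \sum_i (theta m (tail_idx i) 0) ^+ 2 * lam m 0 (tail_idx i).
  rewrite mxE; apply: eq_bigr => i _; rewrite /Sigma_tail mul_mx_diag !mxE; ring.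
rewrite sqr_sqrtr; last first.
  by apply: sumr_ge0 => i _; rewrite mulr_ge0 ?sqr_ge0// ltW// lam_gt0.
rewrite nsqE.
rewrite (eq_bigr (fun j : 'I_p => if (d <= j)%N then theta m j 0 ^+ 2 * lam m 0 j else 0)); last first.
  move=> j _; rewrite mul_diag_mx mxE exprMn tail_row_sqr; last exact: lam_gt0.
  by case: ifP => _; rewrite ?mul0r 1?mulrC.
(* Extension by 0 to all naturals, so that the sum can be cut at [d] and shifted to indices counted
   from the tail. *)
pose F (k : nat) : R := if insub k is Some j then (if (d <= (j : 'I_p))%N then theta m j 0 ^+ 2 * lam m 0 j else 0) else 0.
rewrite [RHS](eq_bigr (fun j : 'I_p => F j)); last by move=> j _; rewrite /F valK.
have dp := ltnW (ddim_lt m).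
have z : \sum_(0 <= k < d) F k = 0.
  rewrite big_nat_cond big1// => k /andP[/andP[_ kd] _].
  by rewrite /F; case: insubP => // j _ jk; rewrite jk leqNgt kd.
rewrite -(big_mkord xpredT F) (@big_cat_nat _ _ _ d)//= z add0r.
have -> : \sum_(d <= k < p) F k = \sum_(0 + d <= k < p) F k by rewrite add0n.
rewrite big_addn big_mkord; apply: eq_bigr => i _.
have E : (i + d)%N = tail_idx i by rewrite /= addnC.
by rewrite /F E valK /= leq_addr.
Qed.

Lemma head_signal_ge0 : 0 <= head_signal m.
Proof. by rewrite head_signalE nsq_ge0. Qed.

Lemma tail_signal_ge0 : 0 <= tail_signal m.
Proof. by rewrite tail_signalE nsq_ge0. Qed.

Lemma sigma2_ge0 : 0 <= sigma2 m.
Proof.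
have := @ee_has_mean _ _ _ m (Ordinal n0) (Ordinal n0); rewrite eqxx => h.
by rewrite -lee_fin -h.2; apply: integral_ge0 => w _; rewrite lee_fin -expr2 sqr_ge0.
Qed.

Section on_good_event.
Variables (w : Omega m) (tau : R) (H : 'M[R]_n).
Let X := design w.
Let Z := white_mx (lam m) (fun i => xvar m i) w.
Let Lk : R := 4 * ln 384 * (4 * sigma_x ^+ 2).
Hypothesis gw : good (lam m) (fun i => xvar m i) (ddim_lt m) Lk w.
Hypothesis gv : nsq (Z *m (tdiag *m theta m)) <= 2 * n%:R * nsq (tdiag *m theta m).
Hypothesis tau0 : 0 <= tau.
Hypothesis Hpos : 0 < tau -> H = hat X (n%:R * tau).
Hypothesis Hzero : tau = 0 -> forall i j, hat X k.+1%:R^-1 i j @[k --> \oo] --> H i j.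

Let A := Z *m head_diag *m sq_diag.
Let B := Z *m tdiag.
Let q := op_cst.
Let s := n%:R * tau.
Let ell := n%:R * (q * lam_dS m).
Let f := theta m.
Let bias := X *m f - H *m (X *m f).

Let head_diag_idem : head_diag *m head_diag = head_diag.
Proof.
rewrite /head_diag mulmx_diag; congr diag_mx; apply/matrixP => i j.
by rewrite !mxE; case: (_ < _)%N; rewrite ?mulr1 ?mulr0.
Qed.

Let XE : X = A + B.
Proof.
apply/matrixP => i j; rewrite /A /B /tdiag /tail_diag -mulmxA mulmx_diag !mul_mx_diag !mxE.
have h := divfK (lt0r_neq0 (sqrt_gt0 j)).
case: ltnP => _; first by rewrite mul1r mulr0 addr0 h.
by rewrite mul0r mulr0 add0r h.
Qed.

Let AB0 : A *m B^T = 0.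
Proof.
have e : head_diag *m sq_diag *m tdiag^T = 0.
  rewrite tr_diag_mx !mulmx_diag; apply/matrixP => i j; rewrite !mxE.
  by case: ltnP => _; rewrite ?mulr0 ?mul0r ?mul0rn.
by rewrite /A /B trmx_mul !mulmxA -[Z *m _ *m _]mulmxA -[Z *m (_ *m _) *m _]mulmxA e mulmx0 mul0mx.
Qed.

Let q0 : 0 < q. Proof. exact: op_cst_gt0. Qed.
Let ell0 : 0 < ell. Proof. by apply: mulr_gt0 => //; apply: mulr_gt0. Qed.

Let Bop v : nsq (B^T *m v) <= ell * nsq v.
Proof.
have [_ _ h] := gw; rewrite (le_trans (h v))// ler_wpM2r ?nsq_ge0//.
rewrite tail_trE /ell /q /op_cst -/Lk -[lam m 0 _]/(lam_dS m).
by rewrite le_eqVlt; apply/orP; left; apply/eqP; ring.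
Qed.

Let froB : n%:R / 2 * (lam_dS m * r_d m) <= fro B <= 2 * n%:R * (lam_dS m * r_d m).
Proof.
have [_ h _] := gw; move: h; rewrite tail_trE ler_norml => /andP[h1 h2].
have lr : 0 <= n%:R * (lam_dS m * r_d m) by rewrite ltW// mulr_gt0// mulr_gt0// r_d_gt0.
apply/andP; split; rewrite /B /tdiag; lra.
Qed.

Let supp_head v : supported (head_set p d) (head_diag *m v).
Proof. by move=> j; rewrite inE mul_diag_mx !mxE => /negbTE ->; rewrite mul0r. Qed.

Let head_bounds v : n%:R / 2 * nsq (head_diag *m v) <= nsq (Z *m (head_diag *m v)) <=
  3 / 2 * n%:R * nsq (head_diag *m v).
Proof.
have [h _ _] := gw; have := h _ (supp_head v); rewrite ler_norml => /andP[h1 h2].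
apply/andP; split; lra.
Qed.

Let c10 : 0 < n%:R / 2 :> R. Proof. by rewrite divr_gt0. Qed.
Let head_tr : head_diag^T = head_diag. Proof. exact: tr_diag_mx. Qed.
Let low v : n%:R / 2 * nsq (head_diag *m v) <= nsq (Z *m (head_diag *m v)).
Proof. by case/andP: (head_bounds v). Qed.

Let up v : nsq (head_diag *m (Z^T *m v)) <= 3 / 2 * n%:R * nsq v.
Proof.
have c0 : 0 <= 3 / 2 * n%:R :> R by rewrite mulr_ge0.
have h u : nsq (Z *m head_diag *m u) <= 3 / 2 * n%:R * nsq u.
  rewrite -mulmxA; case/andP: (head_bounds u) => _ /le_trans; apply.
  by rewrite ler_wpM2l// nsq_proj.
by have := op_tr c0 h v; rewrite trmx_mul head_tr mulmxA.
Qed.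

Let tBf : nrm (B *m f) <= Num.sqrt (2 * n%:R) * Num.sqrt (tail_signal m).
Proof.
rewrite /nrm -sqrtrM ?mulr_ge0// ler_sqrt; last first.
  by rewrite mulr_ge0 ?tail_signal_ge0// mulr_ge0.
by rewrite tail_signalE /B -mulmxA.
Qed.

Let HS : nrm (head_diag *m (isq_diag *m f)) = Num.sqrt (head_signal m).
Proof. by rewrite head_signalE. Qed.

Let sq_isq : sq_diag *m isq_diag = 1%:M.
Proof.
rewrite mulmx_diag -diag_const_mx; congr diag_mx; apply/matrixP => i j.
by rewrite !mxE mulfV// gt_eqF.
Qed.

Let head_sq : head_diag *m sq_diag = sq_diag *m head_diag.
Proof. by rewrite !mulmx_diag; congr diag_mx; apply/matrixP => i j; rewrite !mxE mulrC. Qed.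

Let kap := 1 + q * lam_dS m / tau.

Let kapE : 0 < tau -> 1 + ell / s = kap.
Proof. by move=> t0; rewrite /kap /ell /s; congr (1 + _); field; rewrite !gt_eqF. Qed.

(** [bias_le] with [c1 = n / 2], squared. Both constants 16 come from
    [(2 (a + b)) ^ 2 <= 8 a ^ 2 + 8 b ^ 2] together with a factor 2: in [a ^ 2] it is due to [c1],
    in [b ^ 2] to the bound on the tail signal. *)
Lemma good_bias_le : 0 < tau ->
  nsq bias <= n%:R * (16 * kap ^+ 2 * tau ^+ 2 * head_signal m + 16 * tail_signal m).
Proof.
move=> t0; have s0 : 0 < s by rewrite mulr_gt0.
have := bias_le s0 ell0 AB0 Bop head_diag_idem head_tr (tr_diag_mx _)
  sq_isq head_sq erefl c10 low f.
rewrite -XE -/s -(Hpos t0) -/bias HS kapE//.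
set hs := Num.sqrt (head_signal m) => h.
have k1 : 1 <= kap by rewrite lerDl divr_ge0// ltW// mulr_gt0.
have hs0 : 0 <= hs by exact: sqrtr_ge0.
have hs2 : hs ^+ 2 = head_signal m by rewrite sqr_sqrtr// head_signal_ge0.
have c2 : Num.sqrt (n%:R / 2) ^+ 2 = n%:R / 2 :> R by rewrite sqr_sqrtr// ltW.
have cp : 0 < Num.sqrt (n%:R / 2) :> R by rewrite sqrtr_gt0.
have ts2 : nrm (B *m f) ^+ 2 <= 2 * n%:R * tail_signal m.
  rewrite sqr_nrm /B -mulmxA tail_signalE; exact: gv.
set a := kap * s * hs / Num.sqrt (n%:R / 2) in h.
have a2 : a ^+ 2 = 2 * n%:R * kap ^+ 2 * tau ^+ 2 * head_signal m.
  rewrite /a expr_div_n c2 !exprMn hs2 /s; field.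
  by rewrite gt_eqF.
have kp : 0 <= kap by rewrite (le_trans _ k1).
have a0 : 0 <= a.
  by apply: divr_ge0; [apply: mulr_ge0 => //; apply: mulr_ge0 => //; exact: ltW|exact: ltW].
have h2 : nsq bias <= 4 * (a + nrm (B *m f)) ^+ 2.
  rewrite -sqr_nrm (_ : 4 * _ = (2 * (a + nrm (B *m f))) ^+ 2); last by ring.
  by rewrite lerXn2r ?nnegrE// ?mulr_ge0 ?addr_ge0 ?nrm_ge0.
have := sqr_ge0 (a - nrm (B *m f)).
lra.
Qed.

(** [bias_ge] with [c1 = n / 2] and [c2 = 3 n / 2], divided by [sqrt n] and by [u = sqrt (1 / 2)].
    The remaining factors [u] and [v = sqrt (3 / 2)] are rounded up to 1 and 2. *)
Lemma good_bias_ge : 0 < tau ->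
  lam_d m * Num.sqrt (head_signal m) - 2 * Num.sqrt (tail_signal m) <=
  2 * Num.sqrt (n%:R^-1 * nsq bias) * (kap + lam_d m / tau).
Proof.
move=> t0; have s0 : 0 < s by rewrite mulr_gt0.
have c20 : 0 <= 3 / 2 * n%:R :> R by rewrite mulr_ge0.
have gap v : lam_d m * nrm (head_diag *m (isq_diag *m v)) <= nrm (head_diag *m (sq_diag *m v)).
  rewrite -(@ler_pXn2r _ 2)// ?nnegrE ?mulr_ge0 ?nrm_ge0 ?(ltW lam_d0)//.
  rewrite exprMn !sqr_nrm !nsqE mulr_sumr ler_sum// => j _.
  rewrite !mul_diag_mx !mxE; case: ltnP => jd; last by rewrite !mul0r expr0n mulr0.
  rewrite !mul1r !exprMn exprVn (sqr_sqrtr (ltW (lam_gt0 j))) mulrA ler_wpM2r ?sqr_ge0//.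
  have lj : lam_d m <= lam m 0 j.
    by apply: lam_nonincr => /=; rewrite -ltnS prednK// (ddim_gt0 m).
  by rewrite ler_pdivrMr ?lam_gt0// -expr2 lerXn2r ?nnegrE ?(ltW lam_d0) ?(ltW (lam_gt0 j)).
have := bias_ge s0 ell0 AB0 Bop head_diag_idem head_tr (tr_diag_mx _) sq_isq erefl
  c10 low f (ltW lam_d0) c20 up gap.
rewrite -XE -/s -(Hpos t0) -/bias HS kapE//.
set hs := Num.sqrt (head_signal m); set ts := Num.sqrt (tail_signal m) => h.
have nn : Num.sqrt n%:R ^+ 2 = n%:R :> R by rewrite sqr_sqrtr// ltW.
pose r := Num.sqrt n%:R : R.
have r0 : 0 < r by rewrite sqrtr_gt0.
pose b := Num.sqrt (n%:R^-1 * nsq bias).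
have bE : nrm bias = r * b.
  by rewrite /r /b -sqrtrM ?ler0n// mulrA divff ?mul1r// gt_eqF.
have b0 : 0 <= b by exact: sqrtr_ge0.
have k1 : 1 <= kap by rewrite lerDl divr_ge0// ltW// mulr_gt0.
pose u := Num.sqrt (1 / 2) : R.
have u0 : 0 < u by rewrite sqrtr_gt0.
have u2 : u ^+ 2 = 1 / 2 by rewrite sqr_sqrtr.
pose v := Num.sqrt (3 / 2) : R.
have v0 : 0 <= v by exact: sqrtr_ge0.
have v2 : v ^+ 2 = 3 / 2 by rewrite sqr_sqrtr.
have e1 : Num.sqrt (n%:R / 2) = r * u by rewrite /r /u -sqrtrM ?ler0n// mul1r.
have e2 : Num.sqrt (3 / 2 * n%:R) = v * r by rewrite /r /v -sqrtrM.
have e3 : Num.sqrt (2 * n%:R) = 2 * u * r.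
  have -> : 2 * u = Num.sqrt 2.
    apply/eqP; rewrite -(@eqrXn2 _ 2)// ?sqrtr_ge0 ?mulr_ge0 ?(ltW u0)//.
    by rewrite exprMn u2 sqr_sqrtr//; apply/eqP; lra.
  by rewrite /r -sqrtrM.
have tB := tBf; rewrite e3 -/ts in tB.
rewrite bE e1 e2 in h.
have {tB}h1 : r * u * lam_d m * (hs - v * r * (r * b) / s) <=
    kap * (r * b) + 2 * u * r * ts by rewrite (le_trans h)// lerD2l.
have sE : v * r * (r * b) / s = v * b / tau.
  by rewrite /s -nn -/r; field; rewrite !gt_eqF.
rewrite sE in h1.
have {}h1 : u * lam_d m * (hs - v * b / tau) <= kap * b + 2 * u * ts.
  by rewrite -(ler_pM2l r0); lra.
have h2 : lam_d m * (hs - v * b / tau) <= 2 * u * kap * b + 2 * ts.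
  rewrite -(ler_pM2l u0).
  have -> : u * (2 * u * kap * b + 2 * ts) = (2 * u ^+ 2) * (kap * b) + 2 * u * ts by ring.
  by rewrite u2; lra.
have lt0 : 0 <= b * (lam_d m / tau) by rewrite mulr_ge0// divr_ge0// ltW.
have vt : v <= 2 by nra.
have ut : u <= 1 by nra.
have h3 := ler_wpM2r lt0 vt.
have h4 : u * (kap * b) <= kap * b.
  by rewrite ler_piMl// mulr_ge0// (le_trans _ k1).
rewrite -/b.
have -> : lam_d m * hs - 2 * ts = lam_d m * (hs - v * b / tau) + v * (b * (lam_d m / tau)) - 2 * ts.
  ring.
have -> : 2 * b * (kap + lam_d m / tau) = 2 * (kap * b) + 2 * (b * (lam_d m / tau)) by ring.
lra.
Qed.

Lemma good_fro_le : 0 < tau ->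
  fro H <= d%:R + 2 * q * r_d m * (lam_dS m / tau) ^+ 2.
Proof.
move=> t0; have s0 : 0 < s by rewrite mulr_gt0.
have [Pr [Prt PrP PrZ trP]] := range_proj head_tr head_diag_idem c10 low.
have PA : Pr *m A = A by rewrite /A mulmxA PrZ.
have := fro_hat_le s0 AB0 Bop Prt PrP PA; rewrite -XE -/s -(Hpos t0) => h.
rewrite (le_trans h)// lerD//.
  rewrite trP /head_diag mxtrace_diag (eq_bigr (fun j : 'I_p => ((j < d)%N : nat)%:R)); last first.
    by move=> j _; rewrite mxE.
  rewrite -natr_sum ler_nat -big_mkcond/= sum1_card.
  rewrite (leq_trans _ (card_head (ddim_lt m)))//.
  by rewrite subset_leq_card//; apply/fintype.subsetP => j; rewrite !inE.
have [_ fB] := andP froB.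
rewrite ler_pdivrMr ?exprn_gt0//.
have e : 2 * q * r_d m * (lam_dS m / tau) ^+ 2 * s ^+ 2 = ell * (2 * n%:R * (lam_dS m * r_d m)).
  by rewrite /s /ell; field; rewrite gt_eqF.
by rewrite e ler_wpM2l// ltW.
Qed.

Let fro_ge_pos t : 0 < t ->
  (lam_dS m * r_d m / (2 * (q * lam_dS m + t))) ^+ 2 <= n%:R * fro (hat X (n%:R * t)).
Proof.
move=> t0; have s0 : 0 < n%:R * t by rewrite mulr_gt0.
have := fro_hat_ge s0 ell0 AB0 Bop; rewrite -XE; apply: le_trans.
have [fB _] := andP froB.
have es : 0 < ell + n%:R * t by rewrite addr_gt0.
have lr0 : 0 < lam_dS m * r_d m by rewrite mulr_gt0// r_d_gt0.
have qt : 0 < q * lam_dS m + t by rewrite addr_gt0// mulr_gt0.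
rewrite lerXn2r ?nnegrE ?divr_ge0 ?fro_ge0 ?(ltW es) ?(ltW lr0) ?mulr_ge0 ?(ltW qt)//.
rewrite ler_pdivlMr// (le_trans _ fB)// le_eqVlt; apply/orP; left; apply/eqP.
by rewrite /ell; field; rewrite gt_eqF.
Qed.

(** At zero penalty the bound is obtained in the limit from penalties so small that they stay below
    [op_cst] times [lambda_{d+1}]. Replacing such a penalty by this quantity doubles the
    denominator, hence the 4 in place of 2. *)
Lemma good_fro_ge :
  (lam_dS m * r_d m / (4 * (q * lam_dS m + tau))) ^+ 2 <= n%:R * fro H.
Proof.
have lr0 : 0 < lam_dS m * r_d m by rewrite mulr_gt0// r_d_gt0.
have ql0 : 0 < q * lam_dS m := mulr_gt0 q0 lamS0.
have [t0|] := ltP 0 tau.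
  rewrite (Hpos t0); apply: le_trans (fro_ge_pos t0).
  have qt : 0 < q * lam_dS m + tau by rewrite addr_gt0.
  rewrite lerXn2r ?nnegrE ?divr_ge0 ?(ltW lr0) ?mulr_ge0 ?(ltW qt)//.
  rewrite ler_pM2l// lef_pV2 ?posrE ?mulr_gt0//.
  by rewrite ler_wpM2r ?(ltW qt)// ler_nat.
move=> t0; have {t0}t0 : tau = 0 by apply/eqP; rewrite eq_le t0 tau0.
rewrite t0 addr0.
have cv : (n%:R * fro (hat X k.+1%:R^-1)) @[k --> \oo] --> n%:R * fro H.
  apply: cvgMr; rewrite fro_sum.
  under eq_fun do rewrite fro_sum.
  apply: cvg_big => [|i _]; first exact: add_continuous.
  apply: cvg_big => [|j _]; first exact: add_continuous.
  rewrite expr2; under eq_fun do rewrite expr2.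
  by apply: cvgM; exact: Hzero.
have lq : 0 < q * lam_dS m * n%:R := mulr_gt0 ql0 nR.
have key k : k.+1%:R^-1 <= q * lam_dS m * n%:R ->
    (lam_dS m * r_d m / (4 * (q * lam_dS m))) ^+ 2 <= n%:R * fro (hat X k.+1%:R^-1).
  move=> kq; have k0 : 0 < k.+1%:R^-1 :> R by rewrite invr_gt0.
  have := @fro_ge_pos (k.+1%:R^-1 / n%:R) (divr_gt0 k0 nR).
  rewrite [n%:R * (_ / _)]mulrC divfK ?gt_eqF//; apply: le_trans.
  have qt : 0 < q * lam_dS m + k.+1%:R^-1 / n%:R by rewrite addr_gt0// divr_gt0.
  have h4 : 0 < 4 * (q * lam_dS m) := mulr_gt0 (ltr0Sn R 3) ql0.
  have h2 : 0 < 2 * (q * lam_dS m + k.+1%:R^-1 / n%:R) := mulr_gt0 (ltr0Sn R 1) qt.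
  rewrite lerXn2r ?nnegrE ?divr_ge0 ?(ltW lr0) ?(ltW h2) ?(ltW h4)//.
  rewrite ler_pM2l// lef_pV2 ?posrE//.
  have : k.+1%:R^-1 / n%:R <= q * lam_dS m by rewrite ler_pdivrMr.
  have -> : 4 * (q * lam_dS m) = 2 * (q * lam_dS m + q * lam_dS m) by ring.
  by rewrite ler_pM2l// lerD2l.
apply: (cvgr_to_ge cv).
have := @cvg_harmonic R; move/cvgrPdist_le => /(_ _ lq).
apply: filterS => k; rewrite sub0r normrN ger0_norm ?invr_ge0//.
exact: key.
Qed.

End on_good_event.

(** The upper bound adds bias and variance; the first lower bound drops the bias, the second drops
    the variance. The one free of a sign condition on [tau] is the variance bound, which is how a
    vanishing penalty gets excluded. *)
Lemma mse_bounds (tau : R) (mse : Omega m -> R) : 0 <= tau -> is_MSE_in tau mse ->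
  let kap := 1 + op_cst * lam_dS m / tau in
  let rho := 2 * expR (- (n%:R * ((1 / 8) ^+ 2 / (128 * expR 1 * (4 * sigma_x ^+ 2) ^+ 2)))) in
  whp P (fun w =>
    [/\ 0 < tau -> mse w <= 16 * kap ^+ 2 * tau ^+ 2 * head_signal m + 16 * tail_signal m +
          sigma2 m / n%:R * (d%:R + 2 * op_cst * r_d m * (lam_dS m / tau) ^+ 2),
        sigma2 m * (lam_dS m * r_d m / (4 * (op_cst * lam_dS m + tau)) / n%:R) ^+ 2 <= mse w &
        0 < tau -> lam_d m * Num.sqrt (head_signal m) - 2 * Num.sqrt (tail_signal m) <=
          2 * Num.sqrt (mse w) * (kap + lam_d m / tau)])
    ((96 ^ d)%:R * rho + (rho + ((1 / 2) ^+ n + rho))).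
Proof.
move=> tau0 hM kap rho.
have [N [mN PN hN]] := mse_ae tau0 n0 hM.
have wN : whp P (fun w => ~ N w) 0 by exists N; split; rewrite ?PN.
have K1 := K_ge1 m n0.
have wG := whp_good n0 (ddim_gt0 m) (ddim_lt m) (@lam_gt0 _ _ _ m) (@lam_nonincr _ _ _ m)
  (measurable_xvar (m := m)) (xvar_indep (m := m)) K1 (white_has_mean (m := m))
  (white_exp (m := m)) (tail_diag d (lam m) *m theta m).
apply: (whp_le _ (whp_imp _ (whp_and wG wN))); first by rewrite addr0.
move=> w [[gw gv] Nw]; have [H [Hpos Hzero mseE]] := hN w Nw.
have ni : 0 < n%:R^-1 :> R by rewrite invr_gt0.
have s20 := sigma2_ge0.
split.
- move=> t0; rewrite mseE mulrDr; apply: lerD.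
    by rewrite ler_pdivrMl//; exact: good_bias_le gw gv tau0 Hpos t0.
  rewrite mulrA [n%:R^-1 * _]mulrC ler_wpM2l ?mulr_ge0 ?(ltW ni)//.
  exact: good_fro_le gw Hpos t0.
- rewrite mseE [n%:R^-1 * _]mulrDr.
  have h := good_fro_ge gw tau0 Hpos Hzero.
  have h1 : (lam_dS m * r_d m / (4 * (op_cst * lam_dS m + tau)) / n%:R) ^+ 2 <= n%:R^-1 * fro H.
    rewrite expr_div_n ler_pdivrMr ?exprn_gt0// (le_trans h)//.
    by rewrite le_eqVlt; apply/orP; left; apply/eqP; field; rewrite gt_eqF.
  rewrite [n%:R^-1 * (sigma2 m * _)]mulrCA (le_trans (ler_wpM2l s20 h1))// lerDr.
  by rewrite mulr_ge0 ?nsq_ge0// ltW.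
- move=> t0; have h := good_bias_ge gw gv tau0 Hpos t0.
  rewrite (le_trans h)//.
  have k0 : 0 <= kap + lam_d m / tau.
    rewrite addr_ge0// ?divr_ge0 ?(ltW lam_d0)// addr_ge0// divr_ge0//.
    by rewrite ltW// mulr_gt0// op_cst_gt0.
  rewrite ler_wpM2r// ler_wpM2l// ler_wsqrtr// mseE mulrDr lerDl.
  by rewrite mulr_ge0 ?(ltW ni)// mulr_ge0 ?fro_ge0.
Qed.

End risk_bounds.

(** * Deterministic inequalities between the rates *)

Section arith.
Context {R : realType}.

(** Here [S] and [D] stand for [lambda_{d+1}] and [lambda_d], [t] for the penalty, [hs] and [ts] for
    the head and tail signals, [r] for [r_d], [N] for the sample size and [a] for [sqrt (d / N)].
    The penalty and [S] are both of order at most [D a], so each bias term is at most a constant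
    times [hs D ^ 2 a ^ 2]. *)
Lemma upper_arith (S D t hs ts s2 q r N d a c A Q ch cs : R) :
    0 < S -> 0 < D -> 0 < t -> 0 <= hs -> 0 < N -> 0 <= d -> 0 < r ->
    0 <= q <= Q -> 1 <= c -> 1 <= A -> 0 <= a -> a ^+ 2 = d / N -> 0 <= s2 <= cs ->
    hs * D ^+ 2 <= ch -> S <= c * D * a -> ts <= hs * S ^+ 2 -> t <= A * c * D * a ->
    S <= A * t -> r * (S / t) ^+ 2 <= A ^+ 2 * c ^+ 2 * d ->
  16 * (1 + q * S / t) ^+ 2 * t ^+ 2 * hs + 16 * ts +
    s2 / N * (d + 2 * q * r * (S / t) ^+ 2) <=
  (16 * (1 + Q * A) ^+ 2 * (A ^+ 2 * c ^+ 2 * ch) + 16 * (c ^+ 2 * ch) +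
    cs * (1 + 2 * Q * (A ^+ 2 * c ^+ 2))) * (d / N).
Proof.
move=> S0 D0 t0 hs0 N0 d0 r0 /andP[q0 qQ] c1 A1 a0 a2 /andP[s20 s2c] hD SD tsS tD SA rS.
have Q0 : 0 <= Q by rewrite (le_trans q0).
have A0 : 0 <= A by lra.
have c0 : 0 <= c by lra.
have dN : 0 <= d / N by rewrite divr_ge0// ltW.
have St : S / t <= A by rewrite ler_pdivrMr.
have St0 : 0 <= S / t by rewrite divr_ge0// ltW.
have k1 : (1 + q * S / t) ^+ 2 <= (1 + Q * A) ^+ 2.
  rewrite -mulrA lerXn2r ?nnegrE ?(addr_ge0 ler01 (mulr_ge0 _ _))//.
  by rewrite lerD2l ler_pM.
have cDa0 : 0 <= c * D * a := mulr_ge0 (mulr_ge0 c0 (ltW D0)) a0.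
have AcDa0 : 0 <= A * c * D * a := mulr_ge0 (mulr_ge0 (mulr_ge0 A0 c0) (ltW D0)) a0.
have Ac0 : 0 <= A ^+ 2 * c ^+ 2 := mulr_ge0 (sqr_ge0 A) (sqr_ge0 c).
have tt : t ^+ 2 * hs <= A ^+ 2 * c ^+ 2 * ch * (d / N).
  have h : t ^+ 2 <= (A * c * D * a) ^+ 2.
    by rewrite lerXn2r ?nnegrE ?(ltW t0).
  apply: (le_trans (ler_wpM2r hs0 h)).
  rewrite !exprMn a2.
  have h2 : 0 <= A ^+ 2 * c ^+ 2 * (d / N) := mulr_ge0 Ac0 dN.
  have := ler_wpM2l h2 hD; lra.
have tss : ts <= c ^+ 2 * ch * (d / N).
  apply: (le_trans tsS).
  have h : S ^+ 2 <= (c * D * a) ^+ 2.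
    by rewrite lerXn2r ?nnegrE ?(ltW S0).
  apply: (le_trans (ler_wpM2l hs0 h)).
  rewrite !exprMn a2.
  have h2 : 0 <= c ^+ 2 * (d / N) := mulr_ge0 (sqr_ge0 c) dN.
  have := ler_wpM2l h2 hD; lra.
have v1 : d + 2 * q * r * (S / t) ^+ 2 <= (1 + 2 * Q * (A ^+ 2 * c ^+ 2)) * d.
  have h1 : 0 <= r * (S / t) ^+ 2 by rewrite mulr_ge0 ?sqr_ge0// ltW.
  have h2 := ler_wpM2r h1 qQ.
  have h3 := ler_wpM2l Q0 rS.
  lra.
have v2 : s2 / N * (d + 2 * q * r * (S / t) ^+ 2) <=
    cs * (1 + 2 * Q * (A ^+ 2 * c ^+ 2)) * (d / N).
  have e : cs * (1 + 2 * Q * (A ^+ 2 * c ^+ 2)) * (d / N) =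
      cs / N * ((1 + 2 * Q * (A ^+ 2 * c ^+ 2)) * d) by ring.
  rewrite e; apply: ler_pM => //.
  - by rewrite divr_ge0// ltW.
  - rewrite addr_ge0//; apply: mulr_ge0; last exact: sqr_ge0.
    by apply: mulr_ge0; [exact: mulr_ge0|exact: ltW].
  - by rewrite ler_wpM2r// invr_ge0 ltW.
have th0 : 0 <= t ^+ 2 * hs by rewrite mulr_ge0 ?sqr_ge0.
have b1 : (1 + q * S / t) ^+ 2 * (t ^+ 2 * hs) <=
    (1 + Q * A) ^+ 2 * (A ^+ 2 * c ^+ 2 * ch * (d / N)).
  by apply: ler_pM => //; exact: sqr_ge0.
lra.
Qed.

(* The lower bound on the variance forces [S g] below a multiple of [Q S + t]
   with [g = (r / N) / a] and [a = sqrt (d / N)]; as [g] diverges, the term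
   [Q S] can be absorbed. *)
Lemma tau_lower_arith (S t r N a s2 q Q cs C mu : R) :
    0 < S -> 0 <= t -> 0 < r -> 0 < N -> 0 < a -> 0 < q <= Q -> 0 < cs -> 1 <= cs * s2 ->
    0 < C -> s2 * (S * r / (4 * (q * S + t)) / N) ^+ 2 <= mu -> mu <= C * a ^+ 2 ->
    8 * Num.sqrt (cs * C) * Q <= r / N / a ->
  S * (r / N / a) <= 8 * Num.sqrt (cs * C) * t.
Proof.
move=> S0 t0 r0 N0 a0 /andP[q0 qQ] cs0 s2c C0 h1 h2 hg.
pose k := Num.sqrt (cs * C).
have k0 : 0 <= k by exact: sqrtr_ge0.
have k2 : k ^+ 2 = cs * C by rewrite sqr_sqrtr// mulr_ge0// ltW.
have qt : 0 < q * S + t by rewrite ltr_pwDl// mulr_gt0.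
pose v := S * r / (4 * (q * S + t)) / N.
have v0 : 0 <= v.
  by rewrite !divr_ge0// ?mulr_ge0// ltW.
have vk : v <= k * a.
  rewrite -(@ler_pXn2r _ 2)// ?nnegrE ?mulr_ge0 ?(ltW a0)// [(k * a) ^+ 2]exprMn k2.
  have := le_trans h1 h2; rewrite -/v => h.
  have h3 := ler_wpM2l (ltW cs0) h.
  have h4 := ler_wpM2r (sqr_ge0 v) s2c.
  lra.
have e : S * (r / N / a) = v / a * (4 * (q * S + t)).
  by rewrite /v; field; rewrite !gt_eqF.
have va : v / a <= k by rewrite ler_pdivrMr.
have h5 : S * (r / N / a) <= k * (4 * (q * S + t)).
  by rewrite e ler_wpM2r// mulr_ge0// ltW.
have h6 := ler_wpM2l (ltW S0) hg.
have h7 : k * (q * S) <= k * (Q * S) by rewrite ler_wpM2l// ler_wpM2r// ltW.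
rewrite -/k in hg h6 *; lra.
Qed.

(** The tail signal takes away at most a fraction [sqrt del] of [D sqrt hs], so the left side of the
    bias inequality is at least [(1 - sqrt del) h0]. The right side is at most
    [2 sqrt C a (1 + (Q + 1) D / t)]; the smallness of [a] makes the part without [D / t] at most
    half of the left side, and the rest bounds [t]. *)
Lemma tau_upper_arith (S D t a hs ts q Q h0 C mu del : R) :
    0 < S -> S <= D -> 0 < t -> 0 < a -> 0 <= hs -> 0 < q <= Q -> 0 < h0 -> 0 < C ->
    0 < del < 1 -> h0 <= D * Num.sqrt hs -> 4 * ts <= del * (S ^+ 2 * hs) ->
    D * Num.sqrt hs - 2 * Num.sqrt ts <= 2 * Num.sqrt mu * (1 + q * S / t + D / t) ->
    mu <= C * a ^+ 2 -> 4 * Num.sqrt C * a <= (1 - Num.sqrt del) * h0 ->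
  t <= 4 * Num.sqrt C * (Q + 1) / ((1 - Num.sqrt del) * h0) * (D * a).
Proof.
move=> S0 SD t0 a0 hs0 /andP[q0 qQ] h00 C0 /andP[d0 d1] hD tsS main muC small.
have D0 : 0 < D by rewrite (lt_le_trans S0).
pose e := Num.sqrt del.
have e0 : 0 <= e by exact: sqrtr_ge0.
have e2 : e ^+ 2 = del by rewrite sqr_sqrtr// ltW.
have e1 : e < 1 by nra.
pose k := Num.sqrt C.
have k0 : 0 <= k by exact: sqrtr_ge0.
pose x := Num.sqrt hs.
have x0 : 0 <= x by exact: sqrtr_ge0.
have ts1 : 2 * Num.sqrt ts <= e * (D * x).
  have [tn|tp] := ltP ts 0.
    by rewrite ltr0_sqrtr// mulr0 !mulr_ge0// ltW.
  rewrite -(@ler_pXn2r _ 2)// ?nnegrE ?mulr_ge0 ?sqrtr_ge0 ?(ltW D0)//.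
  rewrite !exprMn e2 !sqr_sqrtr//.
  have : S ^+ 2 <= D ^+ 2 by rewrite lerXn2r ?nnegrE ?(ltW S0) ?(ltW D0).
  move=> SD2; have := ler_wpM2l (ltW d0) (ler_wpM2r hs0 SD2).
  have -> : (2 : R) ^+ 2 = 4 by rewrite -natrX.
  lra.
have mk : Num.sqrt mu <= k * a.
  have -> : k * a = Num.sqrt (C * a ^+ 2).
    by rewrite sqrtrM ?(ltW C0)// sqrtr_sqr gtr0_norm.
  exact: ler_wsqrtr.
have y0 : 0 < D / t by rewrite divr_gt0.
have qS : q * S / t <= Q * (D / t).
  rewrite mulrAC -!mulrA ler_pM// ?(ltW q0)//.
  - by rewrite mulr_ge0// ?invr_ge0 ltW.
  - by rewrite mulrC ler_wpM2r// invr_ge0 ltW.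
have g0 : 0 < (1 - e) * h0 by rewrite mulr_gt0// subr_gt0.
have ka0 : 0 <= k * a by rewrite mulr_ge0// ltW.
have h1 : (1 - e) * h0 <= 2 * (k * a) * (1 + (Q + 1) * (D / t)).
  have hh : (1 - e) * h0 <= (1 - e) * (D * x) by rewrite ler_wpM2l// subr_ge0 ltW.
  have m1 : D * x - e * (D * x) <= 2 * Num.sqrt mu * (1 + q * S / t + D / t).
    by rewrite (le_trans _ main)// lerD2l lerN2.
  have m2 : 2 * Num.sqrt mu * (1 + q * S / t + D / t) <= 2 * (k * a) * (1 + (Q + 1) * (D / t)).
    apply: ler_pM.
    - by rewrite mulr_ge0// sqrtr_ge0.
    - rewrite !addr_ge0 ?(ltW y0)// ?mulr_ge0 ?invr_ge0// ltW//.
    - by rewrite ler_pM2l.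
    - lra.
  lra.
have h2 : (1 - e) * h0 <= 4 * (k * a) * ((Q + 1) * (D / t)).
  rewrite -/e -/k in small; lra.
rewrite -/e -/k mulrAC ler_pdivlMr// mulrC -ler_pdivlMr//.
apply: (le_trans h2); rewrite le_eqVlt; apply/orP; left; apply/eqP.
by field; rewrite gt_eqF.
Qed.

End arith.

Section whp_use.
Context d (T : measurableType d) (R : realType) (P : probability T R).

Lemma whp_prob (Q : T -> Prop) r : whp P Q r -> measurable [set w | Q w] ->
  ((1 - r)%:E <= P [set w | Q w])%E.
Proof.
move=> [B [mB PB h]] mQ.
apply: (@le_trans _ _ (P (~` B))).
  rewrite probability_setC// EFinB; apply: leeB => //.
apply: le_measure; rewrite ?inE//.
exact: measurableC.
Qed.

(** Otherwise the event [S] would lie inside the exceptional set, whose probability is below [e]. *)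
Lemma whp_witness (Q S : T -> Prop) r e : whp P Q r -> r < e ->
  measurable [set w | S w] -> (e%:E <= P [set w | S w])%E -> exists w, S w /\ Q w.
Proof.
move=> [B [mB PB h]] re mS eS; apply: contrapT => nE.
have SB : [set w | S w] `<=` B.
  by move=> w Sw; apply: contrapT => nB; apply: nE; exists w; split=> //; exact: h.
have := le_trans eS (le_trans (le_measure P _ _ SB) PB).
rewrite !inE => /(_ mS mB); rewrite lee_fin => er.
by have := lt_le_trans re er; rewrite ltxx.
Qed.

End whp_use.

(** * Rates along a sequence of models *)

Section rho.
Context (R : realType).

(* [conc_cst / sigma ^ 4] is the exponent in [concentration] at [eta = 1 / 8]
   and [K = 4 sigma ^ 2]. *)
Definition conc_cst : R := (1 / 8) ^+ 2 / (128 * expR 1) / 16.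

(** Chosen so that [ln 96 = 2 conc_cst (abs_cst - 1)], which is at most [2 conc_cst abs_cst ^ 2]:
    this is the room needed to pay for [96 ^ d] net points. *)
Definition abs_cst : R := 1 + ln 96 / (2 * conc_cst).

Lemma conc_cst_gt0 : 0 < conc_cst.
Proof. by rewrite !divr_gt0 ?exprn_gt0 ?mulr_gt0 ?expR_gt0. Qed.

Lemma abs_cst_gt0 : 0 < abs_cst.
Proof.
rewrite ltr_pwDl// divr_ge0 ?ln_ge0 ?ler1n// mulr_ge0// ltW//.
exact: conc_cst_gt0.
Qed.

(* The terms bound the failure probabilities for the net of the first [d]
   coordinates, the trace of the tail, the norm of the tail and the tail signal. *)
Definition fail_prob (sigma : R) (n d : nat) : R :=
  let rho := 2 * expR (- (n%:R * ((1 / 8) ^+ 2 / (128 * expR 1 * (4 * sigma ^+ 2) ^+ 2)))) in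
  (96 ^ d)%:R * rho + (rho + ((1 / 2) ^+ n + rho)).

(* The condition on [d / n] makes [96 ^ d] at most the square root of
   [expR (n conc_cst / sigma ^ 4)]. *)
Lemma fail_prob_le (sigma : R) (n d : nat) : 1 <= sigma -> (0 < n)%N ->
  abs_cst * sigma ^+ 2 * Num.sqrt (d%:R / n%:R) < 1 / 2 ->
  fail_prob sigma n d <= 6 * expR (- (conc_cst / (2 * sigma ^+ 4))) ^+ n + (1 / 2) ^+ n.
Proof.
move=> s1 n0 h.
have nR : 0 < n%:R :> R by rewrite ltr0n.
have s0 : 0 < sigma by rewrite (lt_le_trans _ s1).
have s4 : 0 < sigma ^+ 4 by rewrite exprn_gt0.
have c0 := conc_cst_gt0.
have e0 : 0 < expR 1 :> R := expR_gt0 1.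
rewrite /fail_prob.
set x := n%:R * _; set rho := 2 * expR (- x).
have xE : x = n%:R * (conc_cst / sigma ^+ 4).
  by rewrite /x /conc_cst; field; rewrite !gt_eqF.
have rE : rho <= 2 * expR (- (conc_cst / (2 * sigma ^+ 4))) ^+ n.
  rewrite -expRM_natl ler_pM2l// ler_expR xE mulrN lerN2 ler_pM2l//.
  rewrite ler_pM2l// lef_pV2 ?posrE ?mulr_gt0//; lra.
have l96 : 0 <= ln 96 :> R by rewrite ln_ge0// ler1n.
have dn : d%:R * ln 96 <= x / 2.
  have C1 : 1 <= abs_cst by rewrite lerDl divr_ge0// mulr_ge0// ltW.
  have h2 : abs_cst ^+ 2 * sigma ^+ 4 * (d%:R / n%:R) < 1 / 4.
    have -> : abs_cst ^+ 2 * sigma ^+ 4 * (d%:R / n%:R) =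
        (abs_cst * sigma ^+ 2 * Num.sqrt (d%:R / n%:R)) ^+ 2.
      by rewrite [RHS]exprMn sqr_sqrtr ?divr_ge0//; ring.
    have -> : 1 / 4 = (1 / 2) ^+ 2 :> R by field.
    rewrite ltrXn2r ?nnegrE//.
    by rewrite mulr_ge0 ?sqrtr_ge0// mulr_ge0 ?sqr_ge0// ltW// (lt_le_trans _ C1).
  have h3 : ln 96 <= 2 * conc_cst * abs_cst ^+ 2.
    have c20 : 0 < 2 * conc_cst by rewrite mulr_gt0.
    have -> : ln 96 = 2 * conc_cst * (abs_cst - 1) :> R.
      by rewrite /abs_cst addrAC subrr add0r mulrC divfK// gt_eqF.
    rewrite ler_pM2l//; nra.
  rewrite xE.
  have dn0 : 0 <= d%:R / n%:R :> R by rewrite divr_ge0.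
  have h4 := ler_wpM2r dn0 h3.
  have h5 : d%:R / n%:R * ln 96 <= conc_cst / sigma ^+ 4 / 2.
    rewrite ler_pdivlMr// ler_pdivlMr//.
    have := ler_wpM2l (ltW c0) (ltW h2).
    have := ler_wpM2r (ltW s4) h4; nra.
  have := ler_wpM2l (ltW nR) h5.
  have -> : n%:R * (d%:R / n%:R * ln 96) = d%:R * ln 96 :> R by field; rewrite gt_eqF.
  lra.
have h96 : (96 ^ d)%:R * rho <= 2 * expR (- (conc_cst / (2 * sigma ^+ 4))) ^+ n.
  have -> : (96 ^ d)%:R = expR (d%:R * ln 96) :> R.
    by rewrite expRM_natl lnK ?posrE ?ltr0n// natrX.
  rewrite /rho mulrCA ler_pM2l// -expRD -expRM_natl ler_expR.
  have -> : n%:R * - (conc_cst / (2 * sigma ^+ 4)) = x / 2 - x.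
    by rewrite xE; field; rewrite gt_eqF.
  by rewrite lerD2r.
lra.
Qed.

Lemma fail_prob_small (sigma e : R) (d : nat -> nat) : 1 <= sigma -> 0 < e ->
  (\forall n \near \oo, abs_cst * sigma ^+ 2 * Num.sqrt ((d n)%:R / n%:R) < 1 / 2) ->
  \forall n \near \oo, fail_prob sigma n (d n) <= e.
Proof.
move=> s1 e0 h.
have c0 := conc_cst_gt0.
have s4 : 0 < sigma ^+ 4 by rewrite exprn_gt0// (lt_le_trans _ s1).
have a1 : `|expR (- (conc_cst / (2 * sigma ^+ 4)))| < 1.
  rewrite ger0_norm ?expR_ge0// -[ltRHS]expR0 ltr_expR oppr_lt0.
  by rewrite divr_gt0// mulr_gt0.
have h1 := cvg_expr a1.
have h2 : (1 / 2 : R) ^+ n @[n --> \oo] --> (0 : R).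
  by apply: cvg_expr; rewrite ger0_norm; lra.
near=> n.
have n0 : (0 < n)%N by near: n; exact: nbhs_infty_gt.
have hn : abs_cst * sigma ^+ 2 * Num.sqrt ((d n)%:R / n%:R) < 1 / 2 by near: n.
apply: (le_trans (fail_prob_le s1 n0 hn)).
have e1 : expR (- (conc_cst / (2 * sigma ^+ 4))) ^+ n <= e / 12.
  near: n; move/cvgrPdist_le : h1 => /(_ (e / 12) (divr_gt0 e0 (ltr0Sn _ _))).
  apply: filterS => n; rewrite sub0r normrN; exact: le_trans (ler_norm _).
have e2 : (1 / 2) ^+ n <= e / 2.
  near: n; move/cvgrPdist_le : h2 => /(_ (e / 2) (divr_gt0 e0 (ltr0Sn _ _))).
  apply: filterS => n; rewrite sub0r normrN; exact: le_trans (ler_norm _).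
lra.
Unshelve. all: by end_near. Qed.

End rho.

(** The two ranges of the penalty lead to the same five inequalities. They differ in the last one:
    for [r <= d] it follows from [S / t <= A], and for [r > d] from the factor [sqrt (r / d) / c] in
    the lower end of the range. *)
Lemma suff_arith (R : realType) (S D t r d a c A : R) :
    0 < S -> 0 < D -> 0 < r -> 0 < d -> 0 <= a -> 1 <= c -> 1 <= A ->
    S / D <= c * (a * Num.min 1 (Num.sqrt (d / r))) ->
    (if r <= d then A^-1 * S <= t <= A * S
     else A^-1 * S * Num.max (1 / c * Num.sqrt (r / d)) 1 <= t <=
       A * D * Num.min (c * a) 1) ->
  [/\ 0 < t, S <= c * D * a, t <= A * c * D * a, S <= A * t &
      r * (S / t) ^+ 2 <= A ^+ 2 * c ^+ 2 * d].
Proof.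
move=> S0 D0 r0 d0 a0 c1 A1 hr ht.
have c0 : 0 < c by lra.
have A0 : 0 < A by lra.
have hS : S <= c * D * a.
  have h : S / D <= c * a.
    by apply: (le_trans hr); rewrite ler_pM2l// ler_piMr// ge_min lexx.
  by move: h; rewrite ler_pdivrMr// => h; rewrite mulrAC.
have AS0 : 0 < A^-1 * S by rewrite mulr_gt0// invr_gt0.
have St : A^-1 * S <= t.
  move: ht; case: ifP => _ /andP[h _] //; apply: le_trans h.
  by rewrite ler_peMr ?(ltW AS0)// le_max lexx orbT.
have t0 : 0 < t := lt_le_trans AS0 St.
have SAt : S <= A * t by rewrite -ler_pdivrMl.
split => //.
- move: ht; case: ifP => _ /andP[_ h]; apply: (le_trans h).
    have := ler_wpM2l (ltW A0) hS; rewrite !mulrA//.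
  have -> : A * c * D * a = A * D * (c * a) by ring.
  by rewrite ler_wpM2l ?mulr_ge0 ?(ltW A0) ?(ltW D0)// ge_min lexx.
- have S2 : (S / t) ^+ 2 <= A ^+ 2.
    rewrite lerXn2r ?nnegrE ?(ltW A0) ?divr_ge0 ?(ltW S0) ?(ltW t0)//.
    by rewrite ler_pdivrMr.
  move: ht; case: ifP => [rd _|_ /andP[h _]].
    have h1 : r * (S / t) ^+ 2 <= d * A ^+ 2 by apply: ler_pM => //; [exact: ltW|exact: sqr_ge0].
    have h2 : 1 <= c ^+ 2 by rewrite exprn_ege1.
    have h3 := ler_wpM2l (mulr_ge0 (ltW d0) (sqr_ge0 A)) h2; lra.
  have {}h : A^-1 * S * (1 / c * Num.sqrt (r / d)) <= t.
    by apply: le_trans h; rewrite ler_pM2l// le_max lexx.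
  pose x := Num.sqrt (r / d).
  have x2 : x ^+ 2 = r / d by rewrite sqr_sqrtr// divr_ge0 ?ltW.
  have x0 : 0 <= x by exact: sqrtr_ge0.
  have h1 : S / t * x <= A * c.
    rewrite mulrAC ler_pdivrMr//.
    have := ler_wpM2l (ltW (mulr_gt0 A0 c0)) h; rewrite -/x.
    have -> : A * c * (A^-1 * S * (1 / c * x)) = S * x by field; rewrite !gt_eqF.
    by [].
  have h2 : (S / t * x) ^+ 2 <= (A * c) ^+ 2.
    by rewrite lerXn2r ?nnegrE ?mulr_ge0 ?invr_ge0 ?(ltW S0) ?(ltW t0) ?(ltW A0) ?(ltW c0).
  rewrite exprMn x2 [(A * c) ^+ 2]exprMn in h2.
  have -> : r * (S / t) ^+ 2 = (S / t) ^+ 2 * (r / d) * d by field; rewrite !gt_eqF.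
  by rewrite ler_wpM2r// ltW.
Qed.

Section model_facts.
Context (R : realType) (sigma_x : R) (n : nat) (m : ridge_model sigma_x n).

Lemma lam_dS_gt0 : 0 < lam_dS m. Proof. exact: lam_gt0. Qed.
Lemma lam_d_gt0 : 0 < lam_d m. Proof. exact: lam_gt0. Qed.
Lemma lam_dS_le : lam_dS m <= lam_d m.
Proof. by apply: lam_nonincr => /=; exact: leq_pred. Qed.

Lemma ddim_gt0R : 0 < (ddim m)%:R :> R.
Proof. by rewrite ltr0n; exact: ddim_gt0. Qed.

Lemma measurable_mse tau (mse : Omega m -> R) C : is_MSE_in tau mse ->
  measurable [set w | mse w <= C].
Proof.
move=> [_ Mi _]; have /measurable_EFinP mM := measurable_int _ Mi.
have := mM measurableT `]-oo, C]%classic (measurable_itv _).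
by rewrite setTI; congr measurable; apply/funext => w; rewrite /preimage/= in_itv.
Qed.

End model_facts.

(** * Sufficiency and necessity for a fixed sequence of models *)

Section sequence.
Context (R : realType) (sigma_x C1 delta1 : R).
Context (m : forall n : nat, ridge_model sigma_x n).
Context (tau : nat -> R) (mse : forall n : nat, Omega (m n) -> R).
Let r n := r_d (m n).
Let gg n := r n / n%:R * Num.sqrt (n%:R / (ddim (m n))%:R).
Hypothesis tau0 : forall n, 0 <= tau n.
Hypothesis hM : forall n, is_MSE_in (tau n) (@mse n).
Hypothesis hd : \forall n \near \oo,
  abs_cst R * sigma_x ^+ 2 * Num.sqrt (dn (m n)) < 1 / 2.
Hypothesis C10 : 0 < C1.
Hypothesis hr : \forall n \near \oo, r n / n%:R <= C1.
Hypothesis del : 0 < delta1 < 1.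
Hypothesis hsig : \forall n \near \oo, tail_signal (m n) / head_signal (m n)
  <= delta1 / (4 * (1 + sigma_x ^+ 2)) * lam_dS (m n) ^+ 2.
Hypothesis hs2 : same_order (fun n => sigma2 (m n)) (fun=> 1).
Hypothesis hhs : same_order (fun n => head_signal (m n) * lam_d (m n) ^+ 2) (fun=> 1).

Let s1 : 1 <= sigma_x. Proof. exact: sigma_x_ge1 (m 1%N) isT. Qed.

Let Q := 4 * ln 384 * (4 * sigma_x ^+ 2) * (1 + C1).

Let L0 : 0 < 4 * ln 384 * (4 * sigma_x ^+ 2).
Proof.
have h : 0 < ln 384 :> R by rewrite ln_gt0// ltr1n.
have h2 : 0 < sigma_x ^+ 2 by rewrite exprn_gt0// (lt_le_trans _ s1).
by apply: mulr_gt0; apply: mulr_gt0.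
Qed.

Let Q0 : 0 < Q. Proof. by rewrite mulr_gt0// addr_gt0. Qed.

Let qQ : \forall n \near \oo, 0 < op_cst (m n) <= Q.
Proof.
near=> n; have n0 : (0 < n)%N by near: n; exact: nbhs_infty_gt.
rewrite op_cst_gt0// /op_cst ler_pM2l// lerD2l.
by near: n.
Unshelve. all: by end_near. Qed.

Let hs_gt0 : \forall n \near \oo, 0 < head_signal (m n).
Proof.
have [_ [c c0 h]] := hhs; near=> n.
have : 1 <= c * (head_signal (m n) * lam_d (m n) ^+ 2) by near: n.
rewrite lt_def head_signal_ge0 andbT => h1; apply/eqP => h0.
by move: h1; rewrite h0 mul0r mulr0; lra.
Unshelve. all: by end_near. Qed.

Let ts_le : \forall n \near \oo,
  4 * tail_signal (m n) <= delta1 * (lam_dS (m n) ^+ 2 * head_signal (m n)).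
Proof.
near=> n.
have h0 : 0 < head_signal (m n) by near: n.
have : tail_signal (m n) / head_signal (m n)
  <= delta1 / (4 * (1 + sigma_x ^+ 2)) * lam_dS (m n) ^+ 2 by near: n.
rewrite ler_pdivrMr// => h.
have [d0 d1] := andP del.
have x0 : 0 <= lam_dS (m n) ^+ 2 * head_signal (m n) by rewrite mulr_ge0 ?sqr_ge0// ltW.
have h2 : delta1 / (4 * (1 + sigma_x ^+ 2)) <= delta1 / 4.
  rewrite ler_pM2l// lef_pV2 ?posrE ?mulr_gt0//; have := sqr_ge0 sigma_x; lra.
have := ler_wpM2r x0 h2; lra.
Unshelve. all: by end_near. Qed.

Lemma mse_whp_suff (A0 c : R) : 1 <= A0 -> 1 <= c ->
  (\forall n \near \oo, lam_dS (m n) / lam_d (m n) <=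
     c * (Num.sqrt (dn (m n)) * Num.min 1 (Num.sqrt ((ddim (m n))%:R / r n)))) ->
  (\forall n \near \oo,
     if r n <= (ddim (m n))%:R then
       A0^-1 * lam_dS (m n) <= tau n <= A0 * lam_dS (m n)
     else A0^-1 * lam_dS (m n) * Num.max (1 / c * Num.sqrt (r n / (ddim (m n))%:R)) 1
       <= tau n <= A0 * lam_d (m n) * Num.min (c * Num.sqrt (dn (m n))) 1) ->
  mse_rate_whp mse.
Proof.
move=> A1 c1 hratio htau.
have [[cs cs0 hcs] _] := hs2; have [[ch ch0 hch] _] := hhs.
pose C := 16 * (1 + Q * A0) ^+ 2 * (A0 ^+ 2 * c ^+ 2 * ch) + 16 * (c ^+ 2 * ch) +
    cs * (1 + 2 * Q * (A0 ^+ 2 * c ^+ 2)).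
have C_gt0 : 0 < C.
  have c2 : 0 < c ^+ 2 by rewrite exprn_gt0// (lt_le_trans _ c1).
  have Ac : 0 <= A0 ^+ 2 * c ^+ 2 := mulr_ge0 (sqr_ge0 _) (sqr_ge0 _).
  have z1 : 0 <= 16 * (1 + Q * A0) ^+ 2 * (A0 ^+ 2 * c ^+ 2 * ch) :=
    mulr_ge0 (mulr_ge0 (ler0n _ _) (sqr_ge0 _)) (mulr_ge0 Ac (ltW ch0)).
  have z2 : 0 < c ^+ 2 * ch := mulr_gt0 c2 ch0.
  have z3 : 0 <= cs * (1 + 2 * Q * (A0 ^+ 2 * c ^+ 2)) :=
    mulr_ge0 (ltW cs0) (addr_ge0 ler01
      (mulr_ge0 (mulr_ge0 (ler0n _ 2) (ltW Q0)) Ac)).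
  move: z1 z2 z3; rewrite /C; lra.
exists C => //.
(* [C] is fixed before [e]: the risk bound on the good event does not involve [e], which only
   governs how large [n] must be. *)
have main e : 0 < e -> \forall n \near \oo,
    ((1 - e)%:E <= Prob (m n) [set w | (@mse n w <= C * dn (m n))%R])%E.
  move=> e0; near=> n.
  have n0 : (0 < n)%N by near: n; exact: nbhs_infty_gt.
  have fe : fail_prob sigma_x n (ddim (m n)) <= e.
    by near: n; exact: fail_prob_small.
  apply: whp_prob; last exact: measurable_mse (hM n).
  apply: (whp_le fe (whp_imp _ (mse_bounds n0 (tau0 n) (hM n)))) => w [h _ _].
  have S0 := lam_dS_gt0 (m n); have D0 := lam_d_gt0 (m n); have r0 := r_d_gt0 (m n).
  have d0 := ddim_gt0R (m n).
  have nR : 0 < n%:R :> R by rewrite ltr0n.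
  have a0 : 0 <= Num.sqrt (dn (m n)) by exact: sqrtr_ge0.
  have hrn : lam_dS (m n) / lam_d (m n) <=
     c * (Num.sqrt (dn (m n)) * Num.min 1 (Num.sqrt ((ddim (m n))%:R / r n))) by near: n.
  have htn : if r n <= (ddim (m n))%:R then
       A0^-1 * lam_dS (m n) <= tau n <= A0 * lam_dS (m n)
     else A0^-1 * lam_dS (m n) * Num.max (1 / c * Num.sqrt (r n / (ddim (m n))%:R)) 1
       <= tau n <= A0 * lam_d (m n) * Num.min (c * Num.sqrt (dn (m n))) 1 by near: n.
  have [t0 hS ht SA rS] := suff_arith S0 D0 r0 d0 a0 c1 A1 hrn htn.
  have q1 : 0 < op_cst (m n) <= Q by near: n.
  have hs0 : 0 < head_signal (m n) by near: n.
  have tsl : 4 * tail_signal (m n) <= delta1 * (lam_dS (m n) ^+ 2 * head_signal (m n)) by near: n.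
  apply: (le_trans (h t0)); rewrite /C /dn.
  apply: (upper_arith (a := Num.sqrt (dn (m n))) (D := lam_d (m n))) => //.
  - exact: ltW.
  - by case/andP: q1 => /ltW -> ->.
  - by rewrite sqr_sqrtr// divr_ge0.
  - by rewrite sigma2_ge0//=; have : sigma2 (m n) <= cs * 1; [near: n|rewrite mulr1].
  - have hq : head_signal (m n) * lam_d (m n) ^+ 2 <= ch * 1 by near: n.
    by rewrite mulr1 in hq.
  - have [dl0 dl1] := andP del.
    have x0 : 0 <= lam_dS (m n) ^+ 2 * head_signal (m n) by rewrite mulr_ge0 ?sqr_ge0// ltW.
    have := ler_wpM2r x0 (ltW dl1); lra.
apply/fine_cvgP; split.
  by apply: nearW => n; rewrite fin_num_measure//; exact: measurable_mse (hM n).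
apply/cvgrPdist_le => e e0; near=> n.
have mA : measurable [set w | (@mse n w <= C * dn (m n))%R] by exact: measurable_mse (hM n).
have h : ((1 - e)%:E <= Prob (m n) [set w | (@mse n w <= C * dn (m n))%R])%E.
  by near: n; exact: main.
have h2 := probability_le1 (Prob (m n)) mA.
have PE : (fine (Prob (m n) [set w | (@mse n w <= C * dn (m n))%R]))%:E =
  Prob (m n) [set w | (@mse n w <= C * dn (m n))%R] by rewrite fineK// fin_num_measure.
rewrite -PE !lee_fin in h h2; rewrite /= ger0_norm ?subr_ge0//; lra.
Unshelve. all: by end_near. Qed.

(** For large [n] the good event fails with probability at most [e / 2], so it meets the event of
    small risk. Keeping only the value [mu] of the risk at a common point makes the rest of the
    argument deterministic. *)
Lemma mse_bounds_near : mse_rate_bounded_away mse ->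
  exists2 C, 0 < C & \forall n \near \oo, exists mu,
    [/\ mu <= C * dn (m n),
        sigma2 (m n) * (lam_dS (m n) * r n /
          (4 * (op_cst (m n) * lam_dS (m n) + tau n)) / n%:R) ^+ 2 <= mu &
        0 < tau n ->
          lam_d (m n) * Num.sqrt (head_signal (m n)) - 2 * Num.sqrt (tail_signal (m n)) <=
          2 * Num.sqrt mu *
            (1 + op_cst (m n) * lam_dS (m n) / tau n + lam_d (m n) / tau n)].
Proof.
move=> [C [e [C0 e0 h]]]; exists C => //; near=> n.
have n0 : (0 < n)%N by near: n; exact: nbhs_infty_gt.
have fe : fail_prob sigma_x n (ddim (m n)) < e.
  apply: (@le_lt_trans _ _ (e / 2)); last by lra.
  by near: n; apply: fail_prob_small => //; exact: divr_gt0.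
have he : (e%:E <= Prob (m n) [set w | (@mse n w <= C * dn (m n))%R])%E by near: n.
have [w [hw [_ h1 h2]]] := whp_witness (mse_bounds n0 (tau0 n) (hM n)) fe
  (measurable_mse _ (hM n)) he.
by exists (mse w).
Unshelve. all: by end_near. Qed.

Let ggE n : gg n = r n / n%:R / Num.sqrt (dn (m n)).
Proof.
by rewrite /gg /dn -[X in Num.sqrt X]invf_div sqrtrV// divr_ge0.
Qed.

Let dn_gt0 n : (0 < n)%N -> 0 < dn (m n).
Proof. by move=> n0; rewrite divr_gt0 ?ddim_gt0R// ltr0n. Qed.

Let gg_gt0 n : (0 < n)%N -> 0 < gg n.
Proof.
move=> n0; rewrite ggE divr_gt0 ?sqrtr_gt0 ?dn_gt0// divr_gt0 ?ltr0n//.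
exact: r_d_gt0.
Qed.

Lemma gg_ge K : negligible_to (fun=> 1) gg -> \forall n \near \oo, K <= gg n.
Proof.
move=> /cvgrPdist_le h; near=> n.
have n0 : (0 < n)%N by near: n; exact: nbhs_infty_gt.
have g0 := gg_gt0 n0.
have K0 : 0 < `|K| + 1 by rewrite ltr_wpDl.
have : `|0 - 1 / gg n| <= (`|K| + 1)^-1.
  by near: n; apply: h; rewrite invr_gt0.
rewrite sub0r normrN ger0_norm ?divr_ge0 ?(ltW g0)// div1r lef_pV2 ?posrE//.
have := ler_norm K; lra.
Unshelve. all: by end_near. Qed.

Lemma sqrt_dn_le K : 0 < K ->
  negligible_to (fun n => (ddim (m n))%:R) (fun n => n%:R : R) ->
  \forall n \near \oo, Num.sqrt (dn (m n)) <= K.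
Proof.
move=> K0 /cvgrPdist_le /(_ (K ^+ 2) (exprn_gt0 _ K0)); apply: filterS => n.
rewrite sub0r normrN ger0_norm ?divr_ge0// => h.
by rewrite -(ger0_norm (ltW K0)) -sqrtr_sqr ler_wsqrtr.
Qed.

Lemma tau_lower : negligible_to (fun=> 1) gg -> mse_rate_bounded_away mse ->
  lesssim (fun n => lam_dS (m n) * gg n) tau.
Proof.
move=> hg /mse_bounds_near[C C0 hmu]; have [_ [cs cs0 hcs]] := hs2.
have k0 : 0 < Num.sqrt (cs * C) by rewrite sqrtr_gt0 mulr_gt0.
exists (8 * Num.sqrt (cs * C)); first by rewrite mulr_gt0.
near=> n.
have n0 : (0 < n)%N by near: n; exact: nbhs_infty_gt.
have [mu [mC h _]] : exists mu,
    [/\ mu <= C * dn (m n),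
        sigma2 (m n) * (lam_dS (m n) * r n /
          (4 * (op_cst (m n) * lam_dS (m n) + tau n)) / n%:R) ^+ 2 <= mu &
        0 < tau n ->
          lam_d (m n) * Num.sqrt (head_signal (m n)) - 2 * Num.sqrt (tail_signal (m n)) <=
          2 * Num.sqrt mu *
            (1 + op_cst (m n) * lam_dS (m n) / tau n + lam_d (m n) / tau n)] by near: n.
have q1 : 0 < op_cst (m n) <= Q by near: n.
have s2l : 1 <= cs * sigma2 (m n) by near: n.
have gl : 8 * Num.sqrt (cs * C) * Q <= gg n by near: n; exact: gg_ge.
have a0 : 0 < Num.sqrt (dn (m n)) by rewrite sqrtr_gt0 dn_gt0.
rewrite ggE in gl *.
apply: tau_lower_arith gl; last 2 first.
- exact: h.
- by rewrite sqr_sqrtr// ltW// dn_gt0.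
- exact: lam_dS_gt0.
- exact: tau0.
- exact: r_d_gt0.
- by rewrite ltr0n.
- exact: a0.
- exact: q1.
- exact: cs0.
- exact: s2l.
- exact: C0.
Unshelve. all: by end_near. Qed.

Lemma tau_upper : negligible_to (fun n => (ddim (m n))%:R) (fun n => n%:R : R) ->
  negligible_to (fun=> 1) gg -> mse_rate_bounded_away mse ->
  lesssim tau (fun n => lam_d (m n) * Num.sqrt (dn (m n))).
Proof.
move=> hdn hg hb; have [C C0 hmu] := mse_bounds_near hb.
have [M M0 hlow] := tau_lower hg hb.
have [_ [ch ch0 hch]] := hhs.
have [dl0 dl1] := andP del.
have sd : 0 < 1 - Num.sqrt delta1.
  rewrite subr_gt0 -[ltRHS]sqrtr1 ltr_sqrt//.
pose h0 := (Num.sqrt ch)^-1.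
have h00 : 0 < h0 by rewrite invr_gt0 sqrtr_gt0.
have C4 : 0 < 4 * Num.sqrt C by rewrite mulr_gt0 ?sqrtr_gt0.
have sh0 : 0 < (1 - Num.sqrt delta1) * h0 := mulr_gt0 sd h00.
exists (4 * Num.sqrt C * (Q + 1) / ((1 - Num.sqrt delta1) * h0)).
  by apply: divr_gt0 => //; apply: mulr_gt0 => //; exact: addr_gt0.
near=> n.
have n0 : (0 < n)%N by near: n; exact: nbhs_infty_gt.
have [mu [mC _ h]] : exists mu,
    [/\ mu <= C * dn (m n),
        sigma2 (m n) * (lam_dS (m n) * r n /
          (4 * (op_cst (m n) * lam_dS (m n) + tau n)) / n%:R) ^+ 2 <= mu &
        0 < tau n ->
          lam_d (m n) * Num.sqrt (head_signal (m n)) - 2 * Num.sqrt (tail_signal (m n)) <=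
          2 * Num.sqrt mu *
            (1 + op_cst (m n) * lam_dS (m n) / tau n + lam_d (m n) / tau n)] by near: n.
have q1 : 0 < op_cst (m n) <= Q by near: n.
have S0 := lam_dS_gt0 (m n); have D0 := lam_d_gt0 (m n).
(* The lower bound on the penalty excludes the value 0, and with it the bias inequality becomes
   available. *)
have t0 : 0 < tau n.
  have hl : lam_dS (m n) * gg n <= M * tau n by near: n.
  by rewrite -(pmulr_rgt0 _ M0) (lt_le_trans _ hl)// mulr_gt0// gg_gt0.
have a0 : 0 < Num.sqrt (dn (m n)) by rewrite sqrtr_gt0 dn_gt0.
have as_ : Num.sqrt (dn (m n)) <= (1 - Num.sqrt delta1) * h0 / (4 * Num.sqrt C).
  by near: n; apply: sqrt_dn_le => //; exact: divr_gt0.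
have tsl : 4 * tail_signal (m n) <= delta1 * (lam_dS (m n) ^+ 2 * head_signal (m n)) by near: n.
have hh : 1 <= ch * (head_signal (m n) * lam_d (m n) ^+ 2) by near: n.
apply: (tau_upper_arith S0 (lam_dS_le (m n)) t0 a0 (head_signal_ge0 (m n)) q1 h00 C0 del
  _ tsl (h t0)).
- rewrite /h0 -[X in X * _](ger0_norm (ltW D0)) -sqrtr_sqr -sqrtrM ?sqr_ge0//.
  rewrite -sqrtrV ?(ltW ch0)// ler_wsqrtr// -[leLHS]mulr1 ler_pdivrMl//.
  by rewrite [_ ^+ 2 * _]mulrC.
- by rewrite sqr_sqrtr// ltW// dn_gt0.
- by rewrite mulrC -ler_pdivlMr.
Unshelve. all: by end_near. Qed.

(** Writing [a = sqrt (d / n)] and [g = (r / n) / a], the two bounds on the penalty chain to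
    [lambda_{d+1} g <= M N lambda_d a], and [a / g = d / r]. *)
Lemma ratio_le : negligible_to (fun n => (ddim (m n))%:R) (fun n => n%:R : R) ->
  negligible_to (fun=> 1) gg -> mse_rate_bounded_away mse ->
  lesssim (fun n => lam_dS (m n) / lam_d (m n)) (fun n => (ddim (m n))%:R / r n).
Proof.
move=> hdn hg hb.
have [M M0 hlow] := tau_lower hg hb; have [N N0 hup] := tau_upper hdn hg hb.
exists (M * N); first exact: mulr_gt0.
near=> n.
have n0 : (0 < n)%N by near: n; exact: nbhs_infty_gt.
have nR : 0 < n%:R :> R by rewrite ltr0n.
have hl : lam_dS (m n) * gg n <= M * tau n by near: n.
have hu : tau n <= N * (lam_d (m n) * Num.sqrt (dn (m n))) by near: n.
have D0 := lam_d_gt0 (m n); have r0 : 0 < r n := r_d_gt0 (m n).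
have a0 : 0 < Num.sqrt (dn (m n)) by rewrite sqrtr_gt0 dn_gt0.
have hu2 := ler_wpM2l (ltW M0) hu.
rewrite ler_pdivrMr//.
have e : M * N * ((ddim (m n))%:R / r n) * lam_d (m n) =
    M * (N * (lam_d (m n) * Num.sqrt (dn (m n)))) / gg n.
  have d2 : (ddim (m n))%:R = Num.sqrt (dn (m n)) ^+ 2 * n%:R.
    by rewrite sqr_sqrtr ?(ltW (dn_gt0 n0))// divfK// gt_eqF.
  by rewrite ggE d2; field; rewrite !gt_eqF.
by rewrite e ler_pdivlMr ?gg_gt0// (le_trans hl).
Unshelve. all: by end_near. Qed.

End sequence.

Lemma lesssim_trans (R : realType) (u v w : nat -> R) :
  lesssim u v -> lesssim v w -> lesssim u w.
Proof.
move=> [c c0 h] [k k0 h2]; exists (c * k); first exact: mulr_gt0.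
apply: filterS2 h h2 => n a b; apply: (le_trans a).
by rewrite -mulrA ler_pM2l.
Qed.

(* For [r] of order [n] both rates are of order [d / n]. *)
Lemma suff_rate_same_order (R : realType) (d : nat -> nat) (r : nat -> R) :
  (forall n, 0 < r n) -> (forall n, (0 < d n)%N) ->
  (\forall n \near \oo, (d n <= n)%N) -> same_order r (fun n => n%:R) ->
  same_order
    (fun n => Num.sqrt ((d n)%:R / n%:R) * Num.min 1 (Num.sqrt ((d n)%:R / r n)))
    (fun n => (d n)%:R / r n).
Proof.
move=> r0 d0 dle [[k k0 hk] [l l0 hl]]; split.
- exists (Num.sqrt k); first by rewrite sqrtr_gt0.
  near=> n.
  have n0 : (0 < n)%N by near: n; exact: nbhs_infty_gt.
  have nR : 0 < n%:R :> R by rewrite ltr0n.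
  have dR : 0 < (d n)%:R :> R by rewrite ltr0n.
  have rk : r n <= k * n%:R by near: n.
  have dr : 0 < (d n)%:R / r n by rewrite divr_gt0.
  rewrite -[leRHS]/(_ * _) -[X in _ <= _ * X](sqr_sqrtr (ltW dr)) expr2.
  rewrite mulrA; apply: ler_pM; rewrite ?sqrtr_ge0 ?le_min ?ler01 ?sqrtr_ge0//.
    rewrite -sqrtrM ?(ltW k0)// ler_wsqrtr// mulrCA ler_pM2l//.
    by rewrite ler_pdivlMr// mulrC ler_pdivrMr.
  by rewrite ge_min lexx orbT.
- exists (Num.sqrt l * Num.max 1 (Num.sqrt l)).
    by rewrite mulr_gt0 ?sqrtr_gt0// lt_max ltr01.
  near=> n.
  have n0 : (0 < n)%N by near: n; exact: nbhs_infty_gt.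
  have nR : 0 < n%:R :> R by rewrite ltr0n.
  have dR : 0 < (d n)%:R :> R by rewrite ltr0n.
  have dn : (d n)%:R <= n%:R :> R by rewrite ler_nat; near: n.
  have rl : n%:R <= l * r n by near: n.
  have dr : 0 < (d n)%:R / r n by rewrite divr_gt0.
  set x := Num.sqrt ((d n)%:R / r n).
  have x0 : 0 < x by rewrite sqrtr_gt0.
  rewrite -[leLHS](sqr_sqrtr (ltW dr)) -/x.
  have h1 : x <= Num.sqrt l * Num.sqrt ((d n)%:R / n%:R).
    rewrite -sqrtrM ?(ltW l0)// ler_wsqrtr// mulrCA ler_pM2l//.
    by rewrite ler_pdivlMr// mulrC ler_pdivrMr.
  have h2 : x <= Num.max 1 (Num.sqrt l) * Num.min 1 x.
    have [x1|x1] := leP 1 x.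
      rewrite mulr1 le_max; apply/orP; right; rewrite (le_trans h1)//.
      rewrite ler_piMr ?sqrtr_ge0// -[leRHS]sqrtr1 ler_wsqrtr// ler_pdivrMr// mul1r//.
    by rewrite ler_peMl ?(ltW x0)// le_max lexx.
  have := ler_pM (ltW x0) (ltW x0) h1 h2; lra.
Unshelve. all: by end_near. Qed.

Theorem corollary2 (R : realType) :
  exists2 C0 : R, 0 < C0 &
  forall (sigma_x C1 delta1 A0 : R)
    (m : forall n : nat, ridge_model sigma_x n)
    (tau : nat -> R) (mse : forall n : nat, Omega (m n) -> R),
  let ratio n := lam_dS (m n) / lam_d (m n) in
  let d_over_n n := dn (m n) in
  let r n := r_d (m n) in
  let d_over_r n := (ddim (m n))%:R / r n in
  let suff_rate n :=
    Num.sqrt (d_over_n n) * Num.min 1 (Num.sqrt (d_over_r n)) in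
  let gg_quantity n :=
    r n / n%:R * Num.sqrt (n%:R / (ddim (m n))%:R) in
  (forall n, 0 <= tau n) ->
  (forall n, is_MSE_in (tau n) (@mse n)) ->
  (\forall n \near \oo, (ddim (m n) <= n)%N /\
     C0 * sigma_x ^+ 2 * Num.sqrt (d_over_n n) < 1 / 2) ->
  0 < C1 ->
  (\forall n \near \oo, r n / n%:R <= C1) ->
  0 < delta1 < 1 ->
  (\forall n \near \oo,
     tail_signal (m n) / head_signal (m n)
       <= delta1 / (4 * (1 + sigma_x ^+ 2)) * lam_dS (m n) ^+ 2) ->
  1 <= A0 ->
  (1 + A0) ^+ 2 < 4 * delta1^-1 ->
  same_order (fun n => sigma2 (m n)) (fun=> 1) ->
  same_order (fun n => head_signal (m n) * lam_d (m n) ^+ 2) (fun=> 1) ->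
  [/\ (* (i) *)
    (forall c : R, 1 <= c ->
      (\forall n \near \oo, ratio n <= c * suff_rate n) ->
      (\forall n \near \oo,
         if r n <= (ddim (m n))%:R then
           A0^-1 * lam_dS (m n) <= tau n <= A0 * lam_dS (m n)
         else
           A0^-1 * lam_dS (m n) *
             Num.max (1 / c * Num.sqrt (r n / (ddim (m n))%:R)) 1
           <= tau n <=
           A0 * lam_d (m n) * Num.min (c * Num.sqrt (d_over_n n)) 1) ->
      mse_rate_whp mse),
    (* (ii) *)
    (negligible_to (fun n => (ddim (m n))%:R) (fun n => n%:R : R) ->
     negligible_to (fun=> 1) gg_quantity ->
     64 * (Num.sqrt delta1 / (1 - Num.sqrt delta1)) < 1 ->
     mse_rate_bounded_away mse ->
     [/\ lesssim ratio d_over_r,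
         lesssim (fun n => lam_dS (m n) * gg_quantity n) tau &
         lesssim tau (fun n => lam_d (m n) * Num.sqrt (d_over_n n))])
   & (* the matched case *)
    (negligible_to (fun n => (ddim (m n))%:R) (fun n => n%:R : R) ->
     negligible_to (fun=> 1) gg_quantity ->
     64 * (Num.sqrt delta1 / (1 - Num.sqrt delta1)) < 1 ->
     same_order r (fun n => n%:R) ->
     (lesssim ratio suff_rate <-> lesssim ratio d_over_r))].
Proof.
exists (abs_cst R); first exact: abs_cst_gt0.
move=> sigma_x C1 delta1 A0 m tau mse /= tau0 hM hd C10 hr del hsig A1 _ hs2 hhs.
have hd2 : \forall n \near \oo,
    abs_cst R * sigma_x ^+ 2 * Num.sqrt (dn (m n)) < 1 / 2.
  by apply: filterS hd => n [].
split.
- by move=> c c1; exact: (mse_whp_suff tau0 hM hd2 C10 hr del hsig hs2 hhs A1 c1).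
- move=> hdn hg _ hb; split.
  + exact: (ratio_le tau0 hM hd2 C10 hr del hsig hs2 hhs hdn hg hb).
  + exact: (tau_lower tau0 hM hd2 hr hs2 hg hb).
  + exact: (tau_upper tau0 hM hd2 C10 hr del hsig hs2 hhs hdn hg hb).
- move=> _ _ _ hrn.
  have hdle : \forall n \near \oo, (ddim (m n) <= n)%N by apply: filterS hd => n [].
  have [h1 h2] := suff_rate_same_order (fun n => r_d_gt0 (m n)) (fun n => ddim_gt0 (m n))
    hdle hrn.
  by split=> h; [exact: lesssim_trans h h1|exact: lesssim_trans h h2].
Qed.
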